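(* Any element $u = F(z,\zeta,\bar z,\bar\zeta)$ of $\mathcal{H}$ can be sent to some element $u = F^{(7)}(z,\zeta,\bar z,\bar\zeta)$ of $\mathcal{H}^{(7)}$ by some (not necessarily unique) element of $RT$. Moreover, the ambiguity is controlled: any element $(f,g,\rho)\in RT$ sending one element $F^{(7)}\in\mathcal{H}^{(7)}$ to another element $F'^{(7)}\in\mathcal{H}^{(7)}$ has the form $$f(z,\zeta) = r\,e^{i\theta} z,\qquad g(z,\zeta) = e^{2i\theta}\zeta,\qquad \rho = r^2,$$ for some $r\in\mathbb{R}_+$, $\theta\in[0,2\pi)$.
   Context: Coordinates $(z,\zeta,w=u+iv)\in\mathbb{C}^3$. $RT$ denotes the group of rigid transformations of $\mathbb{C}^3$ fixing the origin, $(z,\zeta,w)\mapsto(f(z,\zeta),g(z,\zeta),\rho w)$, with $\rho\in\mathbb{R}^*$, $f,g$ holomorphic near $0\in\mathbb{C}^2$, $f(0,0)=g(0,0)=0$, and invertible Jacobian $\begin{pmatrix} f_z & f_\zeta\\ g_z & g_\zeta\end{pmatrix}$; group law given by composition. It acts on graphed hypersurfaces via the fundamental equation $F'(f(z,\zeta),g(z,\zeta),\overline{f(z,\zeta)},\overline{g(z,\zeta)}) = \rho F(z,\zeta,\bar z,\bar\zeta)$. $\mathcal{H}$ denotes the space of real analytic graphed hypersurfaces $\{u = F(z,\zeta,\bar z,\bar\zeta)\}$ with $F$ real-valued analytic near $0$, $F(0)=0$, no pluriharmonic monomials ($\partial_z^a\partial_\zeta^b F(0)=0$ for all $a,b$),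 Levi matrix $\begin{pmatrix} F_{z\bar z} & F_{z\bar\zeta}\\ F_{\zeta\bar z} & F_{\zeta\bar\zeta}\end{pmatrix}$ of rank $1$ everywhere, and 2-nondegenerate: $\begin{pmatrix} F_{z\bar z} & F_{z\bar\zeta}\\ F_{zz\bar z} & F_{zz\bar\zeta}\end{pmatrix}$ invertible at the origin. $\mathcal{H}^{(7)}\subset\mathcal{H}$ is the subspace of power series $u = F^{(7)} = \sum \frac{F^{(7)}_{a,b,c,d}}{a!\,b!\,c!\,d!} z^a\zeta^b\bar z^c\bar\zeta^d$ such that: $F^{(7)}_{a,b,1,0}=0$ for all $(a,b)\neq(1,0)$ and $F^{(7)}_{1,0,1,0}=1$; $F^{(7)}_{a,b,2,0}=0$ for all $(a,b)\neq(0,1)$ and $F^{(7)}_{0,1,2,0}=1$; $F^{(7)}_{3,0,0,1}=0$ and $F^{(7)}_{3,0,1,1}=F^{(7)}_{1,1,3,0}$ (i.e. this coefficient is real). *)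

(* Defs.v *)
(* mathcomp-analysis (realType, limn, cos/sin/pi) +
   mathcomp-real-closed complex numbers R[i]. *)
From HB Require Import structures.
From mathcomp Require Import all_ssreflect all_algebra.
From mathcomp Require Import complex.
From mathcomp Require Import reals topology normedtype sequences trigo.
Set Implicit Arguments. Unset Strict Implicit. Unset Printing Implicit Defensive.
Import Order.TTheory GRing.Theory Num.Theory.
Import numFieldNormedType.Exports.
Local Open Scope ring_scope.
Local Open Scope complex_scope.

Section Defs.
Variable R : realType.
Local Notation C := R[i].

(* A power series in (z, zeta, zbar, zetabar), given by its TAYLOR
   coefficients t a b c d (coefficient of z^a zeta^b zbar^c zetabar^d).
   The paper's coefficient F_{a,b,c,d} is a! b! c! d! * t a b c d (dcoef4). *)
Definition ser4 := nat -> nat -> nat -> nat -> C.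
(* A power series in (z, zeta), by its Taylor coefficients. *)
Definition ser2 := nat -> nat -> C.

Definition dcoef4 (F : ser4) (a b c d : nat) : C :=
  (a`! * b`! * c`! * d`!)%:R * F a b c d.

(* convergence (Cauchy estimates) : the series converges near 0 *)
Definition conv4 (F : ser4) : Prop :=
  exists r : R, 0 < r /\ exists M : R, forall a b c d,
    `|F a b c d| * r%:C ^+ (a + b + c + d) <= M%:C.
Definition conv2 (f : ser2) : Prop :=
  exists r : R, 0 < r /\ exists M : R, forall a b,
    `|f a b| * r%:C ^+ (a + b) <= M%:C.

(* partial sums and value of the series at the point (z, zeta, conj z, conj zeta) *)
Definition psum4 (F : ser4) (z w : C) (N : nat) : C :=
  \sum_(a < N) \sum_(b < N) \sum_(c < N) \sum_(d < N)
     F a b c d * z ^+ a * w ^+ b * (z^*) ^+ c * (w^*) ^+ d.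
Definition eval4 (F : ser4) (z w : C) : C :=
  Complex (limn (fun N => (complex.Re (psum4 F z w N) : R)))
          (limn (fun N => (complex.Im (psum4 F z w N) : R))).

Definition psum2 (f : ser2) (z w : C) (N : nat) : C :=
  \sum_(a < N) \sum_(b < N) f a b * z ^+ a * w ^+ b.
Definition eval2 (f : ser2) (z w : C) : C :=
  Complex (limn (fun N => (complex.Re (psum2 f z w N) : R)))
          (limn (fun N => (complex.Im (psum2 f z w N) : R))).

(* (Wirtinger) partial derivatives of power series, on Taylor coefficients *)
Definition Dz (F : ser4) : ser4 := fun a b c d => (a.+1)%:R * F a.+1 b c d.
Definition Dzeta (F : ser4) : ser4 := fun a b c d => (b.+1)%:R * F a b.+1 c d.
Definition Dzb (F : ser4) : ser4 := fun a b c d => (c.+1)%:R * F a b c.+1 d.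
Definition Dzetab (F : ser4) : ser4 := fun a b c d => (d.+1)%:R * F a b c d.+1.
Definition D2z (f : ser2) : ser2 := fun a b => (a.+1)%:R * f a.+1 b.
Definition D2zeta (f : ser2) : ser2 := fun a b => (b.+1)%:R * f a b.+1.

(* "near 0": on a polydisc of some positive radius *)
Definition near0 (P : C -> C -> Prop) : Prop :=
  exists e : R, 0 < e /\ forall z w : C, `|z| < e%:C -> `|w| < e%:C -> P z w.

(* Levi matrix [[F_{z zb}, F_{z zetab}], [F_{zeta zb}, F_{zeta zetab}]] at (z, zeta) *)
Definition levi_mx (F : ser4) (z w : C) : 'M[C]_2 :=
  \matrix_(i < 2, j < 2)
    eval4 ((if i == 0 :> nat then Dz else Dzeta)
             ((if j == 0 :> nat then Dzb else Dzetab) F)) z w.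

(* [[F_{z zb}, F_{z zetab}], [F_{zz zb}, F_{zz zetab}]] at the origin *)
Definition nondeg2_mx (F : ser4) : 'M[C]_2 :=
  \matrix_(i < 2, j < 2)
    eval4 ((if i == 0 :> nat then Dz else (fun G => Dz (Dz G)))
             ((if j == 0 :> nat then Dzb else Dzetab) F)) 0 0.

(* the space H *)
Definition in_H (F : ser4) : Prop :=
  conv4 F /\
  near0 (fun z w => complex.Im (eval4 F z w) = 0) /\                (* real-valued *)
  eval4 F 0 0 = 0 /\
  (forall a b : nat, eval4 (iter a Dz (iter b Dzeta F)) 0 0 = 0) /\
                                               (* no pluriharmonic terms *)
  near0 (fun z w => \rank (levi_mx F z w) = 1%N) /\        (* Levi rank 1 *)
  nondeg2_mx F \in unitmx.                                 (* 2-nondegenerate *)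

(* the subspace H^(7) *)
Definition in_H7 (F : ser4) : Prop :=
  in_H F /\
  (forall a b : nat, (a, b) != (1, 0)%N -> dcoef4 F a b 1 0 = 0) /\
  dcoef4 F 1 0 1 0 = 1 /\
  (forall a b : nat, (a, b) != (0, 1)%N -> dcoef4 F a b 2 0 = 0) /\
  dcoef4 F 0 1 2 0 = 1 /\
  dcoef4 F 3 0 0 1 = 0 /\
  dcoef4 F 3 0 1 1 = dcoef4 F 1 1 3 0.

(* rigid transformations (z, zeta, w) |-> (f(z,zeta), g(z,zeta), rho w) *)
Definition in_RT (f g : ser2) (rho : R) : Prop :=
  rho != 0 /\ conv2 f /\ conv2 g /\
  eval2 f 0 0 = 0 /\ eval2 g 0 0 = 0 /\
  (\matrix_(i < 2, j < 2)
     eval2 ((if j == 0 :> nat then D2z else D2zeta)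
              (if i == 0 :> nat then f else g)) 0 0) \in unitmx.

(* (f, g, rho) sends u = F to u = F' : the fundamental equation
   F'(f, g, conj f, conj g) = rho F, near the origin *)
Definition sends (f g : ser2) (rho : R) (F F' : ser4) : Prop :=
  near0 (fun z w => eval4 F' (eval2 f z w) (eval2 g z w) = rho%:C * eval4 F z w).

Definition expi (t : R) : C := Complex (cos t) (sin t).

End Defs.

(* Main.v *)
(** Everything is reduced to identities between Taylor coefficients: a convergent
    series F(z, zeta, conj z, conj zeta) vanishing near 0 has zero coefficients, so the
    fundamental equation, reality and the vanishing of the Levi determinant may be read
    off order by order in the conjugate variables.

    Write A, B, E, C for the holomorphic coefficients of zb, zetab, zb^2, zb zetab in F.
    If A = z, the part of the Levi determinant free of conjugates forces B to depend on z
    only. Existence then takes three changes of coordinates, each explicit up to the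
    inversion of (f, g): f = rho A gives A = z; f = z + conj k B, g = zeta - k z with a
    suitable k kills the z^3 term of B; f = z, g = 2 (E + conj nu B) gives E = zeta / 2, the
    remaining real parameter in nu making F_{3,0,1,1} real. Uniqueness compares the same
    slices of the fundamental equation: the zb and zetab slices give f = c z and
    g_z(0) = 0, the zb^2 and zb zetab slices give g = (c / conj c) zeta.

    The inverse of (f, g) is the limit of a Picard iteration which stabilizes
    coefficientwise and is bounded in a weighted l^1 norm. *)
Require Import Defs.
From HB Require Import structures.
From mathcomp Require Import all_ssreflect all_algebra.
From mathcomp Require Import complex.
From mathcomp Require Import reals topology normedtype sequences trigo.
From mathcomp Require Import boolp classical_sets.
From mathcomp Require Import ring lra.
Set Implicit Arguments. Unset Strict Implicit. Unset Printing Implicit Defensive.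
Import Order.TTheory GRing.Theory Num.Theory.
Import numFieldNormedType.Exports.
Local Open Scope ring_scope.
Local Open Scope complex_scope.
(* [complex_scope] would otherwise read [z^*] as [conjc z]. *)
Local Notation "z ^*" := (Num.conj z) : ring_scope.
Local Notation "z ^*" := (Num.conj z) : complex_scope.

(** * Unconditional sums *)

(** A change of coordinates always leads to rho F composed with the inverse (p, q) of (f, g). Each
    slice of the result along a conjugate monomial is a combination of slices of F composed with (p,
    q), weighted by conjugates of low Taylor coefficients of p and q. If f or g is chosen to be that
    very combination, the new slice is f(p, q) = z or g(p, q) / 2 = zeta / 2. The obstacle is
    circularity: the weights belong to the inverse of the map being chosen. So k and nu are
    prescribed first, and the low coefficients of the inverse are then checked to agree with them.
    For nu this agreement imposes one real equation, which is why just one real parameter is left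
    for F_{3,0,1,1}. It acts on that coefficient through F_{1,1,1,1}, which the Levi condition makes
    nonzero. On the analytic side, summation is unconditional, so that products and composites never
    depend on an enumeration; the limits over boxes that define values of series enter only through
    [lim_sums]. *)

Section Sums.
Variable R : realType.
Local Notation C := R[i].

(* Limit along the net of finite subsets. *)
Definition sums (I : eqType) (u : I -> C) (S : C) : Prop :=
  forall e : C, 0 < e -> exists s0 : seq I, forall s, uniq s ->
    {subset s0 <= s} -> `|\sum_(i <- s) u i - S| <= e.
(** In [C] the relation x <= y says that y - x is a nonnegative real. The empty sum makes [M] such a
    real, so bounds can stay in [C] without casts. *)
Definition asum (I : eqType) (u : I -> C) (M : C) : Prop :=
  forall s, uniq s -> \sum_(i <- s) `|u i| <= M.

Lemma ler_sum_subset (D : numDomainType) (I : eqType) (s t : seq I) (u : I -> D) :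
  uniq s -> uniq t -> {subset s <= t} -> (forall i, 0 <= u i) ->
  \sum_(i <- s) u i <= \sum_(i <- t) u i.
Proof.
move=> us ut sub u0; rewrite [leRHS](bigID (mem s)) /=.
have -> : \sum_(i <- t | i \in s) u i = \sum_(i <- s) u i.
  rewrite -big_filter; apply: perm_big; apply: uniq_perm => //; first exact: filter_uniq.
  by move=> i; rewrite mem_filter; case: (boolP (i \in s)) => //= /sub.
by rewrite lerDl sumr_ge0.
Qed.

Lemma normc_ge_Im (z : C) : `|complex.Im z|%:C <= `|z|.
Proof.
have := normc_ge_Re (z * 'i%C); rewrite ReiNIm normrN normrM.
by rewrite [X in _ * X]normc_def /= expr0n expr1n add0r sqrtr1 mulr1.
Qed.

(** The order of [C] is partial: e = 1 already equates the imaginary parts, after which the real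
    parts are compared. *)
Lemma ler_eps (x y : C) : (forall e, 0 < e -> x <= y + e) -> x <= y.
Proof.
case: x y => [a b] [c d] h.
have imE : d = b by have := h 1 ltr01; rewrite lecE => /andP[/eqP /=]; lra.
rewrite lecE /= imE eqxx /= leNgt; apply/negP => lt.
have e0 : 0 < ((a - c) / 2)%:C :> C by rewrite ltcR; lra.
by have := h _ e0; rewrite lecE /= => /andP[_]; lra.
Qed.

Lemma le0_eps (x : C) : (forall e, 0 < e -> `|x| <= e) -> x = 0.
Proof.
move=> h; apply/eqP; rewrite -normr_eq0 eq_le normr_ge0 andbT.
by apply: ler_eps => e e0; rewrite add0r h.
Qed.

Section Basics.
Variables (I : eqType).
Implicit Types (u v : I -> C).

Lemma asum_ge0 u M : asum u M -> 0 <= M.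
Proof. by move=> /(_ [::] isT); rewrite big_nil. Qed.

Lemma asum_le u v M : (forall i, `|u i| <= `|v i|) -> asum v M -> asum u M.
Proof. by move=> uv h s us; apply: le_trans (h s us); apply: ler_sum => i _. Qed.

Lemma sums_uniq u S T : sums u S -> sums u T -> S = T.
Proof.
move=> hS hT; apply/eqP; rewrite -subr_eq0; apply/eqP/le0_eps => e e0.
have e2 : 0 < e / 2 by rewrite divr_gt0.
have [s0 h0] := hS _ e2; have [s1 h1] := hT _ e2.
set s := undup (s0 ++ s1).
have us : uniq s by exact: undup_uniq.
have a0 : {subset s0 <= s} by move=> x xs; rewrite mem_undup mem_cat xs.
have a1 : {subset s1 <= s} by move=> x xs; rewrite mem_undup mem_cat xs orbT.
have := h0 s us a0; have := h1 s us a1; set X := \sum_(i <- s) _ => b1 b0.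
have -> : S - T = (X - T) - (X - S) by ring.
by rewrite (le_trans (ler_normB _ _))// [leRHS](splitr e) lerD.
Qed.

Lemma eq_sums u v S : (forall i, u i = v i) -> sums u S -> sums v S.
Proof.
move=> uv h e /h[s0 h0]; exists s0 => s us sub.
by rewrite -(eq_bigr _ (fun i _ => uv i)); apply: h0.
Qed.

Lemma sumsD u v S T : sums u S -> sums v T -> sums (fun i => u i + v i) (S + T).
Proof.
move=> hS hT e e0; have e2 : 0 < e / 2 by rewrite divr_gt0.
have [s0 h0] := hS _ e2; have [s1 h1] := hT _ e2.
exists (s0 ++ s1) => s us sub.
have a1 : {subset s0 <= s} by move=> x xs; rewrite sub // mem_cat xs.
have a2 : {subset s1 <= s} by move=> x xs; rewrite sub // mem_cat xs orbT.
rewrite big_split /= opprD addrACA (le_trans (ler_normD _ _))// [leRHS](splitr e).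
by rewrite lerD ?h0 ?h1.
Qed.

Lemma sumsZ a u S : sums u S -> sums (fun i => a * u i) (a * S).
Proof.
move=> hS e e0; have e2 : 0 < e / (`|a| + 1) by rewrite divr_gt0 ?ltr_wpDl.
have [s0 h0] := hS _ e2; exists s0 => s us sub.
rewrite -mulr_sumr -mulrBr normrM.
apply: (@le_trans _ _ (`|a| * (e / (`|a| + 1)))); first by rewrite ler_wpM2l ?h0.
rewrite mulrCA ler_piMr ?(ltW e0)// ler_pdivrMr ?ltr_wpDl// mul1r lerDl ler01//.
Qed.

Lemma sumsN u S : sums u S -> sums (fun i => - u i) (- S).
Proof. by move=> /(sumsZ (-1)); rewrite mulN1r; apply: eq_sums => i; rewrite mulN1r. Qed.

Lemma sumsB u v S T : sums u S -> sums v T -> sums (fun i => u i - v i) (S - T).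
Proof. by move=> hu /sumsN hv; apply: sumsD. Qed.

Lemma sums_conj u S : sums u S -> sums (fun i => (u i)^*) S^*.
Proof.
move=> hS e /hS[s0 h0]; exists s0 => s us sub.
by rewrite -rmorph_sum -rmorphB norm_conjC h0.
Qed.

Lemma sum_supp (u : I -> C) (s t : seq I) : uniq s -> uniq t -> {subset s <= t} ->
  (forall i, i \notin s -> u i = 0) -> \sum_(i <- t) u i = \sum_(i <- s) u i.
Proof.
move=> us ut sub h0; rewrite (bigID (mem s)) /= [X in _ + X]big1 ?addr0; last first.
  by move=> i /h0.
rewrite -big_filter; apply: perm_big; apply: uniq_perm => //.
  exact: filter_uniq.
by move=> i; rewrite mem_filter; case: (boolP (i \in s)) => //= /sub.
Qed.

Lemma sums_fin u (s : seq I) : uniq s -> (forall i, i \notin s -> u i = 0) ->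
  sums u (\sum_(i <- s) u i).
Proof.
move=> us h0 e e0; exists s => t ut sub.
by rewrite (sum_supp us ut sub h0) subrr normr0 ltW.
Qed.

Lemma sums_le u S M : sums u S -> asum u M -> `|S| <= M.
Proof.
move=> hS hM; apply: ler_eps => e /hS[s0 h0].
have sub : {subset s0 <= undup s0} by move=> x; rewrite mem_undup.
have := h0 _ (undup_uniq s0) sub; set X := \sum_(i <- _) _ => hX.
have -> : S = X - (X - S) by ring.
rewrite (le_trans (ler_normB _ _))// lerD //.
by rewrite (le_trans (ler_norm_sum _ _ _))// hM ?undup_uniq.
Qed.

(** Partial sums of a nonnegative family increase with the finite subset, so the net converges to
    their supremum. *)
Lemma sums_nneg (a : I -> R) (M : R) : (forall i, 0 <= a i) ->
  (forall s, uniq s -> \sum_(i <- s) a i <= M) -> exists S, sums (fun i => (a i)%:C) S.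
Proof.
move=> a0 aM.
pose A : set R := [set x | exists s, uniq s /\ x = \sum_(i <- s) a i]%classic.
have supA : has_sup A.
  split; first by exists 0, [::]; rewrite big_nil.
  by exists M => _ [s [us ->]]; apply: aM.
exists (sup A)%:C => e e0.
have eE : e = (complex.Re e)%:C by rewrite RRe_real // gtr0_real.
have e0' : 0 < complex.Re e by move: e0; rewrite {1}eE ltcR.
have [_ [s0 [us0 ->]] hs0] := sup_adherent e0' supA.
exists s0 => s us sub.
have h1 : \sum_(i <- s0) a i <= \sum_(i <- s) a i by exact: ler_sum_subset.
have h2 : \sum_(i <- s) a i <= sup A.
  by apply: ub_le_sup; [case: supA | exists s].
rewrite -(rmorph_sum (real_complex R)) -(rmorphB (real_complex R)) /=.
rewrite normc_def /= expr0n /= addr0 sqrtr_sqr {1}eE lecR distrC ger0_norm; lra.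
Qed.

Lemma sums_ex u M : asum u M -> exists S, sums u S.
Proof.
move=> hu.
have M0 := asum_ge0 hu.
have ME : M = (complex.Re M)%:C by rewrite RRe_real // ger0_real.
have nE i : `|u i| = (complex.Re `|u i|)%:C by rewrite RRe_real // normr_real.
have bd s : uniq s -> \sum_(i <- s) complex.Re `|u i| <= complex.Re M.
  move=> us; rewrite -lecR -ME rmorph_sum /= (le_trans _ (hu s us))//.
(* [u] is recovered from the nonnegative families |u|, |u| + Re u and |u| + Im u, whose finite sums
   are at most 2 M. *)
have pos (f : C -> R) : (forall z, `|f z|%:C <= `|z|) ->
    exists S, sums (fun i => (complex.Re `|u i| + f (u i))%:C) S.
  move=> hf; have hf' i : `|f (u i)| <= complex.Re `|u i|.
    by rewrite -lecR -nE.
  apply: (@sums_nneg _ (complex.Re M + complex.Re M)).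
    by move=> i; have := hf' i; rewrite ler_norml => /andP[]; lra.
  move=> s us; rewrite big_split /= lerD ?bd//.
  apply: le_trans (bd s us); apply: ler_sum => i _.
  by have := hf' i; rewrite ler_norml => /andP[].
have [S0 h0] : exists S, sums (fun i => (complex.Re `|u i| + 0)%:C) S.
  by apply: (pos (fun=> 0)) => z; rewrite normr0; exact: normr_ge0.
have [S1 h1] := pos (@complex.Re R) (@normc_ge_Re R).
have [S2 h2] : exists S, sums (fun i => (complex.Re `|u i| + complex.Im (u i))%:C) S.
  exact: (pos (@complex.Im R) normc_ge_Im).
exists (S1 - S0 + 'i%C * (S2 - S0)).
have := sumsD (sumsB h1 h0) (sumsZ 'i%C (sumsB h2 h0)).
apply: eq_sums => i; rewrite [RHS](complexE (u i)).
rewrite -!(rmorphB (real_complex R)); congr (_%:C + 'i%C * _%:C); ring.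
Qed.

End Basics.

Lemma sums_bij (I J : eqType) (h : J -> I) (h' : I -> J) (u : I -> C) S :
  cancel h h' -> cancel h' h -> sums u S -> sums (u \o h) S.
Proof.
move=> hK h'K hu e /hu[s0 h0]; exists (map h' s0) => s us sub.
have -> : \sum_(i <- s) (u \o h) i = \sum_(i <- map h s) u i by rewrite big_map.
apply: h0; first by rewrite map_inj_uniq //; apply: can_inj hK.
move=> x xs; apply/mapP; exists (h' x); last by rewrite h'K.
by apply: sub; apply: map_f.
Qed.

Lemma asum_bij (I J : eqType) (h : J -> I) (u : I -> C) M :
  injective h -> asum u M -> asum (u \o h) M.
Proof.
move=> hi hu s us; have := hu (map h s); rewrite map_inj_uniq // big_map; exact.
Qed.

(** Once the double sum and all row sums are known to exist, no absolute bound is needed: finitely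
    many rows are truncated at total error e / 2, with truncations large enough to cover [s0]. *)
Lemma sums_fst (I J : eqType) (u : I * J -> C) S (v : I -> C) :
  sums u S -> (forall i, sums (fun j => u (i, j)) (v i)) -> sums v S.
Proof.
move=> hu hv e e0; have e2 : 0 < e / 2 by rewrite divr_gt0.
have [s0 h0] := hu _ e2.
exists (map fst s0) => t ut sub.
pose e' := e / 2 / (size t).+1%:R.
have e'0 : 0 < e' by rewrite divr_gt0 ?ltr0n.
have [g hg] := choice (fun i => hv i _ e'0).
pose g' i := undup (g i ++ [seq k.2 | k <- s0 & k.1 == i]).
pose L := [seq (i, j) | i <- t, j <- g' i].
have uL : uniq L.
  apply: allpairs_uniq_dep => //; first by move=> i _; apply: undup_uniq.
  by move=> [i j] [i' j'] _ _ /= [-> ->].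
have sL : {subset s0 <= L}.
  move=> [i j] ij; apply/allpairsPdep; exists i, j; split=> //.
    by apply: sub; apply/mapP; exists (i, j).
  rewrite mem_undup mem_cat; apply/orP; right; apply/mapP; exists (i, j) => //.
  by rewrite mem_filter eqxx.
have b0 := h0 L uL sL.
have b1 : `|\sum_(k <- L) u k - \sum_(i <- t) v i| <= e / 2.
  rewrite big_allpairs_dep /= -sumrB (le_trans (ler_norm_sum _ _ _))//.
  apply: (@le_trans _ _ (\sum_(i <- t) e')).
    apply: ler_sum => i _; apply: hg; first exact: undup_uniq.
    by move=> j jg; rewrite mem_undup mem_cat jg.
  rewrite big_const_seq count_predT iter_addr_0 -[leLHS]mulr_natr /e' -[leLHS]mulrA.
  rewrite [leLHS](_ : _ = e / 2 * ((size t).+1%:R^-1 * (size t)%:R)) //.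
  by rewrite ler_piMr ?(ltW e2)// mulrC ler_pdivrMr ?ltr0n// mul1r ler_nat leqnSn.
have -> : \sum_(i <- t) v i - S =
  (\sum_(k <- L) u k - S) - (\sum_(k <- L) u k - \sum_(i <- t) v i) by ring.
by rewrite (le_trans (ler_normB _ _))// [leRHS](splitr e) lerD.
Qed.

Lemma sums_snd (I J : eqType) (u : I * J -> C) S (v : J -> C) :
  sums u S -> (forall j, sums (fun i => u (i, j)) (v j)) -> sums v S.
Proof.
move=> hu; apply: sums_fst (_ : sums (fun k : J * I => u (k.2, k.1)) S) => //.
by apply: (sums_bij (h := fun k : J * I => (k.2, k.1)) (h' := fun k => (k.2, k.1)) _ _ hu);
  case.
Qed.

(** Finite fibres turn a finite set of indices [i] into a finite set of indices [k], so grouping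
    preserves the limit of the net. *)
Lemma sums_fib (K I : eqType) (phi : K -> I) (fib : I -> seq K) (u : K -> C) S :
  (forall i, uniq (fib i)) -> (forall i k, (k \in fib i) = (phi k == i)) ->
  sums u S -> sums (fun i => \sum_(k <- fib i) u k) S.
Proof.
move=> uf mf hu e /hu[s0 h0]; exists (map phi s0) => t ut sub.
have -> : \sum_(i <- t) \sum_(k <- fib i) u k = \sum_(k <- [seq k | i <- t, k <- fib i]) u k.
  by rewrite big_allpairs_dep.
apply: h0.
  apply: allpairs_uniq_dep => // -[i k] [i' k'] /allpairsPdep[a [b [_ +]]] + /allpairsPdep[c [d [_ +]]].
  by rewrite !mf => /eqP <- [-> ->] /eqP <- [-> ->] /= ->.
move=> k ks; apply/allpairsPdep; exists (phi k), k; split => //.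
  by apply: sub; apply: map_f.
by rewrite mf.
Qed.

Lemma asum_pair (I J : eqType) (u : I * J -> C) (m : I -> C) M :
  (forall i, asum (fun j => u (i, j)) (m i)) -> asum m M -> asum u M.
Proof.
move=> hu hm s us.
pose t1 := undup (map fst s); pose t2 := undup (map snd s).
have uL : uniq [seq (i, j) | i <- t1, j <- t2].
  by apply: allpairs_uniq; rewrite ?undup_uniq // => -[? ?] [? ?] _ _ /= [-> ->].
have sub : {subset s <= [seq (i, j) | i <- t1, j <- t2]}.
  move=> [i j] ij; apply/allpairsP; exists (i, j) => /=.
  by rewrite !mem_undup; split => //; apply/mapP; exists (i, j).
apply: (@le_trans _ _ (\sum_(k <- [seq (i, j) | i <- t1, j <- t2]) `|u k|)).
  exact: ler_sum_subset.
rewrite big_allpairs_dep /=; apply: le_trans (hm t1 (undup_uniq _)).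
apply: ler_sum => i _; rewrite ger0_norm; last exact: asum_ge0 (hu i).
exact: hu (undup_uniq _).
Qed.

Lemma asumZ (I : eqType) a (u : I -> C) M : asum u M -> asum (fun i => a * u i) (`|a| * M).
Proof.
move=> hu s us; under eq_bigr do rewrite normrM.
by rewrite -mulr_sumr ler_wpM2l ?hu.
Qed.

(** The absolute bound gives existence of the double sum; its value then comes from summing along
    rows. *)
Lemma sums_prod (I J : eqType) (u : I -> C) (v : J -> C) S T M N :
  asum u M -> asum v N -> sums u S -> sums v T ->
  asum (fun k : I * J => u k.1 * v k.2) (M * N) /\
  sums (fun k : I * J => u k.1 * v k.2) (S * T).
Proof.
move=> aM aN hS hT.
have a : asum (fun k : I * J => u k.1 * v k.2) (M * N).
  apply: (asum_pair (m := fun i => `|u i| * N)) => [i|]; first exact: (asumZ (u i) aN).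
  have N0 := asum_ge0 aN.
  move=> s us; under eq_bigr do rewrite normrM normr_id (ger0_norm N0).
  by rewrite -mulr_suml ler_wpM2r ?aM.
split=> //; have [P hP] := sums_ex a.
have h1 : sums (fun i => T * u i) P.
  apply: (sums_fst hP) => i; rewrite mulrC; exact: (sumsZ (u i) hT).
by rewrite mulrC (sums_uniq (sumsZ T hS) h1).
Qed.

End Sums.

(** * Weighted families and Cauchy products *)

Section Weighted.
Variable R : realType.
Local Notation C := R[i].

Lemma asum_fib (K I : eqType) (phi : K -> I) (fib : I -> seq K) (u : K -> C) M :
  (forall i, uniq (fib i)) -> (forall i k, (k \in fib i) = (phi k == i)) ->
  asum u M -> asum (fun i => \sum_(k <- fib i) u k) M.
Proof.
move=> uf mf hu t ut.
apply: (@le_trans _ _ (\sum_(k <- [seq k | i <- t, k <- fib i]) `|u k|)).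
  by rewrite big_allpairs_dep; apply: ler_sum => i _; apply: ler_norm_sum.
apply: hu.
apply: allpairs_uniq_dep => // -[i k] [i' k'] /allpairsPdep[a [b [_ +]]] + /allpairsPdep[c [d [_ +]]].
by rewrite !mf => /eqP <- [-> ->] /eqP <- [-> ->] /= ->.
Qed.

Lemma asum_prod (I J : eqType) (u : I -> C) (v : J -> C) M N :
  asum u M -> asum v N -> asum (fun k : I * J => u k.1 * v k.2) (M * N).
Proof.
move=> aM aN; have [S hS] := sums_ex aM; have [T hT] := sums_ex aN.
by have [] := sums_prod aM aN hS hT.
Qed.

Section Single.
Variables (I : eqType) (w : I -> nat).
Implicit Types (F G : I -> C) (s M : C).

(** A weighted l^1 bound at radius [s] replaces the Cauchy estimates of [conv2] and [conv4] because
    it is submultiplicative under Cauchy products; [convP] shows that both express convergence near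
    0. *)
Definition bnd s F M := asum (fun i => F i * s ^+ w i) M.
Definition conv F := exists s M, 0 < s /\ bnd s F M.
Definition dom s (x : I -> C) := forall i, `|x i| <= s ^+ w i.

Lemma bnd_asum s F M x : 0 <= s -> bnd s F M -> dom s x -> asum (fun i => F i * x i) M.
Proof.
move=> s0 + dx; apply: asum_le => i.
by rewrite !normrM ler_wpM2l // (le_trans (dx i)) // ger0_norm ?exprn_ge0.
Qed.

Lemma bnd_le s s' F M : 0 <= s' -> s' <= s -> bnd s F M -> bnd s' F M.
Proof.
move=> s0 ss; apply: asum_le => i.
rewrite !normrM !normrX ler_wpM2l // (ger0_norm s0) ger0_norm ?(le_trans s0)//.
by rewrite lerXn2r // nnegrE (le_trans s0).
Qed.

Lemma bndW s F M M' : M <= M' -> bnd s F M -> bnd s F M'.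
Proof. by move=> MM h t ut; apply: le_trans (h t ut) MM. Qed.

Lemma bndD s F G M N : bnd s F M -> bnd s G N -> bnd s (fun i => F i + G i) (M + N).
Proof.
move=> hF hG t ut; apply: le_trans (lerD (hF t ut) (hG t ut)).
by rewrite -big_split /=; apply: ler_sum => i _; rewrite mulrDl ler_normD.
Qed.

Lemma bndZ s a F M : bnd s F M -> bnd s (fun i => a * F i) (`|a| * M).
Proof.
by move=> /(asumZ a); apply: asum_le => i; rewrite mulrA.
Qed.

Lemma convZ a F : conv F -> conv (fun i => a * F i).
Proof. by move=> [s [M [s0 h]]]; exists s, (`|a| * M); split=> //; apply: bndZ. Qed.

Lemma conv2s F G : conv F -> conv G ->
  exists s M N, [/\ 0 < s, bnd s F M & bnd s G N].
Proof.
move=> [s [M [s0 h]]] [t [N [t0 k]]].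
(* This radius lies below both s and t; it stands in for a minimum, the order of [C] being
   partial. *)
exists (s * t / (s + t)), M, N; split.
- by rewrite divr_gt0 ?mulr_gt0 ?addr_gt0.
- apply: bnd_le h; first by rewrite divr_ge0 ?mulr_ge0 ?addr_ge0 ?ltW.
  by rewrite ler_pdivrMr ?addr_gt0// ler_pM2l// lerDr ltW.
- apply: bnd_le k; first by rewrite divr_ge0 ?mulr_ge0 ?addr_ge0 ?ltW.
  by rewrite ler_pdivrMr ?addr_gt0// mulrC ler_pM2l// lerDl ltW.
Qed.

Lemma convD F G : conv F -> conv G -> conv (fun i => F i + G i).
Proof.
move=> hF /(conv2s hF)[s [M [N [s0 h k]]]].
by exists s, (M + N); split=> //; apply: bndD.
Qed.

Lemma eq_conv F G : (forall i, F i = G i) -> conv F -> conv G.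
Proof. by move=> FG [s [M [s0 h]]]; exists s, M; split => //; apply: asum_le h => i; rewrite FG. Qed.

Lemma convN F : conv F -> conv (fun i => - F i).
Proof. by move=> /(convZ (-1)); apply: eq_conv => i; rewrite mulN1r. Qed.

Lemma convB F G : conv F -> conv G -> conv (fun i => F i - G i).
Proof. by move=> hF /convN; apply: convD. Qed.

Lemma bnd_fin s F (t : seq I) : uniq t -> (forall i, i \notin t -> F i = 0) ->
  bnd s F (\sum_(i <- t) `|F i * s ^+ w i|).
Proof.
move=> ut h u uu.
set G := (fun i => `|F i * s ^+ w i|).
have -> : \sum_(i <- t) G i = \sum_(i <- undup (t ++ u)) G i.
  rewrite [RHS](@sum_supp _ _ G t) ?undup_uniq//; first by move=> i; rewrite mem_undup mem_cat => ->.
  by move=> i /h; rewrite /G => ->; rewrite mul0r normr0.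
apply: ler_sum_subset uu (undup_uniq _) _ _ => i; last exact: normr_ge0.
by rewrite mem_undup mem_cat => ->; rewrite orbT.
Qed.

Lemma conv_fin F (t : seq I) : uniq t -> (forall i, i \notin t -> F i = 0) -> conv F.
Proof. by move=> ut h; exists 1; eexists; split; [exact: ltr01 | exact: bnd_fin ut h]. Qed.

End Single.

(** * Cauchy products over an abstract index monoid with finite fibres *)

Section Mul.
Variables (I : eqType) (w : I -> nat) (add : I -> I -> I) (fib : I -> seq (I * I)).
Hypothesis fibU : forall i, uniq (fib i).
Hypothesis fibP : forall i k, (k \in fib i) = (add k.1 k.2 == i).
Hypothesis wD : forall i j, w (add i j) = (w i + w j)%N.
Implicit Types (F G : I -> C).

(* [fib i] lists the pairs of indices adding up to [i]. *)
Definition gmul F G i := \sum_(k <- fib i) F k.1 * G k.2.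

Lemma bnd_gmul s F G M N : bnd w s F M -> bnd w s G N -> bnd w s (gmul F G) (M * N).
Proof.
move=> hF hG; have := asum_fib fibU fibP (asum_prod hF hG).
apply: asum_le => i; rewrite /gmul mulr_suml le_eqVlt; apply/orP; left; apply/eqP.
congr `|_|; rewrite big_seq [RHS]big_seq; apply: eq_bigr => k; rewrite fibP => /eqP <-.
by rewrite wD exprD; ring.
Qed.

Lemma conv_gmul F G : conv w F -> conv w G -> conv w (gmul F G).
Proof.
move=> hF /(conv2s hF)[s [M [N [s0 h k]]]].
by exists s, (M * N); split=> //; apply: bnd_gmul.
Qed.

Lemma sums_gmul s F G M N x S T : 0 <= s -> bnd w s F M -> bnd w s G N -> dom w s x ->
  (forall i j, x (add i j) = x i * x j) ->
  sums (fun i => F i * x i) S -> sums (fun i => G i * x i) T ->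
  sums (fun i => gmul F G i * x i) (S * T).
Proof.
move=> s0 hF hG dx xM hS hT.
have [_] := sums_prod (bnd_asum s0 hF dx) (bnd_asum s0 hG dx) hS hT.
move=> /(sums_fib fibU fibP); apply: eq_sums => i.
rewrite /gmul mulr_suml big_seq [RHS]big_seq; apply: eq_bigr => k; rewrite fibP => /eqP <-.
by rewrite xM; ring.
Qed.
End Mul.

(* [Q j] is the series substituted for the [j]-th monomial; [low i] contains all [j]
   that can contribute to the coefficient [i]. *)
Section Kernel.
Variables (I J : eqType) (w : I -> nat) (Q : J -> I -> C) (low : I -> seq J).
Hypothesis lowU : forall i, uniq (low i).
Hypothesis Qlow : forall i j, j \notin low i -> Q j i = 0.

Definition kcomp (h : J -> C) i := \sum_(j <- low i) h j * Q j i.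

(** In the applications [m j] is r ^ wt j for a common bound r of the substituted series, so the
    assumption on [h] says that its norm at radius r is at most [M]. *)
Lemma kernel_asum (h m : J -> C) M s x : 0 <= s ->
  (forall j, bnd w s (Q j) (m j)) -> asum (fun j => h j * m j) M -> dom w s x ->
  asum (fun k : J * I => h k.1 * Q k.1 k.2 * x k.2) M.
Proof.
move=> s0 hQ hh dx.
have m0 j := asum_ge0 (hQ j).
apply: (asum_pair (m := fun j => `|h j| * m j)).
  move=> j; have := asumZ (h j) (bnd_asum s0 (hQ j) dx).
  by apply: asum_le => i /=; rewrite mulrA.
by apply: asum_le hh => j; rewrite !normrM normr_id.
Qed.

Lemma kernel_bnd (h m : J -> C) M s : 0 <= s ->
  (forall j, bnd w s (Q j) (m j)) -> asum (fun j => h j * m j) M ->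
  bnd w s (kcomp h) M.
Proof.
move=> s0 hQ hh t ut.
have dx : dom w s (fun i => s ^+ w i) by move=> i; rewrite ger0_norm ?exprn_ge0.
have a := kernel_asum s0 hQ hh dx.
pose L := [seq (j, i) | i <- t, j <- low i].
have uL : uniq L.
  apply: allpairs_uniq_dep => // -[i j] [i' j'] _ _ /= [-> ->] //.
apply: le_trans (a L uL); rewrite big_allpairs_dep /=.
apply: ler_sum => i _; rewrite mulr_suml; exact: ler_norm_sum.
Qed.

(** The double family is absolutely summable, so it may be summed by output coefficients or by
    substituted monomials; [T] is the common value. *)
Lemma kernel_sums (h m : J -> C) M s x (y : J -> C) : 0 <= s ->
  (forall j, bnd w s (Q j) (m j)) -> asum (fun j => h j * m j) M -> dom w s x ->
  (forall j, sums (fun i => Q j i * x i) (y j)) ->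
  exists T, sums (fun i => kcomp h i * x i) T /\ sums (fun j => h j * y j) T.
Proof.
move=> s0 hQ hh dx hy.
have [T hT] := sums_ex (kernel_asum s0 hQ hh dx).
exists T; split.
  apply: (sums_snd hT) => i /=; rewrite mulr_suml.
  apply: sums_fin (lowU i) _ => j /Qlow ->; by rewrite mulr0 mul0r.
apply: (sums_fst hT) => j /=; apply: eq_sums (sumsZ (h j) (hy j)) => i.
by rewrite mulrA.
Qed.
End Kernel.

(** If the coefficients below k vanish, the tail is at most (t / s)^(k+1) M, so |a k| is bounded by
    a multiple of t, for arbitrarily small t. *)
Lemma unique1 (a : nat -> C) (s M : C) : 0 < s -> bnd id s a M ->
  (forall t : C, 0 < t -> t <= s -> sums (fun n => a n * t ^+ n) 0) -> forall n, a n = 0.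
Proof.
move=> s0 hM h n; elim/ltn_ind: n => k IH.
have M0 := asum_ge0 hM.
have key (t : C) : 0 < t -> t <= s -> `|a k| <= t * (M / s ^+ k.+1).
  move=> t0 ts.
  have h1 : sums (fun n => if n == k then a n * t ^+ n else 0) (a k * t ^+ k).
    have := @sums_fin R _ (fun n => if n == k then a n * t ^+ n else 0) [:: k] isT.
    rewrite big_seq1 eqxx; apply => i; rewrite inE => /negbTE -> //.
  have h2 := sumsB (h t t0 ts) h1; rewrite sub0r in h2.
  have hb : asum (fun i => a i * t ^+ i - (if i == k then a i * t ^+ i else 0)) ((t / s) ^+ k.+1 * M).
    have ts0 : 0 <= (t / s) ^+ k.+1 by rewrite exprn_ge0 // divr_ge0 ?ltW.
    have := asumZ ((t / s) ^+ k.+1) hM; rewrite ger0_norm //.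
    apply: asum_le => i; case: (ltngtP i k) => [ik|ik|->].
    - by rewrite IH // !mul0r subr0 normr0.
    - rewrite subr0 [leRHS]normrM (ger0_norm ts0) !normrM mulrCA ler_wpM2l //.
      have -> : t ^+ i = (t / s) ^+ i * s ^+ i by rewrite -exprMn divfK // gt_eqF.
      have d0 : 0 <= t / s by rewrite divr_ge0 ?ltW.
      rewrite normrM ler_wpM2r // ger0_norm ?exprn_ge0 //.
      by apply: ler_wiXn2l ik => //; rewrite ler_pdivrMr // mul1r.
    - by rewrite subrr normr0.
  have := sums_le h2 hb; rewrite normrN normrM normrX (gtr0_norm t0) expr_div_n exprS.
  rewrite -[X in _ <= X](_ : t * (M / s ^+ k.+1) * t ^+ k = _); last by ring.
  by rewrite ler_pM2r // exprn_gt0.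
apply: le0_eps => e e0.
pose X := M / s ^+ k.
have X0 : 0 <= X by rewrite divr_ge0 // exprn_ge0 // ltW.
have eX : 0 < e + X by rewrite ltr_wpDr.
(* This t is at most s, and t X / s = e X / (e + X) is at most e. *)
apply: le_trans (key (s * e / (e + X)) _ _) _.
- by rewrite divr_gt0 // mulr_gt0.
- by rewrite ler_pdivrMr // ler_pM2l // lerDl.
have -> : M / s ^+ k.+1 = X / s by rewrite exprS /X invfM mulrCA mulrC.
have -> : s * e / (e + X) * (X / s) = e * (X / (e + X)).
  by clearbody X; field; rewrite !gt_eqF.
by rewrite ler_piMr ?(ltW e0) // ler_pdivrMr // mul1r lerDr ltW.
Qed.

(** The sum is a polynomial in tau k with infinitely many roots; its coefficient of degree m
    collects the terms with d i = m. *)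
Lemma sep (I : eqType) (s : seq I) (P : pred I) (f : I -> C) (d : I -> nat) (tau : nat -> C) :
  injective tau -> (forall k, \sum_(i <- s | P i) f i * tau k ^+ d i = 0) ->
  forall m, \sum_(i <- s | P i && (d i == m)) f i = 0.
Proof.
move=> ti h m.
pose p := \sum_(i <- s | P i) (f i)%:P * 'X^(d i).
have p0 : p = 0.
  apply: (@roots_geq_poly_eq0 _ p [seq tau k | k <- iota 0 (size p).+1]).
  - apply/allP => x /mapP[k _ ->]; apply/rootP; rewrite /p horner_sum.
    by apply: etrans (h k); apply: eq_bigr => i _; rewrite !hornerE.
  - by rewrite map_inj_uniq ?iota_uniq.
  - by rewrite size_map size_iota.
have h0 : p`_m = 0 by rewrite p0 coef0.
rewrite big_mkcondr /=; apply: etrans h0; rewrite /p coef_sum; apply: eq_bigr => i _.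
by rewrite coefCM coefXn eq_sym; case: eqP => _; rewrite ?mulr1 ?mulr0.
Qed.

End Weighted.

(** * Evaluation of convergent series *)

Section Eval.
Variable R : realType.
Local Notation C := R[i].

Definition I2 := (nat * nat)%type.
Definition I4 := (I2 * I2)%type.
Definition wt2 (i : I2) : nat := (i.1 + i.2)%N.
Definition wt4 (i : I4) : nat := (wt2 i.1 + wt2 i.2)%N.
Definition add2 (i j : I2) : I2 := (i.1 + j.1, i.2 + j.2)%N.
Definition add4 (i j : I4) : I4 := (add2 i.1 j.1, add2 i.2 j.2).
Definition fib2 (i : I2) : seq (I2 * I2) :=
  [seq ((k, l), (i.1 - k, i.2 - l)%N) | k <- iota 0 i.1.+1, l <- iota 0 i.2.+1].
Definition fib4 (i : I4) : seq (I4 * I4) :=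
  [seq ((k.1, l.1), (k.2, l.2)) | k <- fib2 i.1, l <- fib2 i.2].
Definition box2 (N : nat) : seq I2 := [seq (a, b) | a <- index_iota 0 N, b <- index_iota 0 N].
Definition box4 (N : nat) : seq I4 := [seq (i, j) | i <- box2 N, j <- box2 N].

Lemma fib2U i : uniq (fib2 i).
Proof. by apply: allpairs_uniq; rewrite ?iota_uniq // => -[a b] [c d] _ _ [-> ->]. Qed.
Lemma fib2P i k : (k \in fib2 i) = (add2 k.1 k.2 == i).
Proof.
case: i k => [i1 i2] [[a b] [c d]]; apply/allpairsP/eqP.
  move=> [[x y] []]; rewrite !mem_iota !add0n !ltnS => xi yi [-> -> -> ->].
  by rewrite /add2 /= !subnKC.
rewrite /add2 => -[<- <-]; exists (a, b).
by rewrite !mem_iota !add0n !ltnS !leq_addr /= !addKn.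
Qed.
Lemma fib4U i : uniq (fib4 i).
Proof.
by apply: allpairs_uniq; rewrite ?fib2U // => -[[? ?] [? ?]] [[? ?] [? ?]] _ _ [-> -> -> ->].
Qed.
Lemma fib4P i k : (k \in fib4 i) = (add4 k.1 k.2 == i).
Proof.
case: i k => [i1 i2] [[a b] [c d]]; apply/allpairsP/eqP => /=.
  move=> [[x y] /= []]; rewrite !fib2P => /eqP xi /eqP yi [-> -> -> ->].
  by rewrite /add4 /= xi yi.
rewrite /add4 /= => -[<- <-]; exists ((a, c), (b, d)).
by rewrite !fib2P /= !eqxx.
Qed.
Lemma wt2D i j : wt2 (add2 i j) = (wt2 i + wt2 j)%N.
Proof. by rewrite /wt2 /= addnACA. Qed.
Lemma wt4D i j : wt4 (add4 i j) = (wt4 i + wt4 j)%N.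
Proof. by rewrite /wt4 /= !wt2D addnACA. Qed.
Lemma box2U N : uniq (box2 N).
Proof. by apply: allpairs_uniq; rewrite ?iota_uniq // => -[a b] [c d] _ _ [-> ->]. Qed.
Lemma box4U N : uniq (box4 N).
Proof. by apply: allpairs_uniq; rewrite ?box2U // => -[a b] [c d] _ _ [-> ->]. Qed.
Lemma mem_box2 N i : (i \in box2 N) = (i.1 < N)%N && (i.2 < N)%N.
Proof.
case: i => a b; apply/allpairsP/andP => /=.
  by move=> [[x y] /= []]; rewrite !mem_index_iota => ? ? [-> ->].
by move=> [? ?]; exists (a, b); rewrite !mem_index_iota.
Qed.
Lemma mem_box4 N i : (i \in box4 N) = (i.1 \in box2 N) && (i.2 \in box2 N).
Proof.
case: i => a b; apply/allpairsP/andP => /=.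
  by move=> [[x y] /= [? ?]] [-> ->].
by move=> [? ?]; exists (a, b).
Qed.
Lemma box2_wt N i : (wt2 i < N)%N -> i \in box2 N.
Proof. by rewrite mem_box2 /wt2 => h; rewrite !(leq_ltn_trans _ h) // ?leq_addr ?leq_addl. Qed.
Lemma box4_wt N i : (wt4 i < N)%N -> i \in box4 N.
Proof.
by rewrite mem_box4 /wt4 => h; rewrite !box2_wt // (leq_ltn_trans _ h) // ?leq_addr ?leq_addl.
Qed.

Definition x2 (z w : C) (i : I2) : C := z ^+ i.1 * w ^+ i.2.
Definition x4 (z w : C) (i : I4) : C := x2 z w i.1 * (x2 z w i.2)^*.

Lemma x2M z w i j : x2 z w (add2 i j) = x2 z w i * x2 z w j.
Proof. by rewrite /x2 !exprD mulrACA. Qed.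
Lemma x4M z w i j : x4 z w (add4 i j) = x4 z w i * x4 z w j.
Proof. by rewrite /x4 !x2M rmorphM mulrACA. Qed.

Definition E2 (f : I2 -> C) z w : C := eval2 (fun a b => f (a, b)) z w.
Definition E4 (F : I4 -> C) z w : C := eval4 (fun a b c d => F ((a, b), (c, d))) z w.

(** [B N] contains every index of weight below N, hence eventually any given finite set: the limit
    along boxes is the limit of the net. *)
Lemma lim_sums (I : eqType) (u : I -> C) (B : nat -> seq I) (w : I -> nat) (p : nat -> C) S :
  (forall N, uniq (B N)) -> (forall N i, (w i < N)%N -> i \in B N) ->
  (forall N, p N = \sum_(i <- B N) u i) -> sums u S ->
  Complex (limn (fun N => (complex.Re (p N) : R))) (limn (fun N => (complex.Im (p N) : R))) = S.
Proof.
move=> Bu Bw pE hS.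
have key (f : C -> R) : (forall z, `|f z|%:C <= `|z|) -> (forall x y, f (x - y) = f x - f y) ->
    limn (fun N => (f (p N) : R)) = f S.
  move=> f1 fB; apply: cvg_lim => //; apply/cvgrPdist_le => e e0.
  have [|s0 h0] := hS e%:C; first by rewrite ltcR.
  exists (\max_(i <- s0) w i).+1 => // N /= hN.
  rewrite -fB -lecR (le_trans (f1 _)) // distrC pE; apply: h0 => // i is0.
  by apply: Bw; apply: leq_trans hN; rewrite ltnS (leq_bigmax_seq i).
rewrite !key; first by case: (S).
- exact: normc_ge_Im.
- by move=> [? ?] [? ?].
- exact: normc_ge_Re.
- by move=> [? ?] [? ?].
Qed.

Lemma sums_E2 f z w S : sums (fun i => f i * x2 z w i) S -> E2 f z w = S.
Proof.
apply: (lim_sums box2U (fun N i => @box2_wt N i)) => N.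
rewrite /psum2 /box2 big_allpairs big_mkord; apply: eq_bigr => a _.
by rewrite big_mkord; apply: eq_bigr => b _; rewrite /x2 /= mulrA.
Qed.

Lemma sums_E4 F z w S : sums (fun i => F i * x4 z w i) S -> E4 F z w = S.
Proof.
apply: (lim_sums box4U (fun N i => @box4_wt N i)) => N.
rewrite /psum4 /box4 /box2 big_allpairs big_allpairs big_mkord; apply: eq_bigr => a _.
rewrite big_mkord; apply: eq_bigr => b _.
rewrite big_allpairs big_mkord; apply: eq_bigr => c _.
rewrite big_mkord; apply: eq_bigr => d _.
by rewrite /x4 /x2 /= rmorphM !rmorphXn; ring.
Qed.

Lemma near0_mono (P Q : C -> C -> Prop) : (forall z w, P z w -> Q z w) -> near0 P -> near0 Q.
Proof. by move=> PQ [e [e0 h]]; exists e; split => // z w hz hw; apply/PQ/h. Qed.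

Lemma near0_and (P Q : C -> C -> Prop) : near0 P -> near0 Q -> near0 (fun z w => P z w /\ Q z w).
Proof.
move=> [e [e0 h]] [d [d0 k]]; exists (Num.min e d); split; first by rewrite lt_min e0.
move=> z w hz hw; split.
  by apply: h; [apply: lt_le_trans hz _|apply: lt_le_trans hw _]; rewrite lecR ge_min lexx.
by apply: k; [apply: lt_le_trans hz _|apply: lt_le_trans hw _]; rewrite lecR ge_min lexx orbT.
Qed.

Lemma gt0_real_complex (s : C) : 0 < s -> exists2 r : R, 0 < r & s = r%:C.
Proof.
move=> s0; have e : s = (complex.Re s)%:C by rewrite RRe_real // gtr0_real.
by exists (complex.Re s) => //; move: s0; rewrite {1}e ltcR.
Qed.

Lemma near0_ball (s : C) : 0 < s -> near0 (fun z w => `|z| < s /\ `|w| < s).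
Proof. by move=> /gt0_real_complex[r r0 ->]; exists r. Qed.

Lemma dom_ball (s : C) z w : `|z| < s -> `|w| < s -> dom wt2 s (x2 z w) /\ dom wt4 s (x4 z w).
Proof.
move=> zs ws.
have s0 : 0 <= s by rewrite (le_trans (normr_ge0 z)) ?ltW.
have h2 : dom wt2 s (x2 z w).
  move=> i; rewrite /x2 normrM !normrX exprD ler_pM ?exprn_ge0 //.
    by rewrite lerXn2r ?nnegrE // ltW.
  by rewrite lerXn2r ?nnegrE // ltW.
split=> // i; rewrite /x4 normrM norm_conjC exprD ler_pM //.
Qed.

Lemma near_sums2 f : conv wt2 f -> near0 (fun z w => sums (fun i => f i * x2 z w i) (E2 f z w)).
Proof.
move=> [s [M [s0 h]]]; apply: near0_mono (near0_ball s0) => z w [hz hw].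
have [S hS] := sums_ex (bnd_asum (ltW s0) h (dom_ball hz hw).1).
by rewrite (sums_E2 hS).
Qed.

Lemma near_sums4 F : conv wt4 F -> near0 (fun z w => sums (fun i => F i * x4 z w i) (E4 F z w)).
Proof.
move=> [s [M [s0 h]]]; apply: near0_mono (near0_ball s0) => z w [hz hw].
have [S hS] := sums_ex (bnd_asum (ltW s0) h (dom_ball hz hw).2).
by rewrite (sums_E4 hS).
Qed.

Lemma E4_0 F : E4 F 0 0 = F ((0, 0), (0, 0))%N.
Proof.
apply: sums_E4; have := @sums_fin R _ (fun i => F i * x4 0 0 i) [:: ((0, 0), (0, 0))%N] isT.
have e : x4 0 0 ((0, 0), (0, 0))%N = 1 by rewrite /x4 /x2 /= !expr0 !mulr1 rmorph1 mulr1.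
rewrite big_seq1 e mulr1; apply.
move=> [[a b] [c d]]; rewrite inE !xpair_eqE /x4 /x2 /= rmorphM !rmorphXn rmorph0 !expr0n.
by case: a => [|a]; case: b => [|b]; case: c => [|c]; case: d => [|d] //=; rewrite ?(mulr0, mul0r).
Qed.

Lemma E2_0 f : E2 f 0 0 = f (0, 0)%N.
Proof.
apply: sums_E2; have := @sums_fin R _ (fun i => f i * x2 0 0 i) [:: (0, 0)%N] isT.
have e : x2 0 0 (0, 0)%N = 1 by rewrite /x2 /= !expr0 !mulr1.
rewrite big_seq1 e mulr1; apply.
move=> [a b]; rewrite inE !xpair_eqE /x2 /= !expr0n.
by case: a => [|a]; case: b => [|b] //=; rewrite ?(mulr0, mul0r).
Qed.

Lemma asum_half : asum (fun n : nat => (2^-1 : C) ^+ n) 2.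
Proof.
move=> s us; pose N := (\max_(i <- s) i).+1.
have sub : {subset s <= iota 0 N}.
  by move=> i si; rewrite mem_iota /= add0n ltnS (leq_bigmax_seq i).
apply: (@le_trans _ _ (\sum_(i <- iota 0 N) `|(2^-1 : C) ^+ i|)).
  by apply: ler_sum_subset; rewrite ?iota_uniq.
have -> : \sum_(i <- iota 0 N) `|(2^-1 : C) ^+ i| = 2 - 2 * 2^-1 ^+ N.
  elim: (N) => [|n IH]; first by rewrite big_nil; ring.
  rewrite -addn1 iotaD big_cat /= IH big_seq1 add0n addn1 ger0_norm ?exprn_ge0 ?invr_ge0 //.
  by rewrite exprS; field.
by rewrite lerBlDr lerDl mulr_ge0 ?exprn_ge0 ?invr_ge0.
Qed.

Lemma asum_half2 : asum (fun i : I2 => (2^-1 : C) ^+ wt2 i) (2 * 2).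
Proof.
by apply: asum_le (asum_prod asum_half asum_half) => i; rewrite exprD.
Qed.
Lemma asum_half4 : asum (fun i : I4 => (2^-1 : C) ^+ wt4 i) (2 * 2 * (2 * 2)).
Proof.
by apply: asum_le (asum_prod asum_half2 asum_half2) => i; rewrite exprD.
Qed.

(** Halving the radius makes a sup bound summable, as the powers of 1/2 are; conversely an l^1 bound
    controls each single term. *)
Lemma convP (I : eqType) (w : I -> nat) (F : I -> C) K : asum (fun i => (2^-1 : C) ^+ w i) K ->
  (exists r : R, 0 < r /\ exists M : R, forall i, `|F i| * r%:C ^+ w i <= M%:C) <-> conv w F.
Proof.
move=> hK; split.
  move=> [r [r0 [M hM]]]; exists (r%:C * 2^-1), (`|M%:C| * K).
  split; first by rewrite mulr_gt0 ?invr_gt0 // ltcR.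
  have r0' : 0 <= r%:C :> C by rewrite lecR ltW.
  apply: asum_le (asumZ M%:C hK) => i; rewrite exprMn mulrA !normrM ler_wpM2r //.
  rewrite [X in _ * X]ger0_norm ?exprn_ge0 //; apply: le_trans (hM i) _.
  by apply: real_ler_norm; rewrite complex_real.
move=> [s [M [/gt0_real_complex[r r0 ->] h]]].
exists r; split=> //; exists (complex.Re M).
have M0 := asum_ge0 h; rewrite RRe_real ?ger0_real // => i.
have := h [:: i] isT; rewrite big_seq1 normrM [X in _ * X]ger0_norm // exprn_ge0 //.
by rewrite lecR ltW.
Qed.

Definition un2 (f : ser2 R) (i : I2) := f i.1 i.2.
Definition un4 (F : ser4 R) (i : I4) := F i.1.1 i.1.2 i.2.1 i.2.2.

Lemma conv2P f : conv2 f <-> conv wt2 (un2 f).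
Proof.
rewrite -(convP _ asum_half2); split=> -[r [r0 [M h]]]; exists r; split=> //; exists M.
  by move=> i; apply: h.
by move=> a b; apply: (h (a, b)).
Qed.

Lemma conv4P F : conv4 F <-> conv wt4 (un4 F).
Proof.
rewrite -(convP _ asum_half4); split=> -[r [r0 [M h]]]; exists r; split=> //; exists M.
  by move=> i; have := h i.1.1 i.1.2 i.2.1 i.2.2; rewrite -addnA.
by move=> a b c d; have := (h ((a, b), (c, d))); rewrite /wt4 /wt2 /= addnA.
Qed.

End Eval.

(** * Germs and the identity theorem *)

Section Germs.
Variable R : realType.
Local Notation C := R[i].
Local Notation S2 := (I2 -> C).
Local Notation S4 := (I4 -> C).
Local Notation conv2' := (@conv R _ wt2).
Local Notation conv4' := (@conv R _ wt4).

Lemma conjM (a b : C) : (a * b : C)^* = a^* * b^* :> C. Proof. exact: rmorphM. Qed.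
Lemma conjD (a b : C) : (a + b : C)^* = a^* + b^* :> C. Proof. exact: rmorphD. Qed.
Lemma conjN (a : C) : (- a : C)^* = - a^* :> C. Proof. exact: rmorphN. Qed.
Lemma conjX (a : C) n : (a ^+ n : C)^* = a^* ^+ n :> C. Proof. exact: rmorphXn. Qed.

Definition mul2 : S2 -> S2 -> S2 := gmul fib2.
Definition mul4 : S4 -> S4 -> S4 := gmul fib4.
Definition tens (h k : S2) : S4 := fun i => h i.1 * (k i.2)^*.
(** The coefficients of the complex conjugate of the function ([E4_herm]): real-valued germs are the
    fixed points of [herm]. *)
Definition herm (F : S4) : S4 := fun i => (F (i.2, i.1))^*.

Lemma conv_mul2 f g : conv2' f -> conv2' g -> conv2' (mul2 f g).
Proof. exact: conv_gmul fib2U fib2P wt2D _ _. Qed.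
Lemma conv_mul4 f g : conv4' f -> conv4' g -> conv4' (mul4 f g).
Proof. exact: conv_gmul fib4U fib4P wt4D _ _. Qed.

Lemma conv_tens h k : conv2' h -> conv2' k -> conv4' (tens h k).
Proof.
move=> hh /(conv2s hh)[s [M [N [s0 hM hN]]]]; exists s, (M * N); split=> //.
have := asum_prod hM hN; apply: asum_le => i.
by rewrite /tens exprD !normrM norm_conjC mulrACA.
Qed.

Lemma conv_herm F : conv4' F -> conv4' (herm F).
Proof.
move=> [s [M [s0 h]]]; exists s, M; split=> //.
have := asum_bij (h := fun i : I4 => (i.2, i.1)) _ h => /(_ _)H.
have /H : injective (fun i : I4 => (i.2, i.1)) by move=> [? ?] [? ?] [-> ->].
by apply: asum_le => i; rewrite /herm /= !normrM norm_conjC /wt4 /= addnC.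
Qed.

Lemma x4_swap (z w : C) i : (x4 z w (i.2, i.1)) = (x4 z w i)^*.
Proof. by rewrite /x4 /= [RHS]conjM conjCK mulrC. Qed.

Lemma E4Z a F : conv4' F -> near0 (fun z w => E4 (fun i => a * F i) z w = a * E4 F z w).
Proof.
move=> /near_sums4; apply: near0_mono => z w h; apply: sums_E4.
by apply: eq_sums (sumsZ a h) => i; rewrite mulrA.
Qed.
Lemma E4D F G : conv4' F -> conv4' G ->
  near0 (fun z w => E4 (fun i => F i + G i) z w = E4 F z w + E4 G z w).
Proof.
move=> /near_sums4 hF /near_sums4 hG; apply: near0_mono (near0_and hF hG) => z w [h k].
by apply: sums_E4; apply: eq_sums (sumsD h k) => i; rewrite mulrDl.
Qed.
Lemma E4B F G : conv4' F -> conv4' G ->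
  near0 (fun z w => E4 (fun i => F i - G i) z w = E4 F z w - E4 G z w).
Proof.
move=> /near_sums4 hF /near_sums4 hG; apply: near0_mono (near0_and hF hG) => z w [h k].
by apply: sums_E4; apply: eq_sums (sumsB h k) => i; rewrite mulrBl.
Qed.
Lemma E4_zero (z w : C) : E4 (fun=> 0) z w = 0.
Proof.
apply: sums_E4; have := @sums_fin R _ (fun i => 0 * x4 z w i) [::] isT.
by rewrite big_nil; apply => i _; rewrite mul0r.
Qed.
Lemma E4_herm F : conv4' F -> near0 (fun z w => E4 (herm F) z w = (E4 F z w)^*).
Proof.
move=> /near_sums4; apply: near0_mono => z w h; apply: sums_E4.
pose sw := fun i : I4 => (i.2, i.1).
have swK : cancel sw sw by case.
apply: eq_sums (sums_conj (sums_bij swK swK h)) => i.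
by rewrite /= /herm conjM x4_swap conjCK.
Qed.
Lemma E2M f g : conv2' f -> conv2' g ->
  near0 (fun z w => E2 (mul2 f g) z w = E2 f z w * E2 g z w).
Proof.
move=> hf hg; have [s [M [N [s0 hM hN]]]] := conv2s hf hg.
apply: near0_mono (near0_and (near0_ball s0) (near0_and (near_sums2 hf) (near_sums2 hg))).
move=> z w [[hz hw] [h k]]; apply: sums_E2.
by apply: (sums_gmul fib2U fib2P (ltW s0) hM hN (dom_ball hz hw).1) => // i j; apply: x2M.
Qed.
Lemma E4M f g : conv4' f -> conv4' g ->
  near0 (fun z w => E4 (mul4 f g) z w = E4 f z w * E4 g z w).
Proof.
move=> hf hg; have [s [M [N [s0 hM hN]]]] := conv2s hf hg.
apply: near0_mono (near0_and (near0_ball s0) (near0_and (near_sums4 hf) (near_sums4 hg))).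
move=> z w [[hz hw] [h k]]; apply: sums_E4.
by apply: (sums_gmul fib4U fib4P (ltW s0) hM hN (dom_ball hz hw).2) => // i j; apply: x4M.
Qed.
Lemma E4_tens f g : conv2' f -> conv2' g ->
  near0 (fun z w => E4 (tens f g) z w = E2 f z w * (E2 g z w)^*).
Proof.
move=> hf hg; have [s [M [N [s0 hM hN]]]] := conv2s hf hg.
apply: near0_mono (near0_and (near0_ball s0) (near0_and (near_sums2 hf) (near_sums2 hg))).
move=> z w [[hz hw] [h k]]; apply: sums_E4.
have aM := bnd_asum (ltW s0) hM (dom_ball hz hw).1.
have aN := bnd_asum (ltW s0) hN (dom_ball hz hw).1.
have aN' : asum (fun i => (g i * x2 z w i)^*) N.
  by apply: asum_le aN => i; rewrite norm_conjC.
have [_] := sums_prod aM aN' h (sums_conj k).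
by apply: eq_sums => i; rewrite /tens /x4 rmorphM mulrACA.
Qed.

Section Small.
Variables (I : eqType) (w : I -> nat) (s t M : C) (F : I -> C) (x : I -> C).
(** Without a term of weight 0 every term carries a factor t, so the norm tends to 0 with the
    radius. This gives both continuity at 0 and radii small enough for substitution. *)
Lemma asum_small : 0 <= s -> 0 <= t -> t <= 1 -> bnd w s F M ->
  (forall i, w i = 0%N -> F i = 0) -> dom w (t * s) x -> asum (fun i => F i * x i) (t * M).
Proof.
move=> s0 t0 t1 hF F0 dx; have := asumZ t hF; rewrite ger0_norm //.
apply: asum_le => i; case: (posnP (w i)) => [/F0 ->|wi]; first by rewrite mul0r normr0.
rewrite normrM [leRHS]normrM [X in _ <= _ * X]normrM (ger0_norm t0) mulrCA ler_wpM2l //.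
apply: le_trans (dx i) _; rewrite exprMn [X in _ <= _ * X]ger0_norm ?exprn_ge0 //.
by rewrite ler_wpM2r ?exprn_ge0 // -(prednK wi) exprS ler_piMr // exprn_ile1.
Qed.
End Small.

Lemma small_pick (M d : C) : 0 <= M -> 0 < d -> exists t : C, [/\ 0 < t, t <= 1 & t * M < d].
Proof.
move=> M0 d0; have dM : 0 < d + M by rewrite ltr_wpDr.
have [->|Mn] := eqVneq M 0; first by exists 1; rewrite ltr01 lexx mulr0.
exists (d / (d + M)); split; first by rewrite divr_gt0.
  by rewrite ler_pdivrMr // mul1r lerDl.
rewrite mulrAC ltr_pdivrMr // ltr_pM2l // ltrDr //.
Qed.

Lemma near_small2 h d : conv2' h -> h (0, 0)%N = 0 -> 0 < d -> near0 (fun z w => `|E2 h z w| < d).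
Proof.
move=> ch h0 d0; have [s [M [s0 hM]]] := ch.
have [t [t0 t1 tM]] := small_pick (asum_ge0 hM) d0.
have ts0 : 0 < t * s by rewrite mulr_gt0.
apply: near0_mono (near0_and (near0_ball ts0) (near_sums2 ch)) => z w [[hz hw] hs].
apply: le_lt_trans tM; apply: sums_le hs _.
apply: (asum_small (ltW s0) (ltW t0) t1 hM _ (dom_ball hz hw).1) => -[a b].
by rewrite /wt2 /= => /eqP; rewrite addn_eq0 => /andP[/eqP -> /eqP ->].
Qed.

Lemma near_small4 h d : conv4' h -> h ((0, 0), (0, 0))%N = 0 -> 0 < d -> near0 (fun z w => `|E4 h z w| < d).
Proof.
move=> ch h0 d0; have [s [M [s0 hM]]] := ch.
have [t [t0 t1 tM]] := small_pick (asum_ge0 hM) d0.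
have ts0 : 0 < t * s by rewrite mulr_gt0.
apply: near0_mono (near0_and (near0_ball ts0) (near_sums4 ch)) => z w [[hz hw] hs].
apply: le_lt_trans tM; apply: sums_le hs _.
apply: (asum_small (ltW s0) (ltW t0) t1 hM _ (dom_ball hz hw).2) => -[[a b] [c d']].
rewrite /wt4 /wt2 /= => /eqP.
by rewrite !addn_eq0 => /andP[/andP[/eqP -> /eqP ->] /andP[/eqP -> /eqP ->]].
Qed.

Lemma near_comp (P : C -> C -> Prop) p q : conv2' p -> conv2' q ->
  p (0, 0)%N = 0 -> q (0, 0)%N = 0 -> near0 P -> near0 (fun z w => P (E2 p z w) (E2 q z w)).
Proof.
move=> cp cq p0 q0 [e [e0 h]]; have e0' : 0 < e%:C :> C by rewrite ltcR.
apply: near0_mono (near0_and (near_small2 cp p0 e0') (near_small2 cq q0 e0')) => z w [hz hw].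
exact: h.
Qed.

Lemma sums_cst (I : eqType) (u : I -> C) (i0 : I) S :
  sums (fun i => if i == i0 then 0 else u i) S -> sums u (u i0 + S).
Proof.
move=> h; have := @sums_fin R _ (fun i => if i == i0 then u i else 0) [:: i0] isT.
rewrite big_seq1 eqxx => /(_ _)H; have {}H : sums (fun i => if i == i0 then u i else 0) (u i0).
  by apply: H => i; rewrite inE => /negbTE ->.
by apply: eq_sums (sumsD H h) => i; case: eqP; rewrite ?addr0 ?add0r.
Qed.

Lemma near_neq0 F : conv4' F -> F ((0, 0), (0, 0))%N != 0 -> near0 (fun z w => E4 F z w != 0).
Proof.
move=> cF F0; set o := ((0, 0), (0, 0))%N in F0.
pose G := fun i => if i == o then 0 else F i.
have cG : conv4' G.
  move: cF => [s [M [s0 h]]]; exists s, M; split=> //; apply: asum_le h => i.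
  by rewrite /G; case: eqP => // _; rewrite mul0r normr0.
have d0 : 0 < `|F o| by rewrite normr_gt0.
have G0 : G o = 0 by rewrite /G eqxx.
apply: near0_mono (near0_and (near_small4 cG G0 d0) (near_sums4 cG)) => z w [hs hG].
have xo : x4 z w o = 1 by rewrite /x4 /x2 /= !expr0 !mulr1 rmorph1 mulr1.
have h : sums (fun i => if i == o then 0 else F i * x4 z w i) (E4 G z w).
  by apply: eq_sums hG => i; rewrite /G; case: eqP => // _; rewrite mul0r.
rewrite (sums_E4 (sums_cst h)) xo mulr1; apply/eqP => e.
have : `|F o| = `|E4 G z w| by rewrite -[RHS]normrN; congr `|_|; apply/eqP; rewrite -addr_eq0 e.
by move=> ee; rewrite ee ltxx in hs.
Qed.

Definition hom4 n : seq I4 := [seq i <- box4 n.+1 | wt4 i == n].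
Lemma hom4P n i : (i \in hom4 n) = (wt4 i == n).
Proof. by rewrite mem_filter; case: eqP => //= <-; apply: box4_wt. Qed.
Lemma hom4U n : uniq (hom4 n).
Proof. by rewrite filter_uniq ?box4U. Qed.

Lemma x4_scale (t z w : C) i : 0 <= t -> x4 (t * z) (t * w) i = x4 z w i * t ^+ wt4 i.
Proof.
move=> t0; have tr : t^* = t by apply: (CrealP _); rewrite ger0_real.
rewrite /x4 /x2 /wt4 /wt2 !(conjM, conjX) tr !exprMn !exprD; ring.
Qed.

(** Along the real ray through (z, w) the series is a power series in t, so [unique1] kills every
    homogeneous part; what is left are finite sums, which [sep] splits algebraically. *)
Lemma E4_eq0 F : conv4' F -> near0 (fun z w => E4 F z w = 0) -> forall i, F i = 0.
Proof.
move=> cF F0.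
have hom z w n : \sum_(i <- hom4 n) F i * x4 z w i = 0.
  have [s [M [s0 hM]]] := cF; move: n.
  have [e [e0 he]] := near0_and F0 (near_sums4 cF).
  pose K : C := 1 + `|z| + `|w|.
  have K0 : 0 < K by rewrite /K -addrA ltr_wpDr ?addr_ge0.
  have zK : `|z| < K by rewrite /K -addrA addrCA ltrDl ltr_wpDr.
  have wK : `|w| < K by rewrite /K ltrDr ltr_wpDr.
  have e0' : 0 < e%:C :> C by rewrite ltcR.
  have [t1 [t10 _ t1K]] := small_pick (ltW K0) e0'.
  have [t2 [t20 _ t2K]] := small_pick (ltW K0) s0.
  pose t0 := t1 * t2 / (t1 + t2).
  have t0p : 0 < t0 by rewrite divr_gt0 ?mulr_gt0 ?addr_gt0.
  have t01 : t0 <= t1 by rewrite ler_pdivrMr ?addr_gt0 // ler_pM2l // lerDr ltW.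
  have t02 : t0 <= t2 by rewrite ler_pdivrMr ?addr_gt0 // mulrC ler_pM2l // lerDl ltW.
  have sm t u T d : 0 < t -> t <= T -> T * K < d -> `|u| < K -> `|t * u| < d.
    move=> tp tT TK uK; apply: le_lt_trans TK; rewrite normrM (gtr0_norm tp).
    by rewrite ler_pM // ltW.
  apply: (@unique1 R _ t0 M t0p) => [|t tp tt].
    have dx := (dom_ball (sm _ _ _ _ t0p t02 t2K zK) (sm _ _ _ _ t0p t02 t2K wK)).2.
    have := asum_fib hom4U (phi := wt4) (fun n k => hom4P n k) (bnd_asum (ltW s0) hM dx).
    apply: asum_le => n; rewrite mulr_suml le_eqVlt; apply/orP; left; apply/eqP; congr `|_|.
    rewrite big_seq [RHS]big_seq; apply: eq_bigr => i; rewrite hom4P => /eqP <-.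
    by rewrite x4_scale ?mulrA // ltW.
  have [E0 hs] := he (t * z) (t * w) (sm _ _ _ _ tp (le_trans tt t01) t1K zK) (sm _ _ _ _ tp (le_trans tt t01) t1K wK).
  have := sums_fib hom4U (phi := wt4) (fun n k => hom4P n k) hs; rewrite E0.
  apply: eq_sums => n; rewrite mulr_suml.
  rewrite big_seq [RHS]big_seq; apply: eq_bigr => i; rewrite hom4P => /eqP <-.
  by rewrite x4_scale ?mulrA // ltW.
(* At z = k (1 + iy), w = 1 + iy', varying k separates the monomials by a + c, and
   varying y and y' separates them by the powers of (1 + iy) / (1 - iy). *)
pose u (y : nat) : C := 1 + 'i%C * y%:R; pose v (y : nat) : C := 1 - 'i%C * y%:R.
have iN : ('i%C : C) != 0 by rewrite eq_complex /= oner_eq0 andbF.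
have uv y : (u y)^* = v y.
  rewrite /u /v conjD conjM rmorph1 rmorph_nat -mulNr; congr (1 + _ * _).
  by apply/eqP; rewrite eq_complex /= oppr0 !eqxx.
have v0 y : v y != 0.
  apply/eqP => vy; have uy : u y = 0 by rewrite -(conjCK (u y)) uv vy rmorph0.
  have : u y + v y = 2 by rewrite /u /v; ring.
  by rewrite uy vy addr0 => /esym/eqP; rewrite pnatr_eq0.
pose tau y := u y / v y.
have ti : injective tau.
  move=> y y' /eqP; rewrite /tau eqr_div // => /eqP e.
  have : 2 * 'i%C * (y%:R - y'%:R) = 0 :> C.
    by transitivity (u y * v y' - u y' * v y); [rewrite /u /v; ring | rewrite e subrr].
  by move=> /eqP; rewrite !mulf_eq0 pnatr_eq0 (negbTE iN) /= subr_eq0 eqr_nat => /eqP.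
move=> [[a b] [c d]]; set i0 : I4 := ((a, b), (c, d)); pose n := wt4 i0.
pose ac (i : I4) := (i.1.1 + i.2.1)%N.
have H1 y y' : \sum_(i <- hom4 n | true && (ac i == (a + c)%N))
    F i * (u y ^+ i.1.1 * v y ^+ i.2.1) * (u y' ^+ i.1.2 * v y' ^+ i.2.2) = 0.
  apply: (sep (tau := fun k => k.+1%:R)) => [k l /eqP|k].
    by rewrite eqr_nat eqSS => /eqP.
  apply: etrans (hom (k.+1%:R * u y) (u y') n); apply: eq_bigr => i _.
  by rewrite /x4 /x2 !exprMn /ac exprD !conjM !conjX !uv rmorph_nat; ring.
have H2 y' : \sum_(i <- hom4 n | (true && (ac i == (a + c)%N)) && (i.1.1 == a))
    F i * (u y' ^+ i.1.2 * v y' ^+ i.2.2) = 0.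
  apply: (sep ti) => y; apply: (mulfI (expf_neq0 (a + c) (v0 y))).
  rewrite mulr0; apply: etrans (H1 y y'); rewrite mulr_sumr; apply: eq_bigr => i /eqP <-.
  rewrite /ac /tau expr_div_n exprD.
  have := expf_neq0 i.1.1 (v0 y); move: (v y ^+ i.1.1) => X X0.
  by field.
have H3 : \sum_(i <- hom4 n | ((true && (ac i == (a + c)%N)) && (i.1.1 == a)) && (i.1.2 == b)) F i = 0.
  apply: (sep ti) => y; apply: (mulfI (expf_neq0 (b + d) (v0 y))).
  rewrite mulr0; apply: etrans (H2 y); rewrite mulr_sumr big_seq_cond [RHS]big_seq_cond; apply: eq_bigr => i.
  rewrite hom4P => /andP[/eqP wi /andP[/eqP aci _]].
  have -> : (b + d = i.1.2 + i.2.2)%N.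
    move: wi aci; rewrite /n /wt4 /wt2 /ac /= => wi aci.
    apply/eqP; rewrite -(eqn_add2l (a + c)) -{2}aci; apply/eqP.
    by rewrite [LHS]addnACA -wi addnACA.
  rewrite /tau expr_div_n exprD.
  have := expf_neq0 i.1.2 (v0 y); move: (v y ^+ i.1.2) => X X0.
  by field.
(* The weight n, the sum a + c, a and b together leave the single index [i0]. *)
move: H3; rewrite big_mkcond (bigD1_seq i0) ?hom4U ?hom4P //= /ac !eqxx /=.
rewrite big_seq_cond big1 ?addr0 // => -[[a1 b1] [c1 d1]] /=.
rewrite hom4P /n /i0 /wt4 /wt2 /= => /andP[wi ne]; case: ifP => // /andP[/andP[e1 /eqP e2] /eqP e3].
move: wi e1 ne; rewrite e2 e3 !eqn_add2l => wi /eqP e4.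
by move: wi; rewrite e4 eqn_add2l => /eqP ->; rewrite eqxx.
Qed.

Lemma E4_inj F G : conv4' F -> conv4' G -> near0 (fun z w => E4 F z w = E4 G z w) -> F = G.
Proof.
move=> cF cG h; apply: funext => i; apply/eqP; rewrite -subr_eq0; apply/eqP.
apply: (E4_eq0 (convB cF cG) _ i).
by apply: near0_mono (near0_and h (E4B cF cG)) => z w [-> ->]; rewrite subrr.
Qed.

Definition o2 : I2 := (0, 0)%N.
Definition one2 : S2 := fun i => (i == o2)%:R.
Definition X2 : S2 := fun i => (i == (1, 0)%N)%:R.
Definition Y2 : S2 := fun i => (i == (0, 1)%N)%:R.

Lemma sums_delta2 (j : I2) (z w : C) : sums (fun i : I2 => (i == j)%:R * x2 z w i) (x2 z w j).
Proof.
have := @sums_fin R _ (fun i => (i == j)%:R * x2 z w i) [:: j] isT.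
rewrite big_seq1 eqxx mul1r; apply => i; rewrite inE => /negbTE ->; exact: mul0r.
Qed.
Lemma conv_delta2 (j : I2) : conv2' (fun i => (i == j)%:R).
Proof.
by apply: (conv_fin wt2 (t := [:: j])) => // i; rewrite inE => /negbTE ->.
Qed.
Lemma E2_one z w : E2 one2 z w = 1.
Proof. by rewrite (sums_E2 (sums_delta2 o2 z w)) /x2 /= !expr0 mulr1. Qed.
Lemma E2_X z w : E2 X2 z w = z.
Proof. by rewrite (sums_E2 (sums_delta2 _ z w)) /x2 /= expr0 mulr1. Qed.
Lemma E2_Y z w : E2 Y2 z w = w.
Proof. by rewrite (sums_E2 (sums_delta2 _ z w)) /x2 /= expr0 mul1r. Qed.

(** Tensoring with 1 views a holomorphic germ as a germ free of conjugates, to which [E4_inj]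
    applies. *)
Lemma E2_inj f g : conv2' f -> conv2' g -> near0 (fun z w => E2 f z w = E2 g z w) -> f = g.
Proof.
move=> cf cg h; have c1 := conv_delta2 o2.
have e : tens f one2 = tens g one2.
  apply: E4_inj; try exact: conv_tens.
  apply: near0_mono (near0_and h (near0_and (E4_tens cf c1) (E4_tens cg c1))).
  by move=> z w [e [-> ->]]; rewrite e.
apply: funext => i; have := congr1 (fun F : S4 => F (i, o2)) e.
by rewrite /tens /= /one2 eqxx rmorph1 !mulr1.
Qed.
End Germs.

(** * Composition *)

Section Comp.
Variable R : realType.
Local Notation C := R[i].
Local Notation S2 := (I2 -> C).
Local Notation S4 := (I4 -> C).
Local Notation conv2' := (@conv R _ wt2).
Local Notation conv4' := (@conv R _ wt4).
Local Notation one2 := (one2 R).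
Local Notation X2 := (X2 R).
Local Notation Y2 := (Y2 R).

(** When p and q vanish at 0, p^a q^b has order at least a + b, so only monomials of weight at most
    that of [i] reach the coefficient [i], and composition is a finite sum per coefficient. *)
Definition low2 (i : I2) : seq I2 := [seq j <- box2 (wt2 i).+1 | (wt2 j <= wt2 i)%N].
Definition low4 (i : I4) : seq I4 := [seq (a, b) | a <- low2 i.1, b <- low2 i.2].
Definition mon (p q : S2) (j : I2) : S2 := iter j.1 (mul2 p) (iter j.2 (mul2 q) one2).
Definition mon4 p q (j : I4) : S4 := tens (mon p q j.1) (mon p q j.2).
Definition scomp (h p q : S2) : S2 := kcomp (mon p q) low2 h.
Definition comp4 (F : S4) (p q : S2) : S4 := kcomp (mon4 p q) low4 F.

Lemma mem_low2 i j : (j \in low2 i) = (wt2 j <= wt2 i)%N.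
Proof. by rewrite mem_filter; case: leqP => //= h; rewrite box2_wt. Qed.
Lemma low2U i : uniq (low2 i).
Proof. by rewrite filter_uniq ?box2U. Qed.
Lemma low4U i : uniq (low4 i).
Proof. by apply: allpairs_uniq; rewrite ?low2U // => -[? ?] [? ?] _ _ [-> ->]. Qed.
Lemma mem_low4 i j : (j \in low4 i) = (j.1 \in low2 i.1) && (j.2 \in low2 i.2).
Proof.
case: j => a b; apply/allpairsP/andP => /=.
  by move=> [[x y] /= [? ?]] [-> ->].
by move=> [? ?]; exists (a, b).
Qed.

Definition ordge n (f : S2) := forall i, (wt2 i < n)%N -> f i = 0.

Lemma order_mul m n f g : ordge m f -> ordge n g -> ordge (m + n) (mul2 f g).
Proof.
move=> hf hg i hi; rewrite /mul2 /gmul big_seq big1 // => k; rewrite fib2P => /eqP e.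
have [km|km] := ltnP (wt2 k.1) m; first by rewrite hf ?mul0r.
rewrite hg ?mulr0 // -(ltn_add2l m) (leq_ltn_trans _ hi) // -e wt2D leq_add2r //.
Qed.

Lemma order1 (f : S2) : f o2 = 0 -> ordge 1 f.
Proof.
by move=> f0 [a b]; rewrite /wt2 ltnS leqn0 addn_eq0 /= => /andP[/eqP -> /eqP ->].
Qed.

Section Sub.
Variables p q : S2.
Hypotheses (p0 : p o2 = 0) (q0 : q o2 = 0).

Lemma order_mon j : ordge (wt2 j) (mon p q j).
Proof.
case: j => a b; rewrite /mon /wt2 /=; elim: a => [|a IH] /=; last first.
  by rewrite addSn -add1n; apply: order_mul IH; apply: order1.
elim: b => [|b IH] //=.
by rewrite add0n -add1n; apply: order_mul IH; apply: order1.
Qed.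

Lemma mon_low i j : j \notin low2 i -> mon p q j i = 0.
Proof. by rewrite mem_low2 -ltnNge; apply: order_mon. Qed.

Lemma mon4_low i j : j \notin low4 i -> mon4 p q j i = 0.
Proof.
rewrite mem_low4 negb_and => /orP[]/mon_low h; rewrite /mon4 /tens h ?mul0r //.
by rewrite rmorph0 mulr0.
Qed.

Lemma bnd_one (s : C) : bnd wt2 s one2 1.
Proof.
have h : forall i, i \notin [:: o2] -> one2 i = 0.
  by move=> i; rewrite inE /one2 => /negbTE ->.
have := bnd_fin wt2 s (t := [:: o2]) isT h.
by rewrite big_seq1 /one2 eqxx mul1r expr0 normr1.
Qed.

Lemma conv_one : conv2' one2. Proof. exact: conv_delta2. Qed.

Lemma bnd_mon (s r : C) j : bnd wt2 s p r -> bnd wt2 s q r -> bnd wt2 s (mon p q j) (r ^+ wt2 j).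
Proof.
move=> hp hq; case: j => a b; rewrite /mon /wt2 /=; elim: a => [|a IH] /=; last first.
  by rewrite addSn exprS; exact: bnd_gmul fib2U fib2P wt2D _ _ _ _ _ hp IH.
elim: b => [|b IH] /=; first exact: bnd_one.
by rewrite add0n exprS; exact: bnd_gmul fib2U fib2P wt2D _ _ _ _ _ hq IH.
Qed.

Lemma bnd_tens (s M N : C) f g : bnd wt2 s f M -> bnd wt2 s g N -> bnd wt4 s (tens f g) (M * N).
Proof.
move=> hM hN; have := asum_prod hM hN; apply: asum_le => i.
by rewrite /tens exprD !normrM norm_conjC mulrACA.
Qed.

Lemma bnd_mon4 (s r : C) j : bnd wt2 s p r -> bnd wt2 s q r -> bnd wt4 s (mon4 p q j) (r ^+ wt4 j).
Proof. by move=> hp hq; rewrite /wt4 exprD; apply: bnd_tens; apply: bnd_mon. Qed.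

Lemma sums_mon (s r z w x y : C) j : 0 <= s -> bnd wt2 s p r -> bnd wt2 s q r ->
  dom wt2 s (x2 z w) -> sums (fun i => p i * x2 z w i) x -> sums (fun i => q i * x2 z w i) y ->
  sums (fun i => mon p q j i * x2 z w i) (x2 x y j).
Proof.
move=> s0 hp hq dx hx hy; case: j => a b; rewrite /mon /x2 /=.
have xM := @x2M R z w.
elim: a => [|a IH] /=.
  rewrite expr0 mul1r; elim: b => [|b IH] /=.
    have := sums_delta2 o2 z w; rewrite /x2 /= !expr0 mulr1; exact.
  have hb := bnd_mon (0%N, b) hp hq.
  by rewrite exprS; exact: (sums_gmul fib2U fib2P s0 hq hb dx xM hy IH).
have ha := bnd_mon (a, b) hp hq.
by rewrite exprS -mulrA; exact: (sums_gmul fib2U fib2P s0 hp ha dx xM hx IH).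
Qed.

Lemma bnd_small (s t M : C) f : 0 <= s -> 0 <= t -> t <= 1 -> f o2 = 0 ->
  bnd wt2 s f M -> bnd wt2 (t * s) f (t * M).
Proof.
move=> s0 t0 t1 f0 hf; apply: (asum_small s0 t0 t1 hf) => i.
  by move=> wi; apply: (order1 f0); rewrite wi.
by rewrite ger0_norm ?exprn_ge0 ?mulr_ge0.
Qed.

Hypotheses (cp : conv2' p) (cq : conv2' q).

(** With no constant term, p and q have norms that shrink with the radius; once both are at most r,
    a series converging at radius r can be composed with them. *)
Lemma bnd_pick (r : C) : 0 < r -> exists s, [/\ 0 < s, bnd wt2 s p r & bnd wt2 s q r].
Proof.
move=> r0; have [s [M [N [s0 hM hN]]]] := conv2s cp cq.
have M0 := asum_ge0 hM; have N0 := asum_ge0 hN.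
have [t [t0 t1 tMN]] := small_pick (addr_ge0 M0 N0) r0.
exists (t * s); split; first by rewrite mulr_gt0.
  apply: bndW (bnd_small (ltW s0) (ltW t0) t1 p0 hM).
  by apply: le_trans (ltW tMN); rewrite ler_pM2l // lerDl.
apply: bndW (bnd_small (ltW s0) (ltW t0) t1 q0 hN).
by apply: le_trans (ltW tMN); rewrite ler_pM2l // lerDr.
Qed.

Lemma conv_comp h : conv2' h -> conv2' (scomp h p q).
Proof.
move=> [r [M [r0 hM]]]; have [s [s0 hp hq]] := bnd_pick r0.
exists s, M; split => //.
apply: (kernel_bnd low2U (ltW s0) _ hM) => j; exact: bnd_mon.
Qed.

Lemma conv_comp4 F : conv4' F -> conv4' (comp4 F p q).
Proof.
move=> [r [M [r0 hM]]]; have [s [s0 hp hq]] := bnd_pick r0.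
exists s, M; split => //.
apply: (kernel_bnd low4U (ltW s0) _ hM) => j; exact: bnd_mon4.
Qed.

Lemma E2_comp h : conv2' h ->
  near0 (fun z w => E2 (scomp h p q) z w = E2 h (E2 p z w) (E2 q z w)).
Proof.
move=> [r [M [r0 hM]]]; have [s [s0 hp hq]] := bnd_pick r0.
apply: near0_mono (near0_and (near0_ball s0) (near0_and (near_sums2 cp) (near_sums2 cq))).
move=> z w [[hz hw] [sp sq]]; have dx := (dom_ball hz hw).1.
have [T [h1 h2]] := kernel_sums low2U mon_low (ltW s0) (fun j => bnd_mon j hp hq) hM dx
  (fun j => sums_mon j (ltW s0) hp hq dx sp sq).
by rewrite (sums_E2 h1) (sums_E2 h2).
Qed.

Lemma E4_comp F : conv4' F ->
  near0 (fun z w => E4 (comp4 F p q) z w = E4 F (E2 p z w) (E2 q z w)).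
Proof.
move=> [r [M [r0 hM]]]; have [s [s0 hp hq]] := bnd_pick r0.
apply: near0_mono (near0_and (near0_ball s0) (near0_and (near_sums2 cp) (near_sums2 cq))).
move=> z w [[hz hw] [sp sq]]; have [dx dx4] := dom_ball hz hw.
have key j : sums (fun i => mon4 p q j i * x4 z w i) (x4 (E2 p z w) (E2 q z w) j).
  have h1 := sums_mon j.1 (ltW s0) hp hq dx sp sq.
  have h2 := sums_mon j.2 (ltW s0) hp hq dx sp sq.
  have a1 := bnd_asum (ltW s0) (bnd_mon j.1 hp hq) dx.
  have a2 := bnd_asum (ltW s0) (bnd_mon j.2 hp hq) dx.
  have a2' : asum (fun i => (mon p q j.2 i * x2 z w i)^*) (r ^+ wt2 j.2).
    by apply: asum_le a2 => i; rewrite norm_conjC.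
  have [_] := sums_prod a1 a2' h1 (sums_conj h2).
  by apply: eq_sums => i; rewrite /mon4 /tens /x4 conjM mulrACA.
have [T [h1 h2]] := kernel_sums low4U mon4_low (ltW s0) (fun j => bnd_mon4 j hp hq) hM dx4 key.
by rewrite (sums_E4 h1) (sums_E4 h2).
Qed.

(** The rectangular range has independent bounds because the chain rule shifts the two exponents
    separately. *)
Lemma compE h i N1 N2 : (wt2 i < N1)%N -> (wt2 i < N2)%N ->
  scomp h p q i = \sum_(a < N1) \sum_(b < N2) h (a : nat, b : nat) * mon p q (a : nat, b : nat) i.
Proof.
move=> h1 h2.
have -> : \sum_(a < N1) \sum_(b < N2) h (a : nat, b : nat) * mon p q (a : nat, b : nat) i =
    \sum_(j <- [seq (a, b) | a <- index_iota 0 N1, b <- index_iota 0 N2]) h j * mon p q j i.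
  rewrite big_allpairs big_mkord; apply: eq_bigr => a _.
  by rewrite big_mkord.
rewrite [RHS](@sum_supp R _ _ (low2 i)) ?low2U //.
- by apply: allpairs_uniq; rewrite ?iota_uniq // => -[? ?] [? ?] _ _ [-> ->].
- move=> [a b]; rewrite mem_low2 => hj; apply/allpairsP; exists (a, b).
  rewrite !mem_index_iota /=; split => //.
    by apply: leq_ltn_trans h1; apply: leq_trans hj; rewrite leq_addr.
  by apply: leq_ltn_trans h2; apply: leq_trans hj; rewrite leq_addl.
- by move=> j /mon_low ->; rewrite mulr0.
Qed.
End Sub.

Lemma comp4E F p q i : comp4 F p q i =
  (scomp (fun j2 => (scomp (fun j1 => F (j1, j2)) p q i.1)^*) p q i.2)^*.
Proof.
rewrite /comp4 /scomp /kcomp /low4 big_allpairs exchange_big rmorph_sum; apply: eq_bigr => b _.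
rewrite [RHS]conjM conjCK mulr_suml; apply: eq_bigr => a _.
by rewrite /mon4 /tens /= mulrA.
Qed.

Lemma comp_lin a b h k p q i :
  scomp (fun j => a * h j + b * k j) p q i = a * scomp h p q i + b * scomp k p q i.
Proof.
by rewrite /scomp /kcomp !mulr_sumr -big_split; apply: eq_bigr => j _ /=; ring.
Qed.

(** * Low-order coefficients of products and composites *)

Lemma mul2_00 (f g : S2) : mul2 f g o2 = f o2 * g o2.
Proof. by rewrite /mul2 /gmul big_seq1. Qed.
Lemma mul2_10 (f g : S2) : mul2 f g (1, 0)%N = f o2 * g (1, 0)%N + f (1, 0)%N * g o2.
Proof. by rewrite /mul2 /gmul /fib2 /= !big_cons big_nil addr0. Qed.
Lemma mul2_01 (f g : S2) : mul2 f g (0, 1)%N = f o2 * g (0, 1)%N + f (0, 1)%N * g o2.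
Proof. by rewrite /mul2 /gmul /fib2 /= !big_cons big_nil addr0. Qed.
Lemma mul2_20 (f g : S2) : mul2 f g (2, 0)%N =
  f o2 * g (2, 0)%N + (f (1, 0)%N * g (1, 0)%N + f (2, 0)%N * g o2).
Proof. by rewrite /mul2 /gmul /fib2 /= !big_cons big_nil addr0. Qed.
Lemma mul2_11 (f g : S2) : mul2 f g (1, 1)%N = f o2 * g (1, 1)%N +
  (f (0, 1)%N * g (1, 0)%N + (f (1, 0)%N * g (0, 1)%N + f (1, 1)%N * g o2)).
Proof. by rewrite /mul2 /gmul /fib2 /= !big_cons big_nil addr0. Qed.
Lemma mul2_30 (f g : S2) : mul2 f g (3, 0)%N = f o2 * g (3, 0)%N +
  (f (1, 0)%N * g (2, 0)%N + (f (2, 0)%N * g (1, 0)%N + f (3, 0)%N * g o2)).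
Proof. by rewrite /mul2 /gmul /fib2 /= !big_cons big_nil addr0. Qed.

Definition mul2_low := (mul2_00, mul2_10, mul2_01, mul2_20, mul2_11, mul2_30).

Section Low.
Variables h p q : S2.
Hypotheses (p0 : p o2 = 0) (q0 : q o2 = 0).

Lemma comp_00 : scomp h p q o2 = h o2.
Proof. by rewrite /scomp /kcomp big_seq1 /mon /= /one2 eqxx mulr1. Qed.

Ltac low := rewrite /scomp /kcomp /low2 /box2 /wt2 /= !big_cons big_nil /mon /= !mul2_low /one2 /= p0 q0; ring.

Lemma comp_10 : scomp h p q (1, 0)%N = h (1, 0)%N * p (1, 0)%N + h (0, 1)%N * q (1, 0)%N.
Proof. low. Qed.
Lemma comp_01 : scomp h p q (0, 1)%N = h (1, 0)%N * p (0, 1)%N + h (0, 1)%N * q (0, 1)%N.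
Proof. low. Qed.
Lemma comp_20 : scomp h p q (2, 0)%N = h (1, 0)%N * p (2, 0)%N + h (0, 1)%N * q (2, 0)%N +
  h (2, 0)%N * p (1, 0)%N ^+ 2 + h (1, 1)%N * p (1, 0)%N * q (1, 0)%N + h (0, 2)%N * q (1, 0)%N ^+ 2.
Proof. low. Qed.
Lemma comp_11 : scomp h p q (1, 1)%N = h (1, 0)%N * p (1, 1)%N + h (0, 1)%N * q (1, 1)%N +
  h (2, 0)%N * (2 * p (1, 0)%N * p (0, 1)%N) +
  h (1, 1)%N * (p (1, 0)%N * q (0, 1)%N + p (0, 1)%N * q (1, 0)%N) +
  h (0, 2)%N * (2 * q (1, 0)%N * q (0, 1)%N).
Proof. low. Qed.
Lemma comp_30 : scomp h p q (3, 0)%N = h (1, 0)%N * p (3, 0)%N + h (0, 1)%N * q (3, 0)%N +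
  h (2, 0)%N * (2 * p (1, 0)%N * p (2, 0)%N) +
  h (1, 1)%N * (p (1, 0)%N * q (2, 0)%N + p (2, 0)%N * q (1, 0)%N) +
  h (0, 2)%N * (2 * q (1, 0)%N * q (2, 0)%N) +
  h (3, 0)%N * p (1, 0)%N ^+ 3 + h (2, 1)%N * p (1, 0)%N ^+ 2 * q (1, 0)%N +
  h (1, 2)%N * p (1, 0)%N * q (1, 0)%N ^+ 2 + h (0, 3)%N * q (1, 0)%N ^+ 3.
Proof. low. Qed.
End Low.

End Comp.

(** * Inverse function theorem *)

Section Inverse.
Variable R : realType.
Local Notation C := R[i].
Local Notation S2 := (I2 -> C).
Local Notation conv2' := (@conv R _ wt2).
Local Notation one2 := (one2 R).
Local Notation X2 := (X2 R).
Local Notation Y2 := (Y2 R).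

Definition agree n (f g : S2) := forall i, (wt2 i < n)%N -> f i = g i.

Lemma agree_mul k m n a b f f' g g' : agree m f f' -> agree n g g' -> ordge a f -> ordge b g' ->
  (k <= a + n)%N -> (k <= m + b)%N -> agree k (mul2 f g) (mul2 f' g').
Proof.
move=> ff gg of_ og kan kmb i ik; rewrite /mul2 /gmul big_seq [RHS]big_seq.
apply: eq_bigr => -[u v]; rewrite fib2P /= => /eqP e.
have wi : (wt2 u + wt2 v < k)%N by rewrite -wt2D e.
have vn : (a <= wt2 u)%N -> (wt2 v < n)%N.
  by move=> h; rewrite -(ltn_add2l a) (leq_trans _ kan) // (leq_ltn_trans _ wi) // leq_add2r.
have [um|um] := ltnP (wt2 u) m.
  rewrite -(ff u um); have [ua|ua] := ltnP (wt2 u) a; first by rewrite of_ // !mul0r.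
  by rewrite gg // vn.
have g0 : g' v = 0.
  by apply: og; rewrite -(ltn_add2l m) (leq_trans _ kmb) // (leq_ltn_trans _ wi) // leq_add2r.
rewrite g0 mulr0; have [ua|ua] := ltnP (wt2 u) a; first by rewrite of_ // mul0r.
by rewrite gg ?vn // g0 mulr0.
Qed.

Lemma agree_mon n (p p' q q' : S2) j : p o2 = 0 -> q o2 = 0 -> p' o2 = 0 -> q' o2 = 0 ->
  agree n.+1 p p' -> agree n.+1 q q' -> agree (n + wt2 j) (mon p q j) (mon p' q' j).
Proof.
move=> p0 q0 p0' q0' pp qq; case: j => a b; elim: a => [|a IH].
  elim: b => [|b IH]; first by [].
  have h := @agree_mul (n + wt2 (0, b.+1)%N) _ _ _ _ _ _ _ _ qq IH (order1 q0) (@order_mon R _ _ p0' q0' (0, b)%N).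
  by apply: h; rewrite /wt2 /= ?(addSn, addnS, add0n).
have h := @agree_mul (n + wt2 (a.+1, b)%N) _ _ _ _ _ _ _ _ pp IH (order1 p0) (@order_mon R _ _ p0' q0' (a, b)%N).
by apply: h; rewrite /wt2 /= ?(addSn, addnS, add0n).
Qed.

(** All monomials of [P] have degree at least 2, so agreement of the substituted series below weight
    n + 1 becomes agreement below n + 2: each iteration step gains one order. *)
Lemma agree_comp n (P p p' q q' : S2) : p o2 = 0 -> q o2 = 0 -> p' o2 = 0 -> q' o2 = 0 ->
  ordge 2 P -> agree n.+1 p p' -> agree n.+1 q q' -> agree n.+2 (scomp P p q) (scomp P p' q').
Proof.
move=> p0 q0 p0' q0' oP pp qq i hi; apply: eq_bigr => j _.
have [j2|j2] := ltnP (wt2 j) 2; first by rewrite oP // !mul0r.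
congr (_ * _); apply: (agree_mon p0 q0 p0' q0' pp qq).
by apply: leq_trans hi _; rewrite -addn2 leq_add2l.
Qed.

Lemma bnd_order n (s t M : C) F : 0 <= s -> 0 <= t -> t <= 1 -> ordge n F ->
  bnd wt2 s F M -> bnd wt2 (t * s) F (t ^+ n * M).
Proof.
move=> s0 t0 t1 oF hF; have := asumZ (t ^+ n) hF; rewrite ger0_norm ?exprn_ge0 //.
apply: asum_le => i; have [/oF ->|wi] := ltnP (wt2 i) n; first by rewrite !mul0r mulr0.
rewrite exprMn !normrM mulrCA ler_wpM2r ?mulr_ge0 //.
by rewrite !ger0_norm ?exprn_ge0 //; apply: ler_wiXn2l.
Qed.

(** * Picard iteration: stabilization and convergence *)

Section Fix.
Variables (a b c d : C) (P Q : S2).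
Hypotheses (oP : ordge 2 P) (oQ : ordge 2 Q).

(* Iteration for p = a z + b zeta + P(p, q), q = c z + d zeta + Q(p, q). *)
Definition istep (pq : S2 * S2) : S2 * S2 :=
  ((fun i => a * X2 i + b * Y2 i + scomp P pq.1 pq.2 i),
   (fun i => c * X2 i + d * Y2 i + scomp Q pq.1 pq.2 i)).
Definition it k := iter k istep (fun=> 0, fun=> 0).

Lemma it0 k : (it k).1 o2 = 0 /\ (it k).2 o2 = 0.
Proof.
case: k => [|k] //=; rewrite !comp_00 (oP (i := o2)) // (oQ (i := o2)) //.
by rewrite /X2 /Y2 /= !mulr0 !addr0.
Qed.

Lemma agree_istep n (p p' q q' : S2) : p o2 = 0 -> q o2 = 0 -> p' o2 = 0 -> q' o2 = 0 ->
  agree n.+1 p p' -> agree n.+1 q q' ->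
  agree n.+2 (istep (p, q)).1 (istep (p', q')).1 /\ agree n.+2 (istep (p, q)).2 (istep (p', q')).2.
Proof.
move=> p0 q0 p0' q0' pp qq; split=> i hi /=; congr (_ + _);
exact: (agree_comp p0 q0 p0' q0' _ pp qq hi).
Qed.

Lemma it_agree k : agree k.+1 (it k).1 (it k.+1).1 /\ agree k.+1 (it k).2 (it k.+1).2.
Proof.
elim: k => [|k [IH1 IH2]].
  have [h1 h2] := it0 1.
  by split=> -[u v]; rewrite /wt2 ltnS leqn0 addn_eq0 => /andP[/= /eqP -> /eqP ->]; rewrite ?h1 ?h2.
have [h1 h2] := it0 k; have [h3 h4] := it0 k.+1.
have [] := agree_istep h1 h2 h3 h4 IH1 IH2.
by rewrite -!surjective_pairing.
Qed.

Lemma it_agree_le k l : (k <= l)%N -> agree k.+1 (it k).1 (it l).1 /\ agree k.+1 (it k).2 (it l).2.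
Proof.
elim: l => [|l IH]; first by rewrite leqn0 => /eqP ->.
rewrite leq_eqVlt => /orP[/eqP -> //|kl].
have [h1 h2] := IH kl; have [h3 h4] := it_agree l.
split=> i hi.
  by rewrite h1 // h3 // (leq_trans hi).
by rewrite h2 // h4 // (leq_trans hi).
Qed.

(** Coefficients of weight w are stationary from the w-th iterate on, so this diagonal is the
    coefficientwise limit. *)
Definition fixp : S2 := fun i => (it (wt2 i)).1 i.
Definition fixq : S2 := fun i => (it (wt2 i)).2 i.

Lemma fix_agree k : agree k.+1 (it k).1 fixp /\ agree k.+1 (it k).2 fixq.
Proof.
by split=> i hi; have [h1 h2] := @it_agree_le (wt2 i) k hi; rewrite /fixp /fixq ?(h1 i) ?(h2 i).
Qed.

Lemma fix0 : fixp o2 = 0 /\ fixq o2 = 0.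
Proof. by []. Qed.

Lemma fixE i : fixp i = a * X2 i + b * Y2 i + scomp P fixp fixq i /\
  fixq i = c * X2 i + d * Y2 i + scomp Q fixp fixq i.
Proof.
have [p0 q0] := it0 (wt2 i); have [fp0 fq0] := fix0.
have [h1 h2] := fix_agree (wt2 i).
have [h3 h4] := agree_istep p0 q0 fp0 fq0 h1 h2.
have [h5 h6] := fix_agree (wt2 i).+1.
have e1 := h3 i (ltnW (ltnSn _)); have e2 := h4 i (ltnW (ltnSn _)).
have e3 := h5 i (ltnW (ltnSn _)); have e4 := h6 i (ltnW (ltnSn _)).
rewrite -surjective_pairing in e1 e2.
by split; [exact: etrans (esym e3) e1 | exact: etrans (esym e4) e2].
Qed.

Lemma bnd_lin (s u v : C) : 0 <= s ->
  bnd wt2 s (fun i => u * X2 i + v * Y2 i) ((`|u| + `|v|) * s).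
Proof.
move=> s0; rewrite mulrDl; have dl (j : I2) : wt2 j = 1%N -> bnd wt2 s (fun i => (i == j)%:R) s.
  move=> wj; have h i : i \notin [:: j] -> (i == j)%:R = 0 :> C.
    by rewrite inE => /negbTE ->.
  have := bnd_fin wt2 s (t := [:: j]) isT h.
  by rewrite big_seq1 eqxx mul1r wj expr1 ger0_norm.
by apply: bndD; apply: bndZ; apply: dl.
Qed.

(** All iterates stay in the ball of radius [sg] for the norm at radius [s]: one half of [sg] pays
    for the linear part, the other for the nonlinear part. *)
Lemma fix_conv : conv2' P -> conv2' Q -> conv2' fixp /\ conv2' fixq.
Proof.
move=> cP cQ; have [r [M [N [r0 hP hQ]]]] := conv2s cP cQ.
have M0 := asum_ge0 hP; have N0 := asum_ge0 hQ.
have r2 : 0 < r / 2 by rewrite divr_gt0.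
have [t [t0 t1 tMN]] := small_pick (addr_ge0 M0 N0) r2.
(* As [P] has order 2, its norm at radius sg = t r is at most t^2 M, and t M < r / 2 brings this
   below sg / 2; likewise for [Q]. *)
pose sg := t * r; have sg0 : 0 < sg by rewrite mulr_gt0.
have hP' : bnd wt2 sg P (sg / 2).
  apply: bndW (bnd_order (ltW r0) (ltW t0) t1 oP hP).
  rewrite expr2 -mulrA /sg -mulrA ler_pM2l // (le_trans _ (ltW tMN)) // ler_pM2l // lerDl //.
have hQ' : bnd wt2 sg Q (sg / 2).
  apply: bndW (bnd_order (ltW r0) (ltW t0) t1 oQ hQ).
  rewrite expr2 -mulrA /sg -mulrA ler_pM2l // (le_trans _ (ltW tMN)) // ler_pM2l // lerDr //.
pose K := `|a| + `|b| + (`|c| + `|d|).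
have sg2 : 0 < sg / 2 by rewrite divr_gt0.
have K0 : 0 <= K by rewrite !addr_ge0.
have [s [s0 _ sK]] := small_pick K0 sg2.
have l1 : (`|a| + `|b|) * s <= sg / 2.
  by rewrite (le_trans _ (ltW sK)) // mulrC ler_pM2l // /K lerDl addr_ge0.
have l2 : (`|c| + `|d|) * s <= sg / 2.
  by rewrite (le_trans _ (ltW sK)) // mulrC ler_pM2l // /K lerDr addr_ge0.
have hit k : bnd wt2 s (it k).1 sg /\ bnd wt2 s (it k).2 sg.
  elim: k => [|k [IH1 IH2]].
    by split=> u uu /=; rewrite big1 ?ltW // => i _; rewrite mul0r normr0.
  split; rewrite [X in bnd _ _ _ X]splitr.
    apply: bndD; first exact: bndW l1 (bnd_lin _ _ (ltW s0)).
    by apply: (kernel_bnd low2U (ltW s0) _ hP') => j; apply: bnd_mon.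
  apply: bndD; first exact: bndW l2 (bnd_lin _ _ (ltW s0)).
  by apply: (kernel_bnd low2U (ltW s0) _ hQ') => j; apply: bnd_mon.
(* A finite set of indices only sees coefficients of weight at most k, where the limit equals the
   k-th iterate. *)
split; exists s, sg; split => // u uu; pose k := \max_(i <- u) wt2 i;
  have [h1 h2] := hit k; [apply: le_trans (h1 u uu)|apply: le_trans (h2 u uu)];
  rewrite big_seq [leRHS]big_seq; apply: ler_sum => i iu;
  have [h3 h4] := fix_agree k; rewrite ?h3 ?h4 // ltnS; exact: (leq_bigmax_seq i).
Qed.
End Fix.

Section Id.
Variables p q : S2.
Hypotheses (p0 : p o2 = 0) (q0 : q o2 = 0) (cp : conv2' p) (cq : conv2' q).

Lemma comp_X : scomp X2 p q = p.
Proof.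
have cX : conv2' X2 := conv_delta2 R (1, 0)%N.
apply: E2_inj => //; first exact: conv_comp.
by apply: near0_mono (E2_comp p0 q0 cp cq cX) => z w ->; rewrite E2_X.
Qed.
Lemma comp_Y : scomp Y2 p q = q.
Proof.
have cY : conv2' Y2 := conv_delta2 R (0, 1)%N.
apply: E2_inj => //; first exact: conv_comp.
by apply: near0_mono (E2_comp p0 q0 cp cq cY) => z w ->; rewrite E2_Y.
Qed.
End Id.

Definition jac (f g : S2) : C := f (1, 0)%N * g (0, 1)%N - f (0, 1)%N * g (1, 0)%N.
Definition diffeo (f g : S2) : Prop :=
  [/\ conv2' f, conv2' g, f o2 = 0, g o2 = 0 & jac f g != 0].

Lemma order2_nonlin f : f o2 = 0 ->
  ordge 2 (fun i => f i - (f (1, 0)%N * X2 i + f (0, 1)%N * Y2 i)).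
Proof.
move=> f0 [[|[|a]] [|[|b]]] //= _; rewrite /X2 /Y2 /= ?f0; ring.
Qed.

Lemma right_inverse f g : diffeo f g ->
  exists p q, [/\ diffeo p q, scomp f p q = X2 & scomp g p q = Y2].
Proof.
move=> [cf cg f0 g0 J0]; set J := jac f g in J0.
pose H i := f i - (f (1, 0)%N * X2 i + f (0, 1)%N * Y2 i).
pose K i := g i - (g (1, 0)%N * X2 i + g (0, 1)%N * Y2 i).
have oH : ordge 2 H by exact: order2_nonlin.
have oK : ordge 2 K by exact: order2_nonlin.
have cX : conv2' X2 by exact: conv_delta2.
have cY : conv2' Y2 by exact: conv_delta2.
have cH : conv2' H by apply: convB => //; apply: convD; apply: convZ.
have cK : conv2' K by apply: convB => //; apply: convD; apply: convZ.
(* Applying the inverse Jacobian matrix to f(p, q) = z, g(p, q) = zeta gives a fixed point equation: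
   its linear part is that matrix, and (P, Q) is minus that matrix applied to the nonlinear parts
   (H, K). *)
pose P i := (- g (0, 1)%N / J) * H i + (f (0, 1)%N / J) * K i.
pose Q i := (g (1, 0)%N / J) * H i + (- f (1, 0)%N / J) * K i.
have oP : ordge 2 P by move=> i hi; rewrite /P oH // oK // !mulr0 addr0.
have oQ : ordge 2 Q by move=> i hi; rewrite /Q oH // oK // !mulr0 addr0.
have cP : conv2' P by apply: convD; apply: convZ.
have cQ : conv2' Q by apply: convD; apply: convZ.
set p := fixp (g (0, 1)%N / J) (- f (0, 1)%N / J) (- g (1, 0)%N / J) (f (1, 0)%N / J) P Q.
set q := fixq (g (0, 1)%N / J) (- f (0, 1)%N / J) (- g (1, 0)%N / J) (f (1, 0)%N / J) P Q.
have [cp cq] : conv2' p /\ conv2' q by exact: fix_conv.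
have [p0 q0] : p o2 = 0 /\ q o2 = 0 by exact: fix0.
have e i := fixE (g (0, 1)%N / J) (- f (0, 1)%N / J) (- g (1, 0)%N / J) (f (1, 0)%N / J) oP oQ i.
have pE i : p i = _ := (e i).1; have qE i : q i = _ := (e i).2.
have cPE i : scomp P p q i = (- g (0, 1)%N / J) * scomp H p q i + (f (0, 1)%N / J) * scomp K p q i.
  exact: comp_lin.
have cQE i : scomp Q p q i = (g (1, 0)%N / J) * scomp H p q i + (- f (1, 0)%N / J) * scomp K p q i.
  exact: comp_lin.
have split_lin h u v L i : (forall j, h j = u * X2 j + v * Y2 j + L j) ->
    scomp h p q i = u * p i + v * q i + scomp L p q i.
  move=> hE; transitivity (u * scomp X2 p q i + v * scomp Y2 p q i + scomp L p q i).
    rewrite /scomp /kcomp !mulr_sumr -!big_split; apply: eq_bigr => j _ /=; rewrite hE; ring.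
  by rewrite comp_X // comp_Y.
have fE i : scomp f p q i = f (1, 0)%N * p i + f (0, 1)%N * q i + scomp H p q i.
  by apply: split_lin => j; rewrite /H; ring.
have gE i : scomp g p q i = g (1, 0)%N * p i + g (0, 1)%N * q i + scomp K p q i.
  by apply: split_lin => j; rewrite /K; ring.
have fX : scomp f p q = X2.
  apply: funext => i; rewrite fE pE qE -/p -/q cPE cQE.
  by move: J0; rewrite /J /jac => J0; field.
have gY : scomp g p q = Y2.
  apply: funext => i; rewrite gE pE qE -/p -/q cPE cQE.
  by move: J0; rewrite /J /jac => J0; field.
exists p, q; split => //; split => //.
have h1 := congr1 (fun F : S2 => F (1, 0)%N) fX; have h2 := congr1 (fun F : S2 => F (0, 1)%N) fX.
have h3 := congr1 (fun F : S2 => F (1, 0)%N) gY; have h4 := congr1 (fun F : S2 => F (0, 1)%N) gY.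
rewrite /= (comp_10 _ p0 q0) /X2 /= in h1; rewrite /= (comp_01 _ p0 q0) /X2 /= in h2.
rewrite /= (comp_10 _ p0 q0) /Y2 /= in h3; rewrite /= (comp_01 _ p0 q0) /Y2 /= in h4.
apply/eqP => jpq; have : J * jac p q = 1.
  transitivity ((f (1, 0)%N * p (1, 0)%N + f (0, 1)%N * q (1, 0)%N) *
                (g (1, 0)%N * p (0, 1)%N + g (0, 1)%N * q (0, 1)%N) -
                (f (1, 0)%N * p (0, 1)%N + f (0, 1)%N * q (0, 1)%N) *
                (g (1, 0)%N * p (1, 0)%N + g (0, 1)%N * q (1, 0)%N)).
    by rewrite /J /jac; ring.
  by rewrite h1 h2 h3 h4; ring.
by rewrite jpq mulr0 => /esym/eqP; rewrite oner_eq0.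
Qed.

(** A right inverse (f', g') of the right inverse (p, q) satisfies f = f(p, q)(f', g') = f', and
    likewise g = g', so the right inverse is two-sided. *)
Lemma inverse f g : diffeo f g ->
  exists p q, [/\ diffeo p q, scomp f p q = X2, scomp g p q = Y2, scomp p f g = X2 & scomp q f g = Y2].
Proof.
move=> dfg; have [p [q [dpq fX gY]]] := right_inverse dfg.
have [f' [g' [dfg' pX qY]]] := right_inverse dpq.
have [cf cg f0 g0 _] := dfg; have [cp cq p0 q0 _] := dpq; have [cf' cg' f0' g0' _] := dfg'.
have hp := E2_comp f0' g0' cf' cg' cp; rewrite pX in hp.
have hq := E2_comp f0' g0' cf' cg' cq; rewrite qY in hq.
have hf := near_comp cf' cg' f0' g0' (E2_comp p0 q0 cp cq cf); rewrite fX in hf.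
have hg := near_comp cf' cg' f0' g0' (E2_comp p0 q0 cp cq cg); rewrite gY in hg.
have ff : f' = f.
  apply: (E2_inj cf' cf); apply: near0_mono (near0_and hf (near0_and hp hq)) => z w [+ [h1 h2]].
  by rewrite -h1 -h2 !E2_X !E2_Y.
have gg : g' = g.
  apply: (E2_inj cg' cg); apply: near0_mono (near0_and hg (near0_and hp hq)) => z w [+ [h1 h2]].
  by rewrite -h1 -h2 !E2_X !E2_Y.
by exists p, q; split => //; rewrite -ff -gg.
Qed.
End Inverse.

(** * Chain rule and Levi determinant *)

Section Chain.
Variable R : realType.
Local Notation C := R[i].
Local Notation S2 := (I2 -> C).
Local Notation S4 := (I4 -> C).
Local Notation conv2' := (@conv R _ wt2).
Local Notation conv4' := (@conv R _ wt4).
Local Notation one2 := (one2 R).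

(* [b = false] stands for the variable z, [b = true] for zeta. *)
Definition sel (b : bool) (i : I2) : nat := if b then i.2 else i.1.
Definition inc (b : bool) (i : I2) : I2 := if b then (i.1, i.2.+1) else (i.1.+1, i.2).
Definition D2 (b : bool) (f : S2) : S2 := fun i => (sel b i).+1%:R * f (inc b i).
Definition DL (b : bool) (F : S4) : S4 := fun i => (sel b i.1).+1%:R * F (inc b i.1, i.2).
Definition DR (b : bool) (F : S4) : S4 := fun i => (sel b i.2).+1%:R * F (i.1, inc b i.2).
Definition mulL (g : S2) (F : S4) : S4 := fun i => mul2 g (fun a => F (a, i.2)) i.1.
(** Multiplication by the conjugate of [g], reduced to [mulL] by conjugating before and after. *)
Definition mulR (g : S2) (F : S4) : S4 := herm (mulL g (herm F)).

Lemma inc_inj b : injective (inc b).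
Proof. by case: b => -[? ?] [? ?] [-> ->]. Qed.
Lemma wt2_inc b i : wt2 (inc b i) = (wt2 i).+1.
Proof. by case: b; rewrite /wt2 /= ?addnS ?addSn. Qed.

Lemma leq_sel b i : (sel b i <= wt2 i)%N.
Proof. by case: b; rewrite /wt2 /= ?leq_addr ?leq_addl. Qed.

(** The factor n i + 1 is at most 2 ^ w i, which halving the radius absorbs. *)
Lemma conv_deriv (I : eqType) (w : I -> nat) (n : I -> nat) (h : I -> I) (F : I -> C) :
  injective h -> (forall i, w (h i) = (w i).+1) -> (forall i, n i <= w i)%N ->
  conv w F -> conv w (fun i => (n i).+1%:R * F (h i)).
Proof.
move=> hi wh nw [s [M [s0 hM]]]; have s2 : 0 < s / 2 by rewrite divr_gt0.
exists (s / 2), (`|s^-1| * M); split => //.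
apply: asum_le (asumZ s^-1 (asum_bij hi hM)) => i /=.
have -> : s^-1 * (F (h i) * s ^+ w (h i)) = F (h i) * s ^+ w i.
  by rewrite wh exprS mulrCA mulKf ?gt_eqF.
have -> : (n i).+1%:R * F (h i) * (s / 2) ^+ w i =
    ((n i).+1%:R / 2 ^+ w i) * (F (h i) * s ^+ w i) by rewrite expr_div_n; ring.
rewrite normrM ler_piMl // normrM normfV normrX !normr_nat ler_pdivrMr ?exprn_gt0 // mul1r.
by rewrite -natrX ler_nat; apply: leq_ltn_trans (nw i) _; apply: ltn_expl.
Qed.

Lemma conv_D2 b f : conv2' f -> conv2' (D2 b f).
Proof. by apply: conv_deriv; [exact: inc_inj | exact: wt2_inc | exact: leq_sel]. Qed.

Lemma conv_DL b F : conv4' F -> conv4' (DL b F).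
Proof.
apply: (conv_deriv (n := fun i => sel b i.1) (h := fun i : I4 => (inc b i.1, i.2))).
- by move=> [? ?] [? ?] /= [/inc_inj -> ->].
- by move=> i; rewrite /wt4 wt2_inc addSn.
- by move=> i; rewrite (leq_trans (leq_sel b _)) // leq_addr.
Qed.
Lemma conv_DR b F : conv4' F -> conv4' (DR b F).
Proof.
apply: (conv_deriv (n := fun i => sel b i.2) (h := fun i : I4 => (i.1, inc b i.2))).
- by move=> [? ?] [? ?] /= [-> /inc_inj ->].
- by move=> i; rewrite /wt4 wt2_inc addnS.
- by move=> i; rewrite (leq_trans (leq_sel b _)) // leq_addl.
Qed.

Lemma sel_add b i j : sel b (add2 i j) = (sel b i + sel b j)%N.
Proof. by case: b. Qed.
Lemma sel_inc b i : sel b (inc b i) = (sel b i).+1.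
Proof. by case: b. Qed.
Lemma incP b i : (0 < sel b i)%N -> exists j, i = inc b j.
Proof. by case: b i => -[[|a] [|c]] //= _; [exists (0, c)%N|exists (a.+1, c)|exists (a, 0)%N|exists (a, c.+1)]. Qed.
Lemma add2_incl b i j : add2 (inc b i) j = inc b (add2 i j).
Proof. by case: b; rewrite /add2 /= ?addSn. Qed.
Lemma add2C i j : add2 i j = add2 j i.
Proof. by rewrite /add2 addnC [X in (_, X)]addnC. Qed.

Lemma fib_shift b i (phi : I2 -> I2 -> C) :
  \sum_(k <- fib2 (inc b i)) (sel b k.1)%:R * phi k.1 k.2 =
  \sum_(k <- fib2 i) (sel b k.1).+1%:R * phi (inc b k.1) k.2.
Proof.
rewrite (bigID (fun k => (0 < sel b k.1)%N)) /= [X in _ + X]big1 ?addr0; last first.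
  by move=> k; rewrite lt0n negbK => /eqP ->; rewrite mul0r.
have -> : \sum_(k <- fib2 i) (sel b k.1).+1%:R * phi (inc b k.1) k.2 =
    \sum_(k <- map (fun k => (inc b k.1, k.2)) (fib2 i)) (sel b k.1)%:R * phi k.1 k.2.
  by rewrite big_map; apply: eq_bigr => k _; rewrite /= sel_inc.
rewrite -big_filter; apply: perm_big; apply: uniq_perm.
- by rewrite filter_uniq ?fib2U.
- by rewrite map_inj_uniq ?fib2U // => -[? ?] [? ?] [/inc_inj -> ->].
move=> [u v]; rewrite mem_filter fib2P; apply/andP/mapP => [[su /eqP e]|[[u' v'] + [-> ->]]].
  have [u' /= eu] := incP su; exists (u', v); last by rewrite eu.
  by rewrite fib2P /=; apply/eqP; apply: (@inc_inj b); rewrite -add2_incl -eu.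
by rewrite fib2P /= => /eqP <-; rewrite sel_inc add2_incl eqxx.
Qed.

Lemma mul2C f g : mul2 f g = mul2 g f :> S2.
Proof.
apply: funext => i; rewrite /mul2 /gmul.
have -> : \sum_(k <- fib2 i) f k.1 * g k.2 =
    \sum_(k <- map (fun k => (k.2, k.1)) (fib2 i)) g k.1 * f k.2.
  by rewrite big_map; apply: eq_bigr => k _ /=; rewrite mulrC.
apply: perm_big; apply: uniq_perm; rewrite ?fib2U //.
  by rewrite map_inj_uniq ?fib2U // => -[? ?] [? ?] [-> ->].
move=> [u v]; apply/mapP/idP => [[[u' v'] + [-> ->]]|]; rewrite !fib2P /=.
  by rewrite add2C.
by rewrite add2C => h; exists (v, u); rewrite ?fib2P.
Qed.

(** In each term of the product the differentiated exponent is the sum of those of the two factors;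
    the two summands give the two sides of the rule after [fib_shift]. *)
Lemma leibniz b (f g : S2) i : D2 b (mul2 f g) i = mul2 (D2 b f) g i + mul2 f (D2 b g) i.
Proof.
have key (f' g' : S2) : \sum_(k <- fib2 (inc b i)) (sel b k.1)%:R * (f' k.1 * g' k.2) = mul2 (D2 b f') g' i.
  by rewrite (fib_shift b i (fun u v => f' u * g' v)); apply: eq_bigr => k _; rewrite /D2 mulrA.
rewrite -key (mul2C f (D2 b g)) -key.
have -> : \sum_(k <- fib2 (inc b i)) (sel b k.1)%:R * (g k.1 * f k.2) =
    \sum_(k <- fib2 (inc b i)) (sel b k.2)%:R * (f k.1 * g k.2).
  have -> : \sum_(k <- fib2 (inc b i)) (sel b k.2)%:R * (f k.1 * g k.2) =
      \sum_(k <- map (fun k => (k.2, k.1)) (fib2 (inc b i))) (sel b k.1)%:R * (g k.1 * f k.2).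
    by rewrite big_map; apply: eq_bigr => k _ /=; rewrite [f _ * _]mulrC.
  apply: perm_big; apply: uniq_perm; rewrite ?fib2U //.
    by rewrite map_inj_uniq ?fib2U // => -[? ?] [? ?] [-> ->].
  move=> [u v]; apply/idP/mapP => [|[[u' v'] + [-> ->]]]; rewrite !fib2P /=.
    by rewrite add2C => h; exists (v, u); rewrite ?fib2P.
  by rewrite add2C.
rewrite -big_split /D2 /mul2 /gmul mulr_sumr /=.
rewrite big_seq [RHS]big_seq; apply: eq_bigr => k; rewrite fib2P => /eqP e.
have -> : (sel b i).+1 = (sel b k.1 + sel b k.2)%N by rewrite -sel_add e sel_inc.
by rewrite natrD mulrDl.
Qed.

(** Passing to values reduces this to the same identity in [C], at the price of convergence
    hypotheses. *)
Lemma mul2CA f g h : conv2' f -> conv2' g -> conv2' h ->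
  mul2 f (mul2 g h) = mul2 g (mul2 f h) :> S2.
Proof.
move=> cf cg ch; have gh := conv_mul2 cg ch; have fh := conv_mul2 cf ch.
apply: E2_inj; try exact: conv_mul2.
apply: near0_mono (near0_and (near0_and (E2M cg ch) (E2M cf ch)) (near0_and (E2M cf gh) (E2M cg fh))).
by move=> z w [[e1 e2] [-> ->]]; rewrite e1 e2 mulrCA.
Qed.

Lemma mul2_lin a b f u v i : mul2 f (fun j => a * u j + b * v j) i = a * mul2 f u i + b * mul2 f v i :> C.
Proof.
by rewrite /mul2 /gmul !mulr_sumr -big_split; apply: eq_bigr => k _ /=; ring.
Qed.

Lemma eq_mul2 f g g' i : (forall j, g j = g' j) -> mul2 f g i = mul2 f g' i :> C.
Proof. by move=> h; apply: eq_bigr => k _; rewrite h. Qed.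

Lemma D2_one b i : D2 b one2 i = 0.
Proof.
have -> : D2 b one2 i = (sel b i).+1%:R * (inc b i == o2)%:R by [].
by case: b i => -[a c]; rewrite xpair_eqE /= ?andbF mulr0.
Qed.

Section Sub.
Variables p q : S2.
Hypotheses (p0 : p o2 = 0) (q0 : q o2 = 0) (cp : conv2' p) (cq : conv2' q).

Lemma conv_mon j : conv2' (mon p q j).
Proof.
case: j => a c; rewrite /mon /=; elim: a => [|a IH] /=; last exact: conv_mul2.
elim: c => [|c IH] /=; [exact: conv_one | exact: conv_mul2].
Qed.

(** For m = 0 or n = 0 the predecessor is a dummy value, erased by the numerical factor. *)
Lemma D2_mon b m n i : D2 b (mon p q (m, n)) i =
  m%:R * mul2 (D2 b p) (mon p q (m.-1, n)) i + n%:R * mul2 (D2 b q) (mon p q (m, n.-1)) i.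
Proof.
have cDp := conv_D2 b cp; have cDq := conv_D2 b cq.
elim: m i => [|m IH] i.
  rewrite mul0r add0r; elim: n i => [|n IH] i; first by rewrite mul0r D2_one.
  rewrite -[mon p q (0%N, n.+1)]/(mul2 q (mon p q (0%N, n))) leibniz.
  have e : mul2 q (D2 b (mon p q (0%N, n))) i = n%:R * mul2 (D2 b q) (mon p q (0%N, n)) i.
    transitivity (mul2 q (fun j => n%:R * mul2 (D2 b q) (mon p q (0, n.-1)%N) j + 0 * q j) i).
      by apply: eq_mul2 => j; rewrite IH mul0r addr0.
    rewrite mul2_lin mul0r addr0; case: n {IH} => [|n]; first by rewrite !mul0r.
    by rewrite mul2CA //; apply: conv_mon.
  by rewrite e /= -natr1; ring.
rewrite -[mon p q (m.+1, n)]/(mul2 p (mon p q (m, n))) leibniz.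
have e : mul2 p (D2 b (mon p q (m, n))) i = m%:R * mul2 (D2 b p) (mon p q (m, n)) i +
    n%:R * mul2 (D2 b q) (mon p q (m.+1, n.-1)) i.
  rewrite (eq_mul2 _ _ IH) mul2_lin; congr (_ + _).
    case: m {IH} => [|m]; first by rewrite !mul0r.
    by rewrite mul2CA //; apply: conv_mon.
  by rewrite mul2CA //; apply: conv_mon.
by rewrite e /= -natr1; ring.
Qed.

Lemma mul2_scomp g h i N1 N2 : (wt2 i < N1)%N -> (wt2 i < N2)%N ->
  mul2 g (scomp h p q) i =
  \sum_(a < N1) \sum_(c < N2) h (a : nat, c : nat) * mul2 g (mon p q (a : nat, c : nat)) i.
Proof.
move=> h1 h2.
transitivity (\sum_(k <- fib2 i) \sum_(a < N1) \sum_(c < N2)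
    h (a : nat, c : nat) * (g k.1 * mon p q (a : nat, c : nat) k.2)).
  rewrite /mul2 /gmul big_seq [RHS]big_seq; apply: eq_bigr => k; rewrite fib2P => /eqP e.
  have kw : (wt2 k.2 <= wt2 i)%N by rewrite -e wt2D leq_addl.
  rewrite (compE p0 q0 h (leq_ltn_trans kw h1) (leq_ltn_trans kw h2)).
  rewrite mulr_sumr; apply: eq_bigr => a _; rewrite mulr_sumr; apply: eq_bigr => c _.
  by rewrite mulrCA.
rewrite exchange_big; apply: eq_bigr => a _ /=; rewrite exchange_big; apply: eq_bigr => c _ /=.
by rewrite mulr_sumr.
Qed.

Lemma chain b h i : D2 b (scomp h p q) i =
  mul2 (D2 b p) (scomp (D2 false h) p q) i + mul2 (D2 b q) (scomp (D2 true h) p q) i.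
Proof.
pose N := (wt2 i).+1.
have iN : (wt2 i < N)%N by [].
have iN1 : (wt2 i < N.+1)%N by rewrite ltnW.
(* Differentiation lowers one exponent, so the range of that exponent is one shorter than that of
   the other. *)
rewrite (mul2_scomp _ (D2 false h) iN iN1) (mul2_scomp _ (D2 true h) iN1 iN).
have iiN : (wt2 (inc b i) < N.+1)%N by rewrite wt2_inc.
rewrite {1}/D2 (compE p0 q0 h iiN iiN).
transitivity (\sum_(a < N.+1) \sum_(c < N.+1)
   (h (a : nat, c : nat) * ((a : nat)%:R * mul2 (D2 b p) (mon p q ((a : nat).-1, c : nat)) i) +
    h (a : nat, c : nat) * ((c : nat)%:R * mul2 (D2 b q) (mon p q (a : nat, (c : nat).-1)) i))).
  rewrite mulr_sumr; apply: eq_bigr => a _; rewrite mulr_sumr; apply: eq_bigr => c _.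
  by rewrite -mulrDr -D2_mon /D2 mulrCA.
under eq_bigr do rewrite big_split.
rewrite big_split /=; congr (_ + _).
  rewrite big_ord_recl big1 ?add0r; last by move=> c _; rewrite mul0r mulr0.
  apply: eq_bigr => a _; apply: eq_bigr => c _ /=.
  by rewrite mulrA [h _ * _]mulrC.
apply: eq_bigr => a _; rewrite big_ord_recl mul0r mulr0 add0r.
by apply: eq_bigr => c _ /=; rewrite mulrA [h _ * _]mulrC.
Qed.

Lemma herm_comp4 F : herm (comp4 F p q) = comp4 (herm F) p q.
Proof.
apply: funext => i; rewrite /herm /comp4 /kcomp /low4 !big_allpairs exchange_big rmorph_sum /=.
apply: eq_bigr => a _; rewrite rmorph_sum; apply: eq_bigr => c _ /=.
by rewrite [LHS]conjM; congr (_ * _); rewrite /mon4 /tens [LHS]conjM /= conjCK mulrC.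
Qed.

Lemma hermK (F : S4) : herm (herm F) = F.
Proof. by apply: funext => -[a c]; rewrite /herm conjCK. Qed.

Lemma DR_herm b F : DR b F = herm (DL b (herm F)).
Proof.
apply: funext => -[a c]; rewrite /DR /DL /herm /= conjM conjCK; congr (_ * _).
by rewrite rmorph_nat.
Qed.

(** Only the conjugate variables are substituted here. The coefficient of the k-th conjugate
    monomial is then a finite combination of slices of F, and [comp4_slice] composes it with (p, q);
    all normalizations are read off this form. *)
Definition compR (F : S4) (k j1 : I2) : C := (scomp (fun j2 => (F (j1, j2))^*) p q k)^*.

Lemma comp4_slice F a k : comp4 F p q (a, k) = scomp (compR F k) p q a.
Proof.
rewrite /comp4 /scomp /kcomp /low4 big_allpairs; apply: eq_bigr => i _.
rewrite /compR /scomp /kcomp rmorph_sum mulr_suml; apply: eq_bigr => j _ /=.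
by rewrite conjM conjCK /mon4 /tens /=; ring.
Qed.

Lemma compR_DL b F k j : compR (DL b F) k j = D2 b (compR F k) j.
Proof.
rewrite /compR /D2 /DL /scomp /kcomp !rmorph_sum mulr_sumr; apply: eq_bigr => l _ /=.
by rewrite !conjM !rmorph_nat mulrA.
Qed.

Lemma DL_comp4 b F : DL b (comp4 F p q) =
  (fun i => mulL (D2 b p) (comp4 (DL false F) p q) i + mulL (D2 b q) (comp4 (DL true F) p q) i).
Proof.
apply: funext => -[a k]; rewrite {1}/DL /= comp4_slice.
rewrite -[LHS]/(D2 b (scomp (compR F k) p q) a) chain /mulL /=.
by congr (_ + _); apply: eq_mul2 => j; rewrite comp4_slice; apply: eq_bigr => l _; rewrite compR_DL.
Qed.

Lemma DR_comp4 b F : DR b (comp4 F p q) =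
  (fun i => mulR (D2 b p) (comp4 (DR false F) p q) i + mulR (D2 b q) (comp4 (DR true F) p q) i).
Proof.
rewrite DR_herm herm_comp4 DL_comp4; apply: funext => i.
by rewrite {1}/herm conjD /mulR !herm_comp4 !DR_herm !hermK.
Qed.
End Sub.

Lemma mul2_1 (f : S2) : mul2 one2 f = f.
Proof.
apply: funext => i; have m : (o2, i) \in fib2 i by rewrite fib2P; case: i => a c.
rewrite /mul2 /gmul (bigD1_seq _ m (fib2U i)) /=.
rewrite {1}/one2 eqxx mul1r big_seq_cond big1 ?addr0 // => -[u v]; rewrite fib2P /= => /andP[/eqP e ne].
rewrite /one2; case: eqP => [u0|]; last by rewrite mul0r.
by move: e ne; rewrite u0 => <-; case: v => a c; rewrite /add2 /= !add0n eqxx.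
Qed.

Lemma mulL_mul4 g F : mulL g F = mul4 (tens g one2) F.
Proof.
apply: funext => -[i j]; rewrite /mulL /mul2 /mul4 /gmul /fib4 [RHS]big_allpairs_dep.
apply: eq_bigr => k _; rewrite /tens.
have := congr1 (fun h : S2 => h j) (mul2_1 (fun l => F (k.2, l))).
rewrite /= => <-; rewrite /mul2 /gmul mulr_sumr; apply: eq_bigr => l _ /=.
by rewrite mulrA; congr (_ * _ * _); rewrite /one2 rmorph_nat.
Qed.

Lemma conv_mulL g F : conv2' g -> conv4' F -> conv4' (mulL g F).
Proof. by move=> cg cF; rewrite mulL_mul4; apply: conv_mul4 => //; apply: conv_tens => //; exact: conv_one. Qed.

Lemma E4_mulL g F : conv2' g -> conv4' F -> near0 (fun z w => E4 (mulL g F) z w = E2 g z w * E4 F z w).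
Proof.
move=> cg cF; rewrite mulL_mul4; have c1 := conv_one R.
have ct := conv_tens cg c1.
apply: near0_mono (near0_and (E4_tens cg c1) (E4M ct cF)) => z w [e ->].
by rewrite e E2_one rmorph1 mulr1.
Qed.

Lemma conv_mulR g F : conv2' g -> conv4' F -> conv4' (mulR g F).
Proof. by move=> cg cF; apply/conv_herm/conv_mulL/conv_herm. Qed.

Lemma E4_mulR g F : conv2' g -> conv4' F ->
  near0 (fun z w => E4 (mulR g F) z w = (E2 g z w)^* * E4 F z w).
Proof.
move=> cg cF; have ch := conv_herm cF.
apply: near0_mono (near0_and (E4_herm (conv_mulL cg ch)) (near0_and (E4_mulL cg ch) (E4_herm cF))).
by move=> z w [e1 [e2 e3]]; rewrite /mulR e1 e2 e3 conjM conjCK.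
Qed.

Lemma DL_mulR b g F : DL b (mulR g F) = mulR g (DL b F).
Proof.
apply: funext => -[i j]; rewrite /DL /mulR /mulL /herm /mul2 /gmul /= !rmorph_sum mulr_sumr.
by apply: eq_bigr => k _ /=; rewrite !conjM rmorph_nat conjCK; ring.
Qed.
Lemma DL_add b F G : DL b (fun i => F i + G i) = (fun i => DL b F i + DL b G i).
Proof. by apply: funext => i; rewrite /DL mulrDr. Qed.

(** * The Levi determinant under substitution *)

Definition levi b c F : S4 := DL b (DR c F).
Definition levi_det F : S4 := fun i =>
  mul4 (levi false false F) (levi true true F) i - mul4 (levi false true F) (levi true false F) i.

Lemma conv_levi b c F : conv4' F -> conv4' (levi b c F).
Proof. by move=> cF; apply/conv_DL/conv_DR. Qed.
Lemma conv_levi_det F : conv4' F -> conv4' (levi_det F).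
Proof. by move=> cF; apply: convB; apply: conv_mul4; apply: conv_levi. Qed.

Lemma E4_levi_det F : conv4' F -> near0 (fun z w => E4 (levi_det F) z w =
  E4 (levi false false F) z w * E4 (levi true true F) z w -
  E4 (levi false true F) z w * E4 (levi true false F) z w).
Proof.
move=> cF; have c b c := @conv_levi b c F cF.
have m1 := conv_mul4 (c false false) (c true true).
have m2 := conv_mul4 (c false true) (c true false).
apply: near0_mono (near0_and (E4B m1 m2) (near0_and (E4M (c false false) (c true true)) (E4M (c false true) (c true false)))).
by move=> z w [-> [-> ->]].
Qed.

(** Entry (b, c) of the congruence of the Levi matrix by the Jacobian matrix of (p, q). Second
    derivatives of p and q do not occur because p and q are holomorphic. *)
Lemma E4_levi_comp p q F b c : p o2 = 0 -> q o2 = 0 -> conv2' p -> conv2' q -> conv4' F ->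
  let L b' c' := comp4 (levi b' c' F) p q in
  near0 (fun z w => E4 (levi b c (comp4 F p q)) z w =
   (E2 (D2 c p) z w)^* * (E2 (D2 b p) z w * E4 (L false false) z w + E2 (D2 b q) z w * E4 (L true false) z w) +
   (E2 (D2 c q) z w)^* * (E2 (D2 b p) z w * E4 (L false true) z w + E2 (D2 b q) z w * E4 (L true true) z w)).
Proof.
move=> p0 q0 cp cq cF L.
have cDp b' := conv_D2 b' cp; have cDq b' := conv_D2 b' cq.
have cL b' c' : conv4' (L b' c') by apply: conv_comp4 => //; apply: conv_levi.
have cA e := conv_mulL (cDp b) (cL false e).
have cB e := conv_mulL (cDq b) (cL true e).
have e1 : levi b c (comp4 F p q) = (fun i =>
   mulR (D2 c p) (fun i => mulL (D2 b p) (L false false) i + mulL (D2 b q) (L true false) i) i +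
   mulR (D2 c q) (fun i => mulL (D2 b p) (L false true) i + mulL (D2 b q) (L true true) i) i).
  by rewrite /levi DR_comp4 // DL_add !DL_mulR !DL_comp4.
rewrite e1.
have cAB e := convD (cA e) (cB e).
have c1 := conv_mulR (cDp c) (cAB false); have c2 := conv_mulR (cDq c) (cAB true).
have h e := near0_and (E4D (cA e) (cB e)) (near0_and (E4_mulL (cDp b) (cL false e)) (E4_mulL (cDq b) (cL true e))).
apply: near0_mono (near0_and (near0_and (h false) (h true))
  (near0_and (E4D c1 c2) (near0_and (E4_mulR (cDp c) (cAB false)) (E4_mulR (cDq c) (cAB true))))).
move=> z w [[[h1 [h2 h3]] [h4 [h5 h6]]] [-> [-> ->]]].
by rewrite h1 h2 h3 h4 h5 h6.
Qed.

Lemma levi_det_comp4 p q F : p o2 = 0 -> q o2 = 0 -> conv2' p -> conv2' q -> conv4' F ->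
  levi_det F = (fun=> 0) -> levi_det (comp4 F p q) = (fun=> 0).
Proof.
move=> p0 q0 cp cq cF d0; have cc := conv_comp4 p0 q0 cp cq cF.
apply: funext; apply: E4_eq0; first exact: conv_levi_det.
have hL b c := near0_and (E4_levi_comp b c p0 q0 cp cq cF) (E4_comp p0 q0 cp cq (conv_levi b c cF)).
have hd := near_comp cp cq p0 q0 (E4_levi_det cF); rewrite d0 in hd.
apply: near0_mono (near0_and hd (near0_and (E4_levi_det cc) (near0_and (near0_and (hL false false) (hL false true)) (near0_and (hL true false) (hL true true))))).
move=> z w [d [-> [[[-> e1] [-> e2]] [[-> e3] [-> e4]]]]]; rewrite e1 e2 e3 e4.
rewrite E4_zero in d.
move: d; set a := E4 (levi false false F) _ _; set b := E4 (levi true true F) _ _.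
set c := E4 (levi false true F) _ _; set f := E4 (levi true false F) _ _ => d.
have ab : a * b = c * f by apply/eqP; rewrite -subr_eq0 -d.
set p1 := E2 (D2 false p) z w; set p2 := E2 (D2 true p) z w.
set q1 := E2 (D2 false q) z w; set q2 := E2 (D2 true q) z w.
(* The determinant is multiplied by the squared modulus of the Jacobian of (p, q). *)
transitivity ((p1 * q2 - q1 * p2) * (p1^* * q2^* - q1^* * p2^*) * (a * b - c * f)); first by ring.
by rewrite ab subrr mulr0.
Qed.
End Chain.

(** * Hypersurfaces and rigid transformations *)

Section Bridge.
Variable R : realType.
Local Notation C := R[i].
Local Notation S2 := (I2 -> C).
Local Notation S4 := (I4 -> C).
Local Notation conv2' := (@conv R _ wt2).
Local Notation conv4' := (@conv R _ wt4).
Local Notation one2 := (one2 R).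
Local Notation X2 := (X2 R).
Local Notation Y2 := (Y2 R).
Local Notation i10 := ((1, 0)%N : I2).
Local Notation i01 := ((0, 1)%N : I2).
Local Notation i20 := ((2, 0)%N : I2).
Local Notation i11 := ((1, 1)%N : I2).
Local Notation i30 := ((3, 0)%N : I2).

(* The formal counterpart of [in_H], without the open conditions [F (i10, i10) != 0]
   and [nondeg F != 0]. *)
Definition FH (F : S4) : Prop :=
  [/\ conv4' F, herm F = F, forall i, F (i, o2) = 0 & levi_det F = (fun=> 0)].
Definition nondeg (F : S4) : C := F (i10, i10) * F (i20, i01) - F (i10, i01) * F (i20, i10).
Definition cur2 (f : S2) : ser2 R := fun a b => f (a, b).
Definition cur4 (F : S4) : ser4 R := fun a b c d => F ((a, b), (c, d)).

Lemma un2K f : un2 (cur2 f) = f. Proof. by apply: funext => -[]. Qed.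
Lemma un4K F : un4 (cur4 F) = F. Proof. by apply: funext => -[[? ?] [? ?]]. Qed.

Lemma herm_sym (F : S4) i j : herm F = F -> F (i, j) = (F (j, i))^*.
Proof. by move=> h; rewrite -{1}h. Qed.

Lemma FH_0 F i : FH F -> F (o2, i) = 0 :> C.
Proof. by move=> [_ h p _]; rewrite (herm_sym _ _ h) p rmorph0. Qed.

Lemma Im0_conj (x : C) : complex.Im x = 0 <-> x^* = x.
Proof.
split=> [h|/CrealP].
  by apply: (conj_Creal (_ : x \is Num.real)); case: x h => a b /= ->; rewrite complex_real.
by case: x => a b; rewrite complex_real => /eqP.
Qed.

Lemma iter_Dz (F : ser4 R) a b : iter a (@Dz R) F 0%N b 0%N 0%N = a`!%:R * F a b 0%N 0%N.
Proof.
elim: a F => [|a IH] F; first by rewrite mul1r.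
by rewrite iterSr IH /Dz factS mulnC natrM mulrA.
Qed.
Lemma iter_Dzeta (F : ser4 R) a b : iter b (@Dzeta R) F a 0%N 0%N 0%N = b`!%:R * F a b 0%N 0%N.
Proof.
elim: b F => [|b IH] F; first by rewrite mul1r.
by rewrite iterSr IH /Dzeta factS mulnC natrM mulrA.
Qed.

Lemma eval4_0 (G : ser4 R) : eval4 G 0 0 = G 0 0 0 0%N.
Proof. exact: (E4_0 (un4 G)). Qed.
Lemma eval2_0 (h : ser2 R) : eval2 h 0 0 = h 0 0%N.
Proof. exact: (E2_0 (un2 h)). Qed.

Lemma pluriharmonicE (F : ser4 R) a b :
  eval4 (iter a (@Dz R) (iter b (@Dzeta R) F)) 0 0 = (a`!%:R * b`!%:R) * F a b 0%N 0%N.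
Proof.
by rewrite eval4_0 [LHS]iter_Dz iter_Dzeta mulrA.
Qed.

Lemma det_mx2 (A : 'M[C]_2) : \det A = A 0 0 * A 1 1 - A 0 1 * A 1 0.
Proof.
rewrite (expand_det_row _ 0) !big_ord_recl big_ord0 addr0 /cofactor !det_mx11 !mxE /=.
rewrite expr0 expr1 mul1r mulN1r mulrN.
by congr (A _ _ * A _ _ - A _ _ * A _ _); apply: val_inj.
Qed.

Lemma det_leviE (F : ser4 R) z w : \det (levi_mx F z w) =
  E4 (levi false false (un4 F)) z w * E4 (levi true true (un4 F)) z w -
  E4 (levi false true (un4 F)) z w * E4 (levi true false (un4 F)) z w.
Proof. by rewrite det_mx2 /levi_mx !mxE. Qed.

Lemma det_nondegE (F : ser4 R) : \det (nondeg2_mx F) = 2 * nondeg (un4 F).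
Proof.
rewrite det_mx2 /nondeg2_mx !mxE /= !eval4_0.
by rewrite /nondeg /un4 /Dz /Dzb /Dzetab /=; ring.
Qed.

Lemma unitmx_det (A : 'M[C]_2) : (A \in unitmx) = (\det A != 0).
Proof. by rewrite unitmxE unitfE. Qed.

Lemma rank1_det (A : 'M[C]_2) : \rank A = 1%N -> \det A = 0.
Proof. by move=> r1; apply/eqP; rewrite -[_ == 0]negbK -unitmx_det -row_free_unit /row_free r1. Qed.

Lemma det_rank1 (A : 'M[C]_2) : \det A = 0 -> A 0 0 != 0 -> \rank A = 1%N.
Proof.
move=> d0 a0; have : \rank A != 2%N.
  by have := row_free_unit A; rewrite /row_free unitmx_det d0 eqxx => ->.
have : \rank A != 0%N by rewrite mxrank_eq0; apply: contra a0 => /eqP ->; rewrite mxE.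
by have := rank_leq_row A; case: (\rank A) => [|[|[|n]]].
Qed.

Lemma in_H_FH (F : ser4 R) : in_H F -> FH (un4 F) /\ nondeg (un4 F) != 0.
Proof.
move=> [/conv4P cF [re [_ [ph [lv nd]]]]]; split; last first.
  by move: nd; rewrite unitmx_det det_nondegE; apply: contra => /eqP ->; rewrite mulr0.
split=> //.
- apply: E4_inj => //; first exact: conv_herm.
  apply: near0_mono (near0_and re (E4_herm cF)) => z w [h ->].
  by apply/Im0_conj.
- move=> [a b]; have /eqP := ph a b; rewrite pluriharmonicE !mulf_eq0 !pnatr_eq0.
  by rewrite !eqn0Ngt !fact_gt0 /= => /eqP.
apply: funext; apply: E4_eq0; first exact: conv_levi_det.
apply: near0_mono (near0_and lv (E4_levi_det cF)) => z w [r ->].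
by rewrite -det_leviE rank1_det.
Qed.

Lemma FH_in_H F : FH F -> F (i10, i10) != 0 -> nondeg F != 0 -> in_H (cur4 F).
Proof.
move=> [cF hF ph lv] f0 nd.
have cl := conv_levi false false cF.
split; first by apply/conv4P; rewrite un4K.
split.
  apply: near0_mono (E4_herm cF) => z w; rewrite hF => h.
  by apply/Im0_conj; rewrite -[eval4 _ _ _]/(E4 F z w).
split; first by rewrite eval4_0 /cur4 ph.
split; first by move=> a b; rewrite pluriharmonicE /cur4 ph mulr0.
split; last by rewrite unitmx_det det_nondegE un4K mulf_neq0 // pnatr_eq0.
(* F_{z zb} is nonzero at 0, hence nearby; with a vanishing determinant the rank is then exactly
   1. *)
have l0 : levi false false F (o2, o2) != 0 by rewrite /levi /DL /DR /= !mul1r.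
have hd := E4_levi_det cF; rewrite lv in hd.
apply: near0_mono (near0_and hd (near_neq0 cl l0)) => z w [e2 e3].
apply: det_rank1; first by rewrite det_leviE un4K -e2 E4_zero.
by rewrite /levi_mx mxE.
Qed.

Lemma in_RTP (f g : ser2 R) rho : in_RT f g rho <-> rho != 0 /\ diffeo (un2 f) (un2 g).
Proof.
have jE : \det (\matrix_(i < 2, j < 2)
     eval2 ((if j == 0 :> nat then @D2z R else @D2zeta R)
              (if i == 0 :> nat then f else g)) 0 0) = jac (un2 f) (un2 g).
  rewrite det_mx2 !mxE /= !eval2_0.
  by rewrite /jac /un2 /D2z /D2zeta /=; ring.
rewrite /in_RT unitmx_det jE !conv2P !eval2_0.
by split=> [[? [? [? [? []]]]]|[? []]].
Qed.

Lemma conv_slice F k : conv4' F -> conv2' (fun i => F (i, k)).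
Proof.
move=> [s [M [s0 hM]]]; exists s, (`|s^-1 ^+ wt2 k| * M); split => //.
have hi : injective (fun i : I2 => (i, k)) by move=> ? ? [].
apply: asum_le (asumZ (s^-1 ^+ wt2 k) (asum_bij hi hM)) => i /=.
rewrite /wt4 /= exprD le_eqVlt; apply/orP; left; apply/eqP; congr `|_|.
by rewrite exprVn; field; rewrite expf_neq0 // gt_eqF.
Qed.

Definition rigid_equiv (F F' : S4) : Prop := exists (f g : S2) (rho : R),
  [/\ rho != 0, diffeo f g &
      near0 (fun z w => E4 F' (E2 f z w) (E2 g z w) = rho%:C * E4 F z w)].

Lemma diffeo_comp (f g f' g' : S2) : diffeo f g -> diffeo f' g' ->
  diffeo (scomp f f' g') (scomp g f' g').
Proof.
move=> [cf cg f0 g0 j0] [cf' cg' f0' g0' j0']; split.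
- exact: conv_comp.
- exact: conv_comp.
- by rewrite comp_00.
- by rewrite comp_00.
rewrite /jac !comp_10 // !comp_01 //.
apply: contra (mulf_neq0 j0 j0') => /eqP <-; apply/eqP.
by rewrite /jac; ring.
Qed.

Lemma rigid_equiv_trans (F F' F'' : S4) : rigid_equiv F F' -> rigid_equiv F' F'' -> rigid_equiv F F''.
Proof.
move=> [f [g [r [r0 d h]]]] [f' [g' [r' [r0' d' h']]]].
exists (scomp f' f g), (scomp g' f g), (r' * r); split; first by rewrite mulf_neq0.
  exact: diffeo_comp.
have [cf cg f0 g0 _] := d; have [cf' cg' _ _ _] := d'.
apply: near0_mono (near0_and (near0_and h (near_comp cf cg f0 g0 h'))
  (near0_and (E2_comp f0 g0 cf cg cf') (E2_comp f0 g0 cf cg cg'))).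
move=> z w [[e1 e2] [e3 e4]]; apply: etrans (congr2 (E4 F'') e3 e4) _; apply: etrans e2 _.
by rewrite e1 mulrA; congr (_ * _); rewrite (rmorphM (real_complex R)).
Qed.

Lemma FH_scale (rho : R) F : FH F -> FH (fun i => rho%:C * F i).
Proof.
move=> [cF hF ph lv]; split.
- exact: convZ.
- apply: funext => i; rewrite /herm conjM -[(F (i.2, i.1))^*]/(herm F i) hF; congr (_ * _).
  by apply: (conj_Creal (_ : rho%:C \is Num.real)); rewrite complex_real.
- by move=> i; rewrite ph mulr0.
apply: funext => i; transitivity (rho%:C * rho%:C * levi_det F i); last by rewrite lv mulr0.
rewrite /levi_det /mul4 /gmul mulrBr !mulr_sumr; congr (_ - _);
by apply: eq_bigr => k _; rewrite /levi /DL /DR; ring.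
Qed.

Lemma FH_comp4 (F : S4) (p q : S2) : FH F -> diffeo p q -> FH (comp4 F p q).
Proof.
move=> [cF hF ph lv] [cp cq p0 q0 _]; split.
- exact: conv_comp4.
- by rewrite herm_comp4 hF.
- move=> i; rewrite comp4E comp_00 //= /scomp /kcomp big1 ?conjCK //.
  by move=> j _; rewrite ph mul0r.
exact: levi_det_comp4.
Qed.

(** Any diffeomorphism and nonzero scale produce a target. The equations on (p, q) are returned
    because they evaluate those slices of the target that are f or g composed with (p, q). *)
Lemma change (F : S4) (f g : S2) (rho : R) : FH F -> diffeo f g -> rho != 0 ->
  exists p q, [/\ diffeo p q, scomp f p q = X2, scomp g p q = Y2,
     FH (fun i => rho%:C * comp4 F p q i) & rigid_equiv F (fun i => rho%:C * comp4 F p q i)].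
Proof.
move=> hF d r0; have [p [q [dpq fX gY pX qY]]] := inverse d.
exists p, q; split => //; first exact/FH_scale/FH_comp4.
have [cF _ _ _] := hF; have [cp cq p0 q0 _] := dpq; have [cf cg f0 g0 _] := d.
exists f, g, rho; split => //.
have h1 := near_comp cf cg f0 g0 (near0_and (E4Z rho%:C (conv_comp4 p0 q0 cp cq cF)) (E4_comp p0 q0 cp cq cF)).
have h2 := E2_comp f0 g0 cf cg cp; rewrite pX in h2.
have h3 := E2_comp f0 g0 cf cg cq; rewrite qY in h3.
apply: near0_mono (near0_and h1 (near0_and h2 h3)) => z w [[-> ->] [e1 e2]].
by rewrite -e1 -e2 E2_X E2_Y.
Qed.

Lemma compR_10 (F : S4) (p q : S2) j : p o2 = 0 -> q o2 = 0 ->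
  compR p q F i10 j = F (j, i10) * (p i10)^* + F (j, i01) * (q i10)^*.
Proof. by move=> p0 q0; rewrite /compR comp_10 // !(conjD, conjM) !conjCK. Qed.
Lemma compR_01 (F : S4) (p q : S2) j : p o2 = 0 -> q o2 = 0 ->
  compR p q F i01 j = F (j, i10) * (p i01)^* + F (j, i01) * (q i01)^*.
Proof. by move=> p0 q0; rewrite /compR comp_01 // !(conjD, conjM) !conjCK. Qed.
Lemma compR_20 (F : S4) (p q : S2) j : p o2 = 0 -> q o2 = 0 ->
  compR p q F i20 j = F (j, i10) * (p i20)^* + F (j, i01) * (q i20)^* +
    F (j, i20) * (p i10)^* ^+ 2 + F (j, i11) * (p i10)^* * (q i10)^* + F (j, (0, 2)%N) * (q i10)^* ^+ 2.
Proof. by move=> p0 q0; rewrite /compR comp_20 // !(conjD, conjM, conjX) !conjCK. Qed.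
Lemma compR_11 (F : S4) (p q : S2) j : p o2 = 0 -> q o2 = 0 ->
  compR p q F i11 j = F (j, i10) * (p i11)^* + F (j, i01) * (q i11)^* +
    F (j, i20) * (2 * (p i10)^* * (p i01)^*) +
    F (j, i11) * ((p i10)^* * (q i01)^* + (p i01)^* * (q i10)^*) +
    F (j, (0, 2)%N) * (2 * (q i10)^* * (q i01)^*).
Proof. by move=> p0 q0; rewrite /compR comp_11 // !(conjD, conjM, conjX) !conjCK !rmorph1. Qed.

Lemma eq_scomp (h h' p q : S2) i : (forall j, h j = h' j) -> scomp h p q i = scomp h' p q i :> C.
Proof. by move=> e; apply: eq_bigr => j _; rewrite e. Qed.

Lemma mul4_0 (F G : S4) i : mul4 F G (i, o2) = mul2 (fun a => F (a, o2)) (fun a => G (a, o2)) i.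
Proof.
rewrite /mul4 /mul2 /gmul /fib4 big_allpairs_dep; apply: eq_bigr => k _.
by rewrite big_seq1.
Qed.

Lemma mul4_1010 (F G : S4) : mul4 F G (i10, i10) =
  F (o2, o2) * G (i10, i10) + F (o2, i10) * G (i10, o2) +
  F (i10, o2) * G (o2, i10) + F (i10, i10) * G (o2, o2).
Proof. by rewrite /mul4 /gmul /fib4 /fib2 /= !big_cons big_nil addr0 !addrA. Qed.

(** * Consequences of A = z *)

Section Normal.
Variable F : S4.
Hypotheses (hF : FH F) (A1 : forall j, F (j, i10) = X2 j).

(** With A = z the conjugate-free parts of F_{z zb} and F_{zeta zb} are 1 and 0, so the
    conjugate-free determinant is that of F_{zeta zetab}, which is the zeta-derivative of B. *)
Lemma FH_B (a b : nat) : F ((a, b.+1), i01) = 0.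
Proof.
have [_ _ _ lv] := hF; have := congr1 (fun G : S4 => G ((a, b), o2)) lv.
rewrite /levi_det !mul4_0.
have -> : (fun a0 : I2 => levi false false F (a0, o2)) = one2.
  apply: funext => -[c d]; rewrite /levi /DL /DR /= !mul1r A1 /X2 /one2 !xpair_eqE /= eqSS.
  by case: eqP => [->|_] /=; rewrite ?mul1r ?mulr0.
rewrite mul2_1 (eq_mul2 _ (g' := fun=> 0)); last first.
  move=> [c d]; rewrite /levi /DL /DR /= !mul1r A1 /X2 xpair_eqE /= andbF mulr0 //.
rewrite [X in _ - X]big1 ?subr0; last by move=> k _; rewrite mulr0.
by rewrite /levi /DL /DR /= mul1r => /eqP; rewrite mulf_eq0 pnatr_eq0 => /eqP.
Qed.

Lemma FH_B10 : F (i10, i01) = 0.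
Proof. by have [_ h _ _] := hF; rewrite (herm_sym _ _ h) A1 /X2 rmorph0. Qed.

Lemma FH_C01 : F (i01, i11) = 0.
Proof. by have [_ h _ _] := hF; rewrite (herm_sym _ _ h) FH_B rmorph0. Qed.

Lemma FH_E10 : F (i10, i20) = 0.
Proof. by have [_ h _ _] := hF; rewrite (herm_sym _ _ h) A1 /X2 rmorph0. Qed.

(** The Levi determinant at order z zb. Through this coefficient a z^2 term of the second coordinate
    acts on F_{3,0,1,1}. *)
Lemma FH_C11 : F (i11, i11) = 4 * F (i20, i01) * F (i01, i20).
Proof.
have [_ _ _ lv] := hF; have := congr1 (fun G : S4 => G (i10, i10)) lv.
rewrite /levi_det !mul4_1010 /levi /DL /DR /= !mul1r FH_B10 FH_C01 !FH_B !A1 /X2 /=.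
move=> e; apply/eqP; rewrite -subr_eq0 -e; apply/eqP; ring.
Qed.

(** B starts at z^2 and is free of zeta, so q does not enter. *)
Lemma scomp_B20 (p q : S2) : p o2 = 0 -> q o2 = 0 ->
  scomp (fun j => F (j, i01)) p q i20 = F (i20, i01) * p i10 ^+ 2.
Proof. by move=> p0 q0; rewrite comp_20 // FH_B10 !FH_B; ring. Qed.
Lemma scomp_B30 (p q : S2) : p o2 = 0 -> q o2 = 0 ->
  scomp (fun j => F (j, i01)) p q i30 =
  F (i20, i01) * (2 * p i10 * p i20) + F (i30, i01) * p i10 ^+ 3.
Proof. by move=> p0 q0; rewrite comp_30 // FH_B10 !FH_B; ring. Qed.
Lemma scomp_B10 (p q : S2) : p o2 = 0 -> q o2 = 0 -> scomp (fun j => F (j, i01)) p q i10 = 0.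
Proof. by move=> p0 q0; rewrite comp_10 // FH_B10 !FH_B; ring. Qed.
Lemma scomp_B01 (p q : S2) : p o2 = 0 -> q o2 = 0 -> scomp (fun j => F (j, i01)) p q i01 = 0.
Proof. by move=> p0 q0; rewrite comp_01 // FH_B10 !FH_B; ring. Qed.
End Normal.
End Bridge.

(** * Normal forms *)

Section Normalization.
Variable R : realType.
Local Notation C := R[i].
Local Notation S2 := (I2 -> C).
Local Notation S4 := (I4 -> C).
Local Notation X2 := (X2 R).
Local Notation Y2 := (Y2 R).
Local Notation i10 := ((1, 0)%N : I2).
Local Notation i01 := ((0, 1)%N : I2).
Local Notation i20 := ((2, 0)%N : I2).
Local Notation i11 := ((1, 1)%N : I2).
Local Notation i30 := ((3, 0)%N : I2).

Lemma conjV (a : C) : (a^-1 : C)^* = (a^*)^-1 :> C. Proof. exact: fmorphV. Qed.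

(* The conditions of [in_H7] on Taylor coefficients, which differ from the paper's
   coefficients by the factor a! b! c! d!. *)
Definition normal (F : S4) : Prop :=
  [/\ forall j, F (j, i10) = X2 j, forall j, F (j, i20) = 2^-1 * Y2 j,
      F (i30, i01) = 0 & F (i30, i11) = F (i11, i30)].

Lemma in_H7P (F : ser4 R) : in_H7 F <-> in_H F /\ normal (un4 F).
Proof.
have nz a b c d : dcoef4 F a b c d = 0 -> F a b c d = 0.
  move=> /eqP; rewrite /dcoef4 mulf_eq0 pnatr_eq0 !muln_eq0 !eqn0Ngt !fact_gt0 /= => /eqP //.
split=> [[hH [h1 [h2 [h3 [h4 [h5 h6]]]]]]|[hH [h1 h2 h3 h4]]].
  split => //; split.
  - move=> [a b]; rewrite /un4 /X2 /=; case: eqP => [[-> ->]|/eqP ne].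
      by move: h2; rewrite /dcoef4 !mulr1n mul1r.
    by rewrite nz ?h1.
  - move=> [a b]; rewrite /un4 /Y2 /=; case: eqP => [[-> ->]|/eqP ne].
      apply: (mulfI (_ : 2 != 0)); first by rewrite pnatr_eq0.
      by move: h4; rewrite /dcoef4 /= mulr1 mulfV ?pnatr_eq0.
    by rewrite nz ?h3 // mulr0.
  - exact: nz h5.
  - apply: (mulfI (_ : 6%:R != 0)); first by rewrite pnatr_eq0.
    by move: h6; rewrite /dcoef4.
split=> //; split=> [a b ne|].
  by have := h1 (a, b); rewrite /un4 /X2 /dcoef4 /= (negbTE ne) => ->; rewrite mulr0.
split; first by have := h1 i10; rewrite /un4 /X2 /dcoef4 /= => ->; rewrite mulr1.
split=> [a b ne|].
  by have := h2 (a, b); rewrite /un4 /Y2 /dcoef4 /= (negbTE ne) => ->; rewrite !mulr0.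
split.
  by have := h2 i01; rewrite /un4 /Y2 /dcoef4 /= => ->; rewrite mulr1 mulfV // pnatr_eq0.
split; first by move: h3; rewrite /un4 /dcoef4 /= => ->; rewrite mulr0.
by move: h4; rewrite /un4 /dcoef4 /= => ->.
Qed.

(** * Rigidity of maps between normal forms *)

Section Unique.
Variables (F F' : S4) (f g : S2) (rho : C).
Hypotheses (hF : FH F) (hF' : FH F') (nF : normal F) (nF' : normal F') (d : diffeo f g).
Hypotheses (r0 : rho != 0) (eqF : forall i, comp4 F' f g i = rho * F i).

(** The order of deductions matters: the missing z^3 terms of B and B' give f_zz(0) = 0, which then
    isolates g_z(0) in the zb slice; only after that does this slice reduce to f = c z and the zb^2
    slice simplify. *)
Lemma unique_linear : [/\ f i10 != 0, rho = f i10 * (f i10)^*,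
  forall j, f j = f i10 * X2 j & forall j, g j = f i10 / (f i10)^* * Y2 j].
Proof.
have [cf cg f0 g0 j0] := d.
have [A1 E1 B3 C3] := nF; have [A1' E1' B3' C3'] := nF'.
have [_ hm _ _] := hF; have [_ hm' _ _] := hF'.
have B2 : F (i20, i01) = 2^-1.
  by rewrite (herm_sym _ _ hm) E1 /Y2 mulr1 conjV rmorph_nat.
have B2' : F' (i20, i01) = 2^-1.
  by rewrite (herm_sym _ _ hm') E1' /Y2 mulr1 conjV rmorph_nat.
have n2 : 2 != 0 :> C by rewrite pnatr_eq0.
set c := f i10.
(* As A' = z, the first slice of F' composed with (f, g) is f itself. *)
have eq10 a : (f i10)^* * f a + (g i10)^* * scomp (fun j => F' (j, i01)) f g a = rho * X2 a.
  rewrite -(A1 a) -eqF comp4_slice // -{2}(comp_X f0 g0 cf cg) -comp_lin.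
  by apply: eq_scomp => j; rewrite compR_10 // A1'; ring.
have eq01 a : (f i01)^* * f a + (g i01)^* * scomp (fun j => F' (j, i01)) f g a = rho * F (a, i01).
  rewrite -eqF comp4_slice // -{2}(comp_X f0 g0 cf cg) -comp_lin.
  by apply: eq_scomp => j; rewrite compR_01 // A1'; ring.
have rhoE : rho = c * c^*.
  by have := eq10 i10; rewrite (scomp_B10 hF' A1') // /X2 /= mulr0 addr0 mulr1 mulrC => <-.
have c0 : c != 0 by apply: contra r0 => /eqP c0; rewrite rhoE c0 mul0r.
have cb0 : c^* != 0 by rewrite fmorph_eq0.
have f01 : f i01 = 0.
  have /eqP := eq10 i01; rewrite (scomp_B01 hF' A1') // /X2 /= !mulr0 addr0.
  by rewrite mulf_eq0 (negbTE cb0) => /eqP.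
(* The zetab slice at z^2, where B and B' both start with z^2 / 2. *)
have g01 : (g i01)^* * c = c^*.
  have := eq01 i20; rewrite f01 rmorph0 mul0r add0r (scomp_B20 hF' A1') // B2 B2' rhoE -/c => e.
  by apply: (mulIf c0); apply: (mulfI (_ : 2^-1 != 0)); rewrite ?invr_eq0 //; ring: e.
have gb0 : (g i01)^* != 0 by apply/eqP => e; move: cb0; rewrite -g01 e mul0r eqxx.
have f20 : f i20 = 0.
  have := eq01 i30; rewrite f01 rmorph0 mul0r add0r (scomp_B30 hF' A1') // B2' B3 B3' -/c.
  have -> : (g i01)^* * (2^-1 * (2 * c * f i20) + 0 * c ^+ 3) = (g i01)^* * c * f i20 by field.
  by rewrite mulr0 => /eqP; rewrite !mulf_eq0 (negbTE c0) (negbTE gb0) => /eqP.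
have g10 : g i10 = 0.
  have /eqP := eq10 i20; rewrite (scomp_B20 hF' A1') // f20 /X2 /= !mulr0 add0r.
  have h : 2^-1 * c ^+ 2 != 0 by rewrite mulf_neq0 ?invr_eq0 ?expf_neq0.
  by rewrite B2' mulf_eq0 (negbTE h) orbF fmorph_eq0 => /eqP.
have fE j : f j = c * X2 j.
  apply: (mulfI cb0); have := eq10 j; rewrite g10 rmorph0 mul0r addr0 -/c => ->.
  by rewrite rhoE; ring.
(* E' = zeta / 2 contributes a multiple of g, so this slice determines g as soon as [g i20] is known
   to vanish. *)
have eq20 a : (g i20)^* * scomp (fun j => F' (j, i01)) f g a + (2^-1 * c^* ^+ 2) * g a = rho * (2^-1 * Y2 a).
  rewrite -(E1 a) -eqF comp4_slice // -{3}(comp_Y f0 g0 cf cg) -comp_lin.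
  by apply: eq_scomp => j; rewrite compR_20 // A1' E1' f20 g10 -/c rmorph0; ring.
have eq11 : c^* * (g i01)^* * scomp (fun j => F' (j, i11)) f g i30 = rho * F (i30, i11).
  have e : (g i11)^* * scomp (fun j => F' (j, i01)) f g i30 = 0.
    by rewrite (scomp_B30 hF' A1') // B3' f20; ring.
  rewrite -eqF comp4_slice // -[LHS]add0r -e -comp_lin.
  apply: eq_scomp => j; rewrite compR_11 // f01 g10 fE /X2 /= -/c rmorph0 mulr0 rmorph0; ring.
have C11 : F' (i11, i11) = 1.
  by rewrite (FH_C11 hF' A1') B2' E1' /Y2 mulr1; field.
(* The zb^2 slice makes [K] purely imaginary, the zb zetab slice makes it real. *)
pose K := c^* ^+ 2 * g i20.
have K1 : K + K^* = 0.
  have := eq20 i20; rewrite (scomp_B20 hF' A1') // B2' /Y2 /= -/c !mulr0 => e.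
  have -> : K^* = c ^+ 2 * (g i20)^* by rewrite /K conjM conjX conjCK.
  by rewrite -[RHS](mulr0 2) -e /K; field.
have K2 : K = c * c^* * F (i30, i11) - (c * c^*) ^+ 2 * F' (i30, i11).
  move: eq11; rewrite comp_30 // f20 g10 (FH_C01 hF' A1') C11 fE /X2 /= -/c rhoE => e.
  have e2 : c * (c * c^* * F (i30, i11)) = c * (K + (c * c^*) ^+ 2 * F' (i30, i11)).
    have gq : (g i01)^* = c^* / c by rewrite -g01 mulfK.
    by rewrite -e /K gq; field.
  by rewrite (mulfI c0 e2); ring.
(* By hermitian symmetry, the last condition of [normal] says that this coefficient is real. *)
have real0 (G : S4) : herm G = G -> G (i30, i11) = G (i11, i30) -> (G (i30, i11))^* = G (i30, i11).
  by move=> h e; rewrite {2}e [RHS](herm_sym _ _ h).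
have K3 : K^* = K.
  rewrite K2 !(conjD, conjN, conjM, conjX) !conjCK (real0 _ hm C3) (real0 _ hm' C3').
  by rewrite [c^* * c]mulrC.
have K0 : K = 0.
  by move: K1; rewrite K3 => /eqP; rewrite -mulr2n mulrn_eq0 => /eqP.
have g20 : g i20 = 0.
  by move: K0 => /eqP; rewrite mulf_eq0 expf_eq0 (negbTE cb0) => /eqP.
split=> // j; have := eq20 j; rewrite g20 rmorph0 mul0r add0r rhoE => e.
apply: (mulfI (_ : 2^-1 * c^* ^+ 2 != 0)); first by rewrite mulf_neq0 ?invr_eq0 ?expf_neq0.
by rewrite e; field.
Qed.
End Unique.

(** * Existence: the three changes of coordinates *)

Lemma conjC_real (r : R) : (r%:C)^* = r%:C :> C.
Proof. by apply: (conj_Creal (_ : r%:C \is Num.real)); rewrite complex_real. Qed.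

Lemma FH_A00 (F : S4) : FH F -> F (i10, i10) = (complex.Re (F (i10, i10)))%:C.
Proof.
move=> [_ h _ _]; have e := herm_sym i10 i10 h.
by rewrite RRe_real //; apply/CrealP; rewrite -e.
Qed.

(** If F_{z zb}(0) = 0, the Levi determinant at 0 is minus the squared modulus of F_{z zetab}(0), so
    the whole first row of the 2-nondegeneracy matrix vanishes. *)
Lemma FH_1010_neq0 (F : S4) : FH F -> nondeg F != 0 -> F (i10, i10) != 0.
Proof.
move=> [_ h _ lv]; apply: contra => /eqP a0.
have := congr1 (fun G : S4 => G (o2, o2)) lv; rewrite /levi_det !mul4_0 !mul2_00 /levi /DL /DR /=.
rewrite !mul1r a0 mul0r sub0r (herm_sym i01 i10 h) => /eqP.
by rewrite oppr_eq0 -normCK expf_eq0 /= normr_eq0 /nondeg a0 => /eqP ->; rewrite !mul0r subrr.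
Qed.

Lemma normalize_A (F : S4) : FH F -> nondeg F != 0 ->
  exists F', [/\ rigid_equiv F F', FH F', forall j, F' (j, i10) = X2 j & F' (i20, i01) != 0].
Proof.
move=> hF nd; have a0 := FH_1010_neq0 hF nd; have aR := FH_A00 hF.
(* This scale gives f, hence p, the z-coefficient 1. As q = zeta, the new zb slice is then rho A(p,
   q) = f(p, q) = z. *)
pose rho : R := (complex.Re (F (i10, i10)))^-1.
have re0 : complex.Re (F (i10, i10)) != 0.
  by apply: contra a0 => /eqP e; rewrite aR e.
have rho0 : rho != 0 by rewrite invr_eq0.
have r0C : rho%:C != 0 :> C by rewrite -(rmorph0 (real_complex R)) (inj_eq (@complexI R)).
have rhoA : rho%:C * F (i10, i10) = 1.
  by rewrite aR /rho -rmorphM mulVf.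
pose f : S2 := fun j => rho%:C * F (j, i10).
have [cF hm ph lv] := hF.
have f0 : f o2 = 0 by rewrite /f (FH_0 _ hF) mulr0.
have d : diffeo f Y2.
  split => //; first exact/convZ/conv_slice.
  - exact: conv_delta2.
  - by rewrite /jac /f rhoA /Y2 /= mul1r mulr0 subr0 oner_eq0.
have [p [q [dp fX gY hF' eqv]]] := change hF d rho0.
have [cp cq p0 q0 _] := dp.
have qE : q = Y2 by rewrite -gY comp_Y.
have p10 : p i10 = 1.
  have := congr1 (fun h : S2 => h i10) fX; rewrite /= comp_10 // qE /X2 /Y2 /= mulr0 addr0.
  by rewrite /f rhoA mul1r.
have p01 : p i01 = - f i01.
  have := congr1 (fun h : S2 => h i01) fX; rewrite /= comp_01 // qE /X2 /Y2 /= mulr1 {1}/f rhoA mul1r.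
  by move/eqP; rewrite addr_eq0 => /eqP.
have p20 : p i20 = - f i20.
  have := congr1 (fun h : S2 => h i20) fX; rewrite /= comp_20 // qE p10 /X2 /Y2 /= {1}/f rhoA mul1r.
  by rewrite !(mulr0, addr0) expr1n mulr1 expr0n mulr0 addr0 => /eqP; rewrite addr_eq0 => /eqP.
have pE k : scomp (fun j => F (j, i10)) p q k = (rho%:C)^-1 * X2 k.
  rewrite -(congr1 (fun h : S2 => h k) fX) /= [in RHS]/scomp [in RHS]/kcomp mulr_sumr.
  by apply: eq_bigr => j _; rewrite /f -!mulrA mulKf.
exists (fun i => rho%:C * comp4 F p q i); split => //.
  move=> j; rewrite comp4_slice //; transitivity (rho%:C * ((rho%:C)^-1 * X2 j)); last by rewrite mulVKf.
  rewrite -pE; congr (_ * _); apply: eq_scomp => k.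
  by rewrite compR_10 // p10 qE /Y2 /= rmorph1 rmorph0 mulr1 mulr0 addr0.
rewrite comp4_slice //.
have -> : scomp (compR p q F i01) p q i20 = (p i01)^* * scomp (fun j => F (j, i10)) p q i20 +
    1 * scomp (fun j => F (j, i01)) p q i20.
  rewrite -comp_lin; apply: eq_scomp => j; rewrite compR_01 // qE /Y2 /= rmorph1; ring.
rewrite pE /X2 /= mulr0 mulr0 add0r mul1r comp_20 // p10 p20 qE /Y2 /f /=.
apply: mulf_neq0 => //.
(* The remaining factor equals [rho%:C * nondeg F]: 2-nondegeneracy is what keeps the new
   F_{2,0,0,1} nonzero. *)
have := mulf_neq0 r0C nd; apply: contra => /eqP e; apply/eqP.
transitivity (rho%:C * F (i10, i10) * F (i20, i01) - rho%:C * F (i10, i01) * F (i20, i10)).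
  by rewrite /nondeg; ring.
rewrite rhoA -[RHS]e; ring.
Qed.

(** K is - i Im(x) / 2, so that 2 K cancels the imaginary part of x. *)
Lemma real_im (x : C) : exists K, K + K^* = 0 /\ (x + 2 * K)^* = x + 2 * K.
Proof.
exists (- (x - x^*) / 4); have n4 : (4 : C)^* = 4 by rewrite rmorph_nat.
have n2 : (2 : C)^* = 2 by rewrite rmorph_nat.
have nK : (- (x - x^*) / 4)^* = (x - x^*) / 4.
  by rewrite conjM conjV n4 conjN conjD conjN conjCK; field.
split; first by rewrite nK mulNr addNr.
by rewrite conjD conjM nK n2; field.
Qed.

Lemma normalize_B (F : S4) : FH F -> (forall j, F (j, i10) = X2 j) -> F (i20, i01) != 0 ->
  exists F', [/\ rigid_equiv F F', FH F', forall j, F' (j, i10) = X2 j, F' (i20, i01) != 0 &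
    F' (i30, i01) = 0].
Proof.
move=> hF A1 b0; have [cF hm ph lv] := hF.
(* The inverse has p = z - kc b z^2 + ..., so the z^3 coefficient of B(p, q) is
   [F (i30, i01) - 2 * kc * b ^+ 2]; [kc] makes it vanish. *)
set b := F (i20, i01) in b0 *; pose kc := F (i30, i01) / (2 * b ^+ 2).
pose f : S2 := fun j => 1 * X2 j + kc * F (j, i01).
(* The z term of g gives q the z-coefficient [kc^*], so the new zb slice is p + kc B(p, q) = f(p, q)
   = z: the shear in zeta compensates the change of z. *)
pose g : S2 := fun j => 1 * Y2 j + (- kc^*) * X2 j.
have cX : conv (@wt2) X2 by exact: conv_delta2.
have cY : conv (@wt2) Y2 by exact: conv_delta2.
have f0 : f o2 = 0 by rewrite /f (FH_0 _ hF) /X2 /= !mulr0 addr0.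
have g0 : g o2 = 0 by rewrite /g /X2 /Y2 /= !mulr0 addr0.
have d : diffeo f g.
  split => //; try by apply: convD; apply: convZ => //; apply: conv_slice.
  rewrite /jac /f /g (FH_B10 hF A1) (FH_B hF A1) /X2 /Y2 /= !(mulr0, addr0, mulr1, mul0r, subr0).
  exact: oner_neq0.
have [p [q [dp fX gY hF' eqv]]] := change hF d (oner_neq0 R).
have [cp cq p0 q0 _] := dp.
have pE k : p k + kc * scomp (fun j => F (j, i01)) p q k = X2 k.
  by rewrite -(congr1 (fun h : S2 => h k) fX) /= comp_lin comp_X // mul1r.
have qE k : q k = Y2 k + kc^* * p k.
  rewrite -(congr1 (fun h : S2 => h k) gY) /= comp_lin comp_X // comp_Y //; ring.
have p10 : p i10 = 1 by have := pE i10; rewrite (scomp_B10 hF A1) // mulr0 addr0.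
have p01 : p i01 = 0 by have := pE i01; rewrite (scomp_B01 hF A1) // mulr0 addr0.
have p20 : p i20 = - (kc * b).
  have := pE i20; rewrite (scomp_B20 hF A1) // p10 expr1n mulr1 /X2 /= => /eqP.
  by rewrite addr_eq0 => /eqP.
have B' k : scomp (compR p q F i01) p q k = scomp (fun j => F (j, i01)) p q k.
  apply: eq_scomp => j; rewrite compR_01 // qE p01 /Y2 /= mulr0 addr0 rmorph0 rmorph1; ring.
exists (fun i => 1%:C * comp4 F p q i); split => //.
- move=> j; have pj : p j = 1 * scomp X2 p q j by rewrite comp_X // mul1r.
  rewrite comp4_slice // mul1r -pE pj -comp_lin; apply: eq_scomp => k.
  rewrite compR_10 // A1 qE p10 /Y2 /= add0r mulr1 conjCK rmorph1; ring.
- by rewrite comp4_slice // mul1r B' (scomp_B20 hF A1) // p10 expr1n mulr1.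
- rewrite comp4_slice // mul1r B' (scomp_B30 hF A1) // p10 p20 -/b /kc; field.
  exact: b0.
Qed.

Lemma normalize_E (F : S4) : FH F -> (forall j, F (j, i10) = X2 j) -> F (i20, i01) != 0 ->
  F (i30, i01) = 0 -> exists F', [/\ rigid_equiv F F', FH F' & normal F'].
Proof.
move=> hF A1 b0 B3; have [cF hm ph lv] := hF.
set b := F (i20, i01) in b0 *.
have bb0 : b^* != 0 by rewrite fmorph_eq0.
have n2 : 2 != 0 :> C by rewrite pnatr_eq0.
have E01 : F (i01, i20) = b^* by rewrite (herm_sym _ _ hm).
have E20 : (F (i20, i20))^* = F (i20, i20) by rewrite -(herm_sym _ _ hm).
(* The argument is the new coefficient of z^3 zb zetab when K = 0, as computed at the end of the
   proof; in general 2 K is added to it. *)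
have [K [K1 K2]] := real_im (F (i30, i11) / (2 * b) - F (i20, i20)).
(* [nu] must be the z^2 coefficient [q i20] of the inverse of (z, g); this fixes the real
   part of [b^* * nu], and [K] is the free imaginary part. *)
pose nu := (K - F (i20, i20) / 2) / b^*.
have nuE : b^* * nu = K - F (i20, i20) / 2 by rewrite /nu mulrC mulfVK.
have nuE' : b * nu^* = K^* - F (i20, i20) / 2.
  rewrite -[b in LHS]conjCK -conjM nuE conjD conjN conjM conjV E20; congr (_ - _ / _).
  by rewrite rmorph_nat.
(* With p = z and no z term in q, the new zb^2 slice is E + conj(q i20) B composed with (p, q). When
   [q i20 = nu], this is g(p, q) / 2 = zeta / 2. *)
pose g : S2 := fun j => 2 * F (j, i20) + (2 * nu^*) * F (j, i01).
have cX : conv (@wt2) X2 by exact: conv_delta2.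
have X0 : X2 o2 = 0 by [].
have g0 : g o2 = 0 by rewrite /g !(FH_0 _ hF) !mulr0 addr0.
have g10 : g i10 = 0 by rewrite /g (FH_E10 hF A1) (FH_B10 hF A1) !mulr0 addr0.
have g01 : g i01 = 2 * b^* by rewrite /g E01 (FH_B hF A1) mulr0 addr0.
have g20 : g i20 = - (2 * b^* * nu).
  rewrite /g -/b -[2 * nu^* * b]mulrA [nu^* * b]mulrC nuE' -mulrA nuE.
  have -> : K^* = - K by apply/eqP; rewrite -addr_eq0 addrC K1.
  by field.
have d : diffeo X2 g.
  split => //; first by apply: convD; apply: convZ; apply: conv_slice.
  by rewrite /jac g01 g10 /X2 /= mul1r mulr0 subr0 mulf_neq0.
have [p [q [dp fX gY hF' eqv]]] := change hF d (oner_neq0 R).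
have [cp cq p0 q0 _] := dp.
have pE : p = X2 by rewrite -fX comp_X.
have q10 : q i10 = 0.
  have /eqP := congr1 (fun h : S2 => h i10) gY; rewrite /= comp_10 // g10 g01 mul0r add0r /Y2 /=.
  by rewrite mulf_eq0 (negbTE (mulf_neq0 n2 bb0)) => /eqP.
have q01 : q i01 = (2 * b^*)^-1.
  have := congr1 (fun h : S2 => h i01) gY; rewrite /= comp_01 // g10 g01 mul0r add0r /Y2 /= => e.
  by apply: (mulfI (mulf_neq0 n2 bb0)); rewrite e mulfV // mulf_neq0.
have q20 : q i20 = nu.
  have := congr1 (fun h : S2 => h i20) gY; rewrite /= comp_20 // g10 g01 g20 q10 pE /X2 /Y2 /= => e.
  apply: (mulfI (mulf_neq0 n2 bb0)); apply/eqP; rewrite -subr_eq0; apply/eqP.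
  by apply: etrans e; ring.
have AE : forall j, 1%:C * comp4 F p q (j, i10) = X2 j.
  move=> j; rewrite comp4_slice // mul1r -(congr1 (fun h : S2 => h j) fX).
  by apply: eq_scomp => k; rewrite compR_10 // A1 q10 pE /X2 /= rmorph0 rmorph1; ring.
exists (fun i => 1%:C * comp4 F p q i); split => //; split => //.
- move=> j; rewrite comp4_slice // mul1r -(congr1 (fun h : S2 => h j) gY) /=.
  rewrite -[RHS]addr0 -[X in _ + X](mul0r (scomp g p q j)) -comp_lin.
  by apply: eq_scomp => k; rewrite compR_20 // q10 q20 pE /X2 /= rmorph0 rmorph1 /g; field.
- rewrite comp4_slice // mul1r.
  transitivity ((q i01)^* * scomp (fun j => F (j, i01)) p q i30 + 0 * scomp X2 p q i30).
    rewrite -comp_lin; apply: eq_scomp => k; rewrite compR_01 // pE /X2 /= rmorph0; ring.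
  by rewrite (scomp_B30 hF A1) // B3 pE /X2 /=; ring.
have [_ hm' _ _] := hF'; rewrite [RHS](herm_sym _ _ hm') /= comp4_slice //.
have -> : scomp (compR p q F i11) p q i30 = F (i30, i11) / (2 * b) - F (i20, i20) + 2 * K.
  transitivity ((q i11)^* * scomp (fun j => F (j, i01)) p q i30 +
                (q i01)^* * scomp (fun j => F (j, i11)) p q i30).
    rewrite -comp_lin; apply: eq_scomp => k.
    by rewrite compR_11 // q10 pE /X2 /= rmorph0 rmorph1; ring.
  rewrite (scomp_B30 hF A1) // B3 comp_30 // (FH_C01 hF A1) (FH_C11 hF A1) E01 q10 q20 q01 pE /X2 /=.
  have -> : ((2 * b^*)^-1)^* = (2 * b)^-1.
    by rewrite conjV conjM conjCK rmorph_nat.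
  transitivity ((2 * b)^-1 * (F (i30, i11) + 4 * b * (b^* * nu))); first by rewrite -/b; ring.
  rewrite nuE; field; exact: b0.
by rewrite conjM K2 conjC_real.
Qed.

Lemma normalize (F : S4) : FH F -> nondeg F != 0 -> exists F', [/\ rigid_equiv F F', FH F' & normal F'].
Proof.
move=> hF nd; have [F1 [e1 h1 A1 b1]] := normalize_A hF nd.
have [F2 [e2 h2 A2 b2 B2]] := normalize_B h1 A1 b1.
have [F3 [e3 h3 n3]] := normalize_E h2 A2 b2 B2.
by exists F3; split => //; apply: rigid_equiv_trans e1 (rigid_equiv_trans e2 e3).
Qed.

Lemma polar (c : C) : c != 0 -> exists r theta : R,
  [/\ 0 < r, 0 <= theta < 2 * pi & c = r%:C * expi theta].
Proof.
case: c => x y c0; pose r := Num.sqrt (x ^+ 2 + y ^+ 2).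
have s0 : 0 < x ^+ 2 + y ^+ 2.
  rewrite lt_neqAle addr_ge0 ?sqr_ge0 // andbT eq_sym paddr_eq0 ?sqr_ge0 // !sqrf_eq0.
  by move: c0; rewrite eq_complex.
have r0 : 0 < r by rewrite sqrtr_gt0.
have r2 : r ^+ 2 = x ^+ 2 + y ^+ 2 by rewrite sqr_sqrtr // ltW.
have xr : -1 <= x / r <= 1.
  rewrite -ler_norml normrM normfV (gtr0_norm r0) ler_pdivrMr // mul1r.
  by rewrite -(ler_pXn2r (n := 2)) ?nnegrE ?(ltW r0) // real_normK ?num_real // r2 lerDl sqr_ge0.
have sE : sin (acos (x / r)) = `|y| / r.
  rewrite sin_acos //; have -> : 1 - (x / r) ^+ 2 = (`|y| / r) ^+ 2.
    rewrite !expr_div_n real_normK ?num_real // r2; field.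
    by rewrite gt_eqF.
  by rewrite sqrtr_sqr ger0_norm // divr_ge0 // ltW.
have cE : cos (acos (x / r)) = x / r by rewrite acosK.
have pi0 := pi_gt0 R.
have th1 : 0 <= acos (x / r) by rewrite acos_ge0.
have th2 : acos (x / r) <= pi by rewrite acos_lepi.
have rn : r != 0 by rewrite gt_eqF.
have [y0|y0] := leP 0 y.
  exists r, (acos (x / r)); split => //; first by rewrite th1 /=; lra.
  rewrite /expi cE sE ger0_norm //; apply/eqP; rewrite eq_complex /= !mul0r subr0 addr0.
  by rewrite ![r * _]mulrC !divfK // !eqxx.
exists r, (2 * pi - acos (x / r)); split => //.
  (* y < 0 excludes the value 0 of acos, which keeps theta strictly below 2 pi. *)
  have th3 : 0 < acos (x / r).
    rewrite lt_neqAle th1 andbT eq_sym; apply/eqP => e; move: sE; rewrite e sin0 => /esym/eqP.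
    by rewrite mulf_eq0 normr_eq0 (lt_eqF y0) invr_eq0 (negbTE rn).
  by apply/andP; split; lra.
have e1 : cos (2 * pi - acos (x / r)) = x / r.
  by rewrite mulr_natl addrC cosD2pi cosN cE.
have e2 : sin (2 * pi - acos (x / r)) = y / r.
  by rewrite mulr_natl addrC sinD2pi sinN sE ltr0_norm // mulNr opprK.
rewrite /expi e1 e2; apply/eqP; rewrite eq_complex /= !mul0r subr0 addr0.
by rewrite ![r * _]mulrC !divfK // !eqxx.
Qed.

Lemma expi_unit (theta : R) : expi theta * (expi theta)^* = 1.
Proof.
apply/eqP; rewrite eq_complex /=; apply/andP; split; apply/eqP.
  by rewrite mulrN opprK -!expr2 cos2Dsin2.
by ring.
Qed.
End Normalization.

Unset Implicit Arguments.

Theorem theorem10p10 (R : realType) :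
  (forall F : ser4 R, in_H F ->
     exists (f g : ser2 R) (rho : R) (F7 : ser4 R),
       in_RT f g rho /\ in_H7 F7 /\ sends f g rho F F7) /\
  (forall (F7 F7' : ser4 R) (f g : ser2 R) (rho : R),
     in_H7 F7 -> in_H7 F7' -> in_RT f g rho -> sends f g rho F7 F7' ->
     exists r theta : R,
       0 < r /\ 0 <= theta < 2 * pi /\
       near0 (fun z w : R[i] =>
                eval2 f z w = r%:C * expi theta * z /\
                eval2 g z w = expi theta ^+ 2 * w) /\
       rho = r ^+ 2).
Proof.
split=> [F /in_H_FH[hF nd]|F F' f g rho].
  have [F' [[f [g [rho [r0 d h]]]] hF' nF']] := normalize hF nd.
  have [A1 E1 _ _] := nF'; have [_ hm _ _] := hF'.
  exists (cur2 f), (cur2 g), rho, (cur4 F'); split.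
    by apply/in_RTP; rewrite !un2K.
  split=> //; apply/in_H7P; rewrite un4K; split=> //.
  apply: FH_in_H => //; first by rewrite A1 oner_neq0.
  by rewrite /nondeg !A1 (herm_sym (2, 0)%N _ hm) E1 /X2 /Y2 /= mul1r mulr0 subr0 mulr1 fmorph_eq0 invr_eq0 pnatr_eq0.
move=> /in_H7P[/in_H_FH[hF _] nF] /in_H7P[/in_H_FH[hF' _] nF'] /in_RTP[r0 d] h.
have [cF _ _ _] := hF; have [cF' _ _ _] := hF'; have [cf cg f0 g0 _] := d.
have eqF : comp4 (un4 F') (un2 f) (un2 g) = fun i => rho%:C * un4 F i.
  apply: E4_inj; [exact: conv_comp4 | exact: convZ |].
  apply: near0_mono (near0_and (near0_and h (E4Z rho%:C cF)) (E4_comp f0 g0 cf cg cF')).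
  by move=> z w [[e1 ->] ->]; exact: e1.
have r0C : rho%:C != 0 :> R[i] by rewrite -(rmorph0 (real_complex R)) (inj_eq (@complexI R)).
have [c0 rE fE gE] := unique_linear hF hF' nF nF' d r0C (fun i => congr1 (fun G => G i) eqF).
have [r [theta [rp th cE]]] := polar c0.
have ee := expi_unit theta.
have e0 : expi theta != 0 by apply/eqP => e; move: ee; rewrite e mul0r => /esym/eqP; rewrite oner_eq0.
exists r, theta; split=> //; split=> //; split; last first.
  apply: (@complexI R); rewrite rE cE conjM conjC_real rmorphXn /=.
  by rewrite mulrACA ee mulr1 expr2.
(* f and g are now linear monomials, so the identities hold everywhere and any radius will do. *)
exists 1; split=> // z w _ _.
have -> : eval2 f z w = E2 (un2 f) z w by [].
have -> : eval2 g z w = E2 (un2 g) z w by [].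
have rn : r%:C != 0 :> R[i] by rewrite -(rmorph0 (real_complex R)) (inj_eq (@complexI R)) gt_eqF.
have gc : un2 f (1, 0)%N / (un2 f (1, 0)%N)^* = expi theta ^+ 2.
  rewrite cE conjM conjC_real -mulf_div mulfV // mul1r; apply: (mulIf (_ : (expi theta)^* != 0)).
    by rewrite fmorph_eq0.
  by rewrite mulfVK ?fmorph_eq0 // expr2 -mulrA ee mulr1.
split; apply: sums_E2.
  rewrite -cE; have := sumsZ (un2 f (1, 0)%N) (sums_delta2 (1, 0)%N z w).
  have -> : x2 z w (1, 0)%N = z by rewrite /x2 /= expr0 mulr1.
  by apply: eq_sums => i; rewrite [in RHS]fE mulrA.
rewrite -gc; have := sumsZ (un2 f (1, 0)%N / (un2 f (1, 0)%N)^*) (sums_delta2 (0, 1)%N z w).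
have -> : x2 z w (0, 1)%N = w by rewrite /x2 /= expr0 mul1r.
by apply: eq_sums => i; rewrite gE mulrA.
Qed.
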